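(* Assume that the error characteristic function $\hat f_\zeta$ satisfies (E1) and (E2), where $\beta>0$ is the exponent in (E1). Let $\alpha>-1/2$ be such that $\alpha+\beta>1/2$ and let $L>0$. For $z\ge 1$ put $$\lambda(z)=z^{1/[2\alpha+\max(2\beta,1)]},\qquad \psi(z)=\begin{cases} z^{-(2\alpha+1)/(4\alpha+4\beta)}, & \beta>1/2,\\ \sqrt{\ln z/z}, & \beta=1/2,\\ 1/\sqrt z, & \beta\in(0,1/2).\end{cases}$$ Then there exist positive constants $C_i=C_i(\alpha,L)$, $i=1,\dots,4$ (depending only on $\alpha$, $L$ and the error distribution) such that the following holds. 1. If $\lambda_\star=C_1\,\lambda(n)$, then for all $t_0\in\mathbb R$ and all large enough $n$, $$\mathrm{Risk}_2[\tilde F_{\lambda_\star};\mathcal F_\alpha(L)]\le C_2\,\psi(n).$$ 2. If $\lambda_\star=C_1\,\lambda\big(n/\ln(2\epsilon^{-1})\big)$, then for all $t_0\in\mathbb R$ and all large enough $n$, $$\mathrm{Risk}_\epsilon[\tilde F_{\lambda_\star};\mathcal F_\alpha(L)]\le C_3\,\psi\big(n/\ln(2\epsilon^{-1})\big),$$ provided that $\epsilon\ge 2\exp\{-C_4 n\}$.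
   Context: Model: $X_1,\dots,X_n$ are i.i.d. with distribution function $F$ on $\mathbb R$; one observes $Y_j=X_j+\zeta_j$, $j=1,\dots,n$, where the $\zeta_j$ are i.i.d., independent of the $X_j$, with a known Lebesgue density $f_\zeta$. For a function $g$ on $\mathbb R$, $\hat g(\omega)=\int_{-\infty}^{\infty} g(x)e^{i\omega x}\,dx$. It is assumed that $|\hat f_\zeta(\omega)|\neq 0$ for all $\omega\in\mathbb R$. The goal is to estimate $F(t_0)$ at a given $t_0\in\mathbb R$. Class $\mathcal F_\alpha(L)$ ($\alpha>-1/2$, $L>0$): all distributions $F$ on $\mathbb R$ having a Lebesgue density $f$ with $\frac1{2\pi}\int_{-\infty}^\infty|\hat f(\omega)|^2(1+\omega^2)^\alpha\,d\omega\le L^2$. Estimator: for $\lambda>0$, $$\tilde F_\lambda=\frac12-\frac1n\sum_{j=1}^n\frac1\pi\int_0^\lambda\frac1\omega\,\Im\Big\{\frac{e^{i\omega(Y_j-t_0)}}{\hat f_\zeta(\omega)}\Big\}\,d\omega .$$ Risks: $\mathrm{Risk}_2[\tilde F;\mathcal F]=\sup_{F\in\mathcal F}\{E|\tilde F-F(t_0)|^2\}^{1/2}$, and for $\epsilon\in(0,1/2)$, $\mathrm{Risk}_\epsilon[\tilde F;\mathcal F]=\min\{\delta:\sup_{F\in\mathcal F}P[|\tilde F-F(t_0)|>\delta]\le\epsilon\}$. (E1): there exist $\beta>0$, $c_\zeta>0$, $C_\zeta>0$ with $c_\zeta(1+\omega^2)^{-\beta/2}\le|\hat f_\zeta(\omega)|\le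 C_\zeta(1+\omega^2)^{-\beta/2}$ for all $\omega\in\mathbb R$. (E2): there exist positive $\omega_0,b_\zeta,\tau$ with $|\hat f_\zeta(\omega)|\ge 1-b_\zeta|\omega|^\tau$ for all $|\omega|\le\omega_0$. *)

(* Defs.v *)
From HB Require Import structures.
From mathcomp Require Import all_boot all_order all_algebra.
From mathcomp Require Import all_classical all_reals all_analysis.
From mathcomp Require Import complex.

Set Implicit Arguments.
Unset Strict Implicit.
Unset Printing Implicit Defensive.

Import Order.TTheory GRing.Theory Num.Theory.
Import numFieldNormedType.Exports.

Local Open Scope classical_set_scope.
Local Open Scope ring_scope.

Definition cexpi (R : realType) (t : R) : R[i] := Complex (cos t) (sin t).

(* The sign and normalisation are those of a characteristic function:
   the integral of g x * exp (i w x) over the real line. *)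
Definition fourier (R : realType) (g : R -> R) (w : R) : R[i] :=
  Complex (\int[@lebesgue_measure R]_x (g x * cos (w * x)))
          (\int[@lebesgue_measure R]_x (g x * sin (w * x))).

(* R-valued modulus; the norm of R[i] itself takes its values in R[i]. *)
Definition cmod (R : realType) (z : R[i]) : R := Normc.normc z.

Definition is_density (R : realType) (f : R -> R) : Prop :=
  [/\ measurable_fun setT f, (forall x, 0 <= f x) &
      (\int[@lebesgue_measure R]_x (f x)%:E = 1)%E].

Definition has_density (R : realType) (F f : R -> R) : Prop :=
  is_density f /\
  forall t, ((F t)%:E = \int[@lebesgue_measure R]_(x in `]-oo, t]) (f x)%:E)%E.

(* Distributions are represented by their distribution functions. *)
Definition sobolev_class (R : realType) (alpha L : R) : set (R -> R) :=
  [set F | exists f, has_density F f /\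
    (((2 * pi)^-1)%:E * \int[@lebesgue_measure R]_w
       (cmod (fourier f w) ^+ 2 * (1 + w ^+ 2) `^ alpha)%:E <= (L ^+ 2)%:E)%E].

Definition cond_E1 (R : realType) (fz : R -> R) (beta : R) : Prop :=
  0 < beta /\ exists c C : R, [/\ 0 < c, 0 < C &
    forall w, c * (1 + w ^+ 2) `^ (- beta / 2) <= cmod (fourier fz w)
              <= C * (1 + w ^+ 2) `^ (- beta / 2)].

Definition cond_E2 (R : realType) (fz : R -> R) : Prop :=
  exists w0 b tau : R, [/\ 0 < w0, 0 < b, 0 < tau &
    forall w, `|w| <= w0 -> 1 - b * `|w| `^ tau <= cmod (fourier fz w)].

Definition mutually_independent (R : realType) (d : measure_display)
    (T : measurableType d) (P : probability T R) (I : finType)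
    (X : I -> {RV P >-> R}) : Prop :=
  forall (J : {set I}) (B : I -> set R), (forall i, measurable (B i)) ->
    P (\big[setI/setT]_(i in J) (X i @^-1` B i)) =
    (\prod_(i in J) P (X i @^-1` B i))%E.

(* The X_j are i.i.d. with distribution function F, the zeta_j are i.i.d. with
   density fz, and the two samples are independent of each other; all this
   independence together is the mutual independence of the pooled family. *)
Definition deconv_model (R : realType) (fz F : R -> R) (n : nat)
    (d : measure_display) (T : measurableType d) (P : probability T R)
    (X zeta : 'I_n -> {RV P >-> R}) : Prop :=
  [/\ forall j t, cdf (X j) t = (F t)%:E,
      forall j (A : set R), measurable A ->
        (distribution P (zeta j) A =
          \int[@lebesgue_measure R]_(x in A) (fz x)%:E)%E &
      mutually_independent
        (fun k : 'I_n + 'I_n => match k with inl j => X j | inr j => zeta j end)].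

Definition deconv_estimator (R : realType) (fz : R -> R) (t0 lambda : R)
    (n : nat) (y : 'I_n -> R) : R :=
  2^-1 - n%:R^-1 * \sum_(j < n) (pi^-1 *
    \int[@lebesgue_measure R]_(w in `[0, lambda])
      (w^-1 * complex.Im (cexpi (w * (y j - t0)) / fourier fz w))).

Definition est_error (R : realType) (n : nat) (est : ('I_n -> R) -> R) (theta : R)
    (T : Type) (X zeta : 'I_n -> T -> R) (s : T) : R :=
  `|est (fun j => X j s + zeta j s) - theta|.

(* The expectation depends only on the joint law of the sample, hence only on F
   (fz and n being fixed), so letting the probability space vary together with F
   yields the supremum over F. *)
Definition risk2 (R : realType) (fz : R -> R) (n : nat)
    (est : ('I_n -> R) -> R) (t0 : R) (Fs : set (R -> R)) : \bar R :=
  ereal_sup [set r : \bar R | exists2 F, Fs F &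
    exists (d : measure_display) (T : measurableType d) (P : probability T R)
      (X zeta : 'I_n -> {RV P >-> R}),
      deconv_model fz F X zeta /\
      r = ('E_P[fun s => (est_error est (F t0) X zeta s ^+ 2)%R] `^ 2^-1)%E].

Definition sup_tail (R : realType) (fz : R -> R) (n : nat)
    (est : ('I_n -> R) -> R) (t0 : R) (Fs : set (R -> R)) (delta : R) : \bar R :=
  ereal_sup [set p : \bar R | exists2 F, Fs F &
    exists (d : measure_display) (T : measurableType d) (P : probability T R)
      (X zeta : 'I_n -> {RV P >-> R}),
      deconv_model fz F X zeta /\
      p = P [set s | delta < est_error est (F t0) X zeta s]].

(* sup_tail is nonincreasing and right-continuous in delta, so this infimum is
   the minimum. *)
Definition risk_eps (R : realType) (eps : R) (fz : R -> R) (n : nat)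
    (est : ('I_n -> R) -> R) (t0 : R) (Fs : set (R -> R)) : \bar R :=
  ereal_inf [set delta%:E | delta in
    [set delta : R | (sup_tail fz est t0 Fs delta <= eps%:E)%E]].

Definition rate_lambda (R : realType) (alpha beta z : R) : R :=
  z `^ (1 / (2 * alpha + Num.max (2 * beta) 1)).

Definition rate_psi (R : realType) (alpha beta z : R) : R :=
  if 1 / 2 < beta then z `^ (- (2 * alpha + 1) / (4 * alpha + 4 * beta))
  else if beta == 1 / 2 then Num.sqrt (ln z / z)
  else 1 / Num.sqrt z.

(* Main.v *)
Require Import Defs.
From HB Require Import structures.
From mathcomp Require Import all_boot all_order all_algebra.
From mathcomp Require Import all_classical all_reals all_analysis measurable_realfun.
From mathcomp Require Import complex ring lra.

Set Implicit Arguments.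
Unset Strict Implicit.

Import Order.TTheory GRing.Theory Num.Theory.
Import numFieldNormedType.Exports.

Local Open Scope classical_set_scope.
Local Open Scope ring_scope.

(** Write phi for the characteristic function [fourier fz] of the errors.  The
    estimator is the empirical mean of K(Y_j), where K(y) is 1/2 minus the
    integral over [0, lambda] of Im (e^{iw(y - t0)} / phi(w)) / (pi w).  The proof
    bounds the bias, the size and the second moment of K(Y_j) by powers of
    lambda and feeds these bounds into an exponential moment inequality of
    Bernstein type, from which both risks follow.

    Bias.  The characteristic function of Y = X + zeta is the product of those of
    X and zeta, so in the mean the division by phi undoes the noise
    ([mean_dint]), and E K(Y) is the Gil-Pelaez inversion formula for F(t0)
    ([gil_pelaez]) truncated at lambda.  What is cut off is at most the integral
    of |chi(w)|/w over w > lambda, where chi is the characteristic function of X,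
    and over the Sobolev class an arithmetic-geometric inequality bounds that by lambda^{-(alpha + 1/2)}
    ([inversion_tail_le]).

    Low frequencies.  The factor 1/w is not integrable at 0, so that K owes its
    boundedness to an oscillation.  Condition (E2) exhibits it.  The mean of
    1 - Re (e^{-iwm} phi(w)) over a random centre m with density fz is
    1 - |phi(w)|^2 = O(w^tau), hence for some fixed m that defect is integrable
    against w^{-1 - tau/2} ([exists_centering]).  Near 0 the kernel then differs
    from sin(w(u - m))/w by an integrable function that does not depend on u
    ([dkern_near0]), and the sine integral is bounded uniformly
    ([sine_integral_bounded]).

    High frequencies.  By (E1) the kernel is O(w^{beta - 1}), which gives the size
    lambda^beta ([normr_dint1_le]).  The second moment of an integral of
    p(w) sin(wY) + q(w) cos(wY) is a quadratic form in (p, q) whose coefficients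
    are values of the characteristic function of Y at w - w' and w + w'.  Schur's
    test bounds it by the L1 norm of that characteristic function times the
    squared L2 norm of (p, q) ([mean_square_trig_integral]), and the L1 norm is
    finite, uniformly over the class, because alpha + beta > 1/2
    ([charmod_integral_le]).  The resulting bound
    1 + int_1^lambda w^{2 beta - 2} dw is what makes psi change form at
    beta = 1/2.

    Concentration.  At lambda = lambda(z), with psi = psi(z), the three bounds read
    |K| <= k z psi, E K(Y)^2 <= k^2 z psi^2 and |bias| <= k psi
    ([exists_kernel_bound]).  Independence then bounds the exponential moment of
    the centred sum at s = +-1/(4 k z psi) by exp(n/(8z)).  For z = n this is a
    constant, and x^2 <= 4 (e^x + e^{-x}) yields the quadratic risk.  For
    z = n / ln(2/eps) the Chernoff bound at distance 8 k psi yields the tail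
    probability eps; the restriction eps >= 2 exp(-n/e) says that z >= e, the
    range in which the bounds on lambda(z) and psi(z) hold. *)
(** * Bounded measurable functions *)

Section bounded_measurable.
Context {R : realType}.

(** The random quantities below are bounded, and bounded measurable functions are
    stable under the operations that occur, including integration in one variable
    over a set of finite measure; integrability against a probability is then
    automatic. *)
Definition bmfun {d} {T : measurableType d} (f : T -> R) : Prop :=
  measurable_fun setT f /\ exists M, forall x, `|f x| <= M.

Section closure.
Context {d} {T : measurableType d}.
Implicit Types f g : T -> R.

Lemma bmfun_cst (k : R) : bmfun (fun _ : T => k).
Proof. by split; [exact: measurable_cst|exists `|k|]. Qed.

Lemma bmfunD f g : bmfun f -> bmfun g -> bmfun (fun x => f x + g x).
Proof.
move=> [mf [M fM]] [mg [N gN]]; split; first exact: measurable_funD.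
by exists (M + N) => x; rewrite (le_trans (ler_normD _ _))// lerD.
Qed.

Lemma bmfunM f g : bmfun f -> bmfun g -> bmfun (fun x => f x * g x).
Proof.
move=> [mf [M fM]] [mg [N gN]]; split; first exact: measurable_funM.
by exists (M * N) => x; rewrite normrM ler_pM.
Qed.

Lemma bmfunN f : bmfun f -> bmfun (fun x => - f x).
Proof.
move=> [mf [M fM]]; split; first exact: measurable_funN.
by exists M => x; rewrite normrN.
Qed.

Lemma bmfunB f g : bmfun f -> bmfun g -> bmfun (fun x => f x - g x).
Proof. by move=> bf bg; apply: bmfunD => //; exact: bmfunN. Qed.

Lemma bmfunX f n : bmfun f -> bmfun (fun x => f x ^+ n).
Proof.
move=> bf; elim: n => [|n ih]; first by under [X in bmfun X]eq_fun do
  rewrite expr0; exact: bmfun_cst.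
by under [X in bmfun X]eq_fun do rewrite exprS; exact: bmfunM.
Qed.

Lemma bmfun_norm f : bmfun f -> bmfun (fun x => `|f x|).
Proof.
move=> [mf [M fM]]; split; first exact: measurableT_comp.
by exists M => x; rewrite normr_id.
Qed.

Lemma bmfun_sum I (r : seq I) (F : I -> T -> R) :
  (forall i, bmfun (F i)) -> bmfun (fun x => \sum_(i <- r) F i x).
Proof.
move=> bF; elim: r => [|i r ih].
  by under [X in bmfun X]eq_fun do rewrite big_nil; exact: bmfun_cst.
by under [X in bmfun X]eq_fun do rewrite big_cons; exact: bmfunD.
Qed.

Lemma bmfun_prod I (r : seq I) (F : I -> T -> R) :
  (forall i, bmfun (F i)) -> bmfun (fun x => \prod_(i <- r) F i x).
Proof.
move=> bF; elim: r => [|i r ih].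
  by under [X in bmfun X]eq_fun do rewrite big_nil; exact: bmfun_cst.
by under [X in bmfun X]eq_fun do rewrite big_cons; exact: bmfunM.
Qed.

Lemma bmfun_indic (A : set T) : measurable A -> bmfun (\1_A : T -> R).
Proof.
move=> mA; split; first exact: measurable_indic.
by exists 1 => x; rewrite indicE; case: (x \in A); rewrite ?normr1 ?normr0.
Qed.

Lemma bmfun_sin f : measurable_fun setT f -> bmfun (fun x => sin (f x)).
Proof.
move=> mf; split.
  apply: measurableT_comp mf; apply: continuous_measurable_fun.
  exact: continuous_sin.
by exists 1 => x; rewrite ler_norml sin_geN1 sin_le1.
Qed.

Lemma bmfun_cos f : measurable_fun setT f -> bmfun (fun x => cos (f x)).
Proof.
move=> mf; split.
  apply: measurableT_comp mf; apply: continuous_measurable_fun.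
  exact: continuous_cos.
by exists 1 => x; rewrite ler_norml cos_geN1 cos_le1.
Qed.

Lemma bmfun_integrable (m : {measure set T -> \bar R}) D f :
  measurable D -> (m D < +oo)%E -> bmfun f -> m.-integrable D (EFin \o f).
Proof.
move=> mD Dy [mf [M fM]]; apply: measurable_bounded_integrable => //.
  exact: measurable_funTS.
exists M; split; first exact: num_real.
by move=> x Mx t _ /=; rewrite (le_trans (fM _))// ltW.
Qed.

End closure.

Lemma bmfun_comp {d d'} {T : measurableType d} {T' : measurableType d'}
    (f : T' -> R) (g : T -> T') :
  bmfun f -> measurable_fun setT g -> bmfun (fun x => f (g x)).
Proof.
move=> [mf [M fM]] mg; split; first exact: measurableT_comp.
by exists M => x.
Qed.

Section fubini.
Context {d1 d2} {T1 : measurableType d1} {T2 : measurableType d2}.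
Variables (m1 : {sigma_finite_measure set T1 -> \bar R})
          (m2 : {sigma_finite_measure set T2 -> \bar R}).
Variables (D1 : set T1) (D2 : set T2).
Hypotheses (mD1 : measurable D1) (mD2 : measurable D2).
Hypotheses (D1y : (m1 D1 < +oo)%E) (D2y : (m2 D2 < +oo)%E).

Lemma measurable_Rintegral_section (F : T1 * T2 -> R) :
  measurable_fun setT F ->
  measurable_fun setT (fun x => \int[m2]_(y in D2) F (x, y)).
Proof.
move=> mF; apply: measurableT_comp => //.
pose G := fun z : T1 * T2 => ((F z)%:E * (\1_D2 z.2)%:E)%E.
have mG : measurable_fun setT G.
  apply: emeasurable_funM; first exact/measurable_EFinP.
  apply/measurable_EFinP; apply: measurableT_comp; last exact: measurable_snd.
  exact: measurable_indic.
have -> : (fun x => \int[m2]_(y in D2) (F (x, y))%:E)%E =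
    (fubini_F m2 (G^\+) \- fubini_F m2 (G^\-))%E.
  apply/funext => x; transitivity (\int[m2]_y G (x, y))%E.
    rewrite integral_mkcond; apply: eq_integral => y _.
    by rewrite /G /patch indicE/=; case: (y \in D2); rewrite ?mule1// mule0.
  rewrite integralE.
  under eq_integral do rewrite funepos_comp/=.
  by under [X in (_ - X = _)%E]eq_integral do rewrite funeneg_comp/=.
apply: emeasurable_funB; apply: measurable_fun_fubini_tonelli_F => //.
  exact: measurable_funepos.
exact: measurable_funeneg.
Qed.

Lemma bmfun_Rintegral (F : T1 * T2 -> R) :
  bmfun F -> bmfun (fun x => \int[m2]_(y in D2) F (x, y)).
Proof.
move=> bF; have [mF [M FM]] := bF; split; first exact: measurable_Rintegral_section.
have bx x : bmfun (fun y => F (x, y)).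
  by apply: (@bmfun_comp _ _ _ _ F (fun y => (x, y)) bF); exact: measurable_pair1.
exists (M * fine (m2 D2)) => x.
apply: le_trans.
  by apply: le_normr_Rintegral => //; apply: bmfun_integrable.
rewrite -Rintegral_cst//; apply: le_Rintegral => //.
- by apply: bmfun_integrable => //; exact: bmfun_norm.
- by apply: bmfun_integrable => //; exact: bmfun_cst.
Qed.

End fubini.

(** Fubini's theorem concerns whole product spaces, so the integrand is
    first extended by 0 outside of D1 x D2. *)
Lemma bmfun_Fubini {d1 d2} {T1 : measurableType d1} {T2 : measurableType d2}
    (m1 : {sigma_finite_measure set T1 -> \bar R})
    (m2 : {sigma_finite_measure set T2 -> \bar R})
    (D1 : set T1) (D2 : set T2) (F : T1 * T2 -> R) :
  measurable D1 -> measurable D2 -> (m1 D1 < +oo)%E -> (m2 D2 < +oo)%E ->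
  bmfun F ->
  \int[m1]_(x in D1) \int[m2]_(y in D2) F (x, y) =
  \int[m2]_(y in D2) \int[m1]_(x in D1) F (x, y).
Proof.
move=> mD1 mD2 D1y D2y bF; have [mF [M FM]] := bF.
pose G := F \_ (D1 `*` D2).
have b1 x : bmfun (fun y => F (x, y)).
  by apply: (@bmfun_comp _ _ _ _ F (fun y => (x, y)) bF); exact: measurable_pair1.
have b2 y : bmfun (fun x => F (x, y)).
  by apply: (@bmfun_comp _ _ _ _ F (fun x => (x, y)) bF); exact: measurable_pair2.
have mDD : measurable (D1 `*` D2) by exact: measurableX.
have iG : (m1 \x m2)%E.-integrable setT (EFin \o G).
  have : (m1 \x m2)%E.-integrable (D1 `*` D2) (EFin \o F).
    apply: bmfun_integrable => //.
    rewrite [ltLHS](_ : _ = (m1 D1 * m2 D2)%E); last exact: product_measure1E.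
    by rewrite lte_mul_pinfty// ge0_fin_numE.
  move/integrable_mkcond => /(_ mDD).
  apply: eq_integrable => // z _.
  by rewrite /G/= restrict_EFin.
have := Fubini iG; rewrite /Rintegral => e.
congr fine.
transitivity (\int[m1]_x \int[m2]_y (EFin \o G) (x, y))%E; last first.
  rewrite e [RHS]integral_mkcond; apply: eq_integral => y _.
  rewrite /patch; case: ifPn => yD.
    rewrite fineK; last first.
      by apply: integrable_fin_num => //; apply: bmfun_integrable.
    rewrite [RHS]integral_mkcond; apply: eq_integral => x _.
    by rewrite /G /patch /= in_setX yD andbT; case: (x \in D1).
  apply: integral0_eq => x _.
  by rewrite /G /patch/= in_setX (negbTE yD) andbF.
rewrite [LHS]integral_mkcond; apply: eq_integral => x _.
rewrite /patch; case: ifPn => xD.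
  rewrite fineK; last first.
    by apply: integrable_fin_num => //; apply: bmfun_integrable.
  rewrite [LHS]integral_mkcond; apply: eq_integral => y _.
  by rewrite /G /patch /= in_setX xD/=; case: (y \in D2).
apply/esym/integral0_eq => y _.
by rewrite /G /patch/= in_setX (negbTE xD).
Qed.

End bounded_measurable.

(** * Measures with a density, and invariance of the Lebesgue measure *)

Lemma measurable_invr {R : realType} : measurable_fun setT (fun x : R => x^-1).
Proof.
have -> : [set: R] = [set 0] `|` ~` [set 0] by rewrite setUv.
have m0 : measurable [set (0 : R)] by exact: measurable_set1.
apply/(measurable_funU _ m0 (measurableC m0)); split.
  have e : {in [set 0], (fun _ : R => 0 : R) =1 (fun x : R => x^-1)}.
    by move=> x; rewrite inE/= => ->; rewrite invr0.
  exact: (eq_measurable_fun _ e).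
apply: subspace_continuous_measurable_fun; first exact: measurableC.
apply: continuous_in_subspaceT => x; rewrite inE/= => /eqP x0.
exact: inv_continuous.
Qed.

Section density.
Context {d} {T : measurableType d} {R : realType}.
Variable m : {measure set T -> \bar R}.
Variable W : T -> R.

Definition density_measure of measurable_fun setT W & (forall x, 0 <= W x) :=
  fun A : set T => (\int[m]_(x in A) (W x)%:E)%E.

Hypotheses (mW : measurable_fun setT W) (W0 : forall x, 0 <= W x).
Notation mu_W := (density_measure mW W0).

Let density0 : mu_W set0 = 0%E.
Proof. by rewrite /density_measure integral_set0. Qed.

Let density_ge0 A : (0 <= mu_W A)%E.
Proof. by apply: integral_ge0 => x _; rewrite lee_fin. Qed.

Let density_sigma_additive : semi_sigma_additive mu_W.
Proof.
move=> A mA tA mUA; rewrite /density_measure ge0_integral_bigcup//.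
- by apply: is_cvg_ereal_nneg_natsum_cond => n _ _; exact: density_ge0.
- by apply/measurable_EFinP; exact: measurable_funTS.
- by move=> x _; rewrite lee_fin.
Qed.

HB.instance Definition _ := isMeasure.Build _ _ _ mu_W
  density0 density_ge0 density_sigma_additive.

Import HBNNSimple.

(** True for indicators by definition of the measure, hence for simple functions
    by linearity and for the rest by monotone convergence along an
    approximation from below. *)
Lemma ge0_integral_density_measure (g : T -> \bar R) :
  measurable_fun setT g -> (forall x, 0 <= g x)%E ->
  (\int[mu_W]_x g x = \int[m]_x (g x * (W x)%:E))%E.
Proof.
move=> mg g0.
pose h := nnsfun_approx measurableT mg.
have nn n k x : (0 <= (k * \1_(h n @^-1` [set k]) x)%:E)%E.
  by rewrite EFinM nnfun_muleindic_ge0.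
have hW n x : (0 <= (h n x)%:E * (W x)%:E)%E by rewrite mule_ge0// lee_fin.
have mhW n : measurable_fun setT (fun x => (h n x)%:E * (W x)%:E)%E.
  by apply: emeasurable_funM; exact/measurable_EFinP.
transitivity (limn (fun n => \int[mu_W]_x (h n x)%:E)%E).
  rewrite -monotone_convergence//.
  - by apply: eq_integral => x _; apply/esym/cvg_lim => //; exact: cvg_nnsfun_approx.
  - by move=> n; exact/measurable_EFinP.
  - by move=> n x _; rewrite lee_fin.
  - by move=> x _ a b ab; rewrite lee_fin; exact/lefP/nd_nnsfun_approx.
transitivity (limn (fun n => \int[m]_x ((h n x)%:E * (W x)%:E))%E); last first.
  rewrite -monotone_convergence//.
  - apply: eq_integral => x _; apply/cvg_lim => //; apply: cvgeZr => //.
    exact: cvg_nnsfun_approx.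
  - move=> x _ a b ab; rewrite lee_wpmul2r ?lee_fin//.
    exact/lefP/nd_nnsfun_approx.
congr (limn _); apply/funext => n.
transitivity (\sum_(k \in range (h n))
    \int[m]_x ((k * \1_(h n @^-1` [set k]) x)%:E * (W x)%:E))%E; last first.
  rewrite -ge0_integral_fsum//.
  - apply: eq_integral => x _; rewrite [in RHS]fimfunE -fsumEFin//.
    by rewrite ge0_mule_fsuml// => k; exact: nn.
  - move=> k; apply: emeasurable_funM; last exact/measurable_EFinP.
    exact/measurable_EFinP/measurable_funM.
  - by move=> k x _; rewrite mule_ge0 ?lee_fin//; exact: nn.
under eq_integral do rewrite fimfunE -fsumEFin//.
rewrite ge0_integral_fsum//; last 2 first.
- by move=> y; exact/measurable_EFinP/measurable_funM.
- by move=> y x _; exact: nn.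
apply: eq_fsbigr => k; rewrite inE => -[t _ htk].
have k0 : 0 <= k by rewrite -htk.
rewrite integralZl_indic_nnsfun// integral_indic// setIT.
under [RHS]eq_integral do rewrite EFinM -muleA.
have mk : measurable_fun setT
    (fun x => (\1_(h n @^-1` [set k]) x)%:E * (W x)%:E)%E.
  by apply: emeasurable_funM; exact/measurable_EFinP.
rewrite ge0_integralZl//; last first.
  by move=> x _; rewrite mule_ge0 ?lee_fin.
congr (_ * _)%E; rewrite /density_measure [LHS]integral_mkcond.
apply: eq_integral => x _; rewrite /patch indicE.
by case: (x \in _); rewrite ?mul1e// mul0e.
Qed.

End density.

Section density_probability.
Context {R : realType} (f : R -> R).
Notation mu := (@lebesgue_measure R).

(** The underlying space is the copy of the real line on which the
    Lebesgue measure is declared. *)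
Definition density_probability (hf : is_density f) :
    set (measurableTypeR R) -> \bar R :=
  @density_measure _ (measurableTypeR R) R mu f
    (let: And3 mf _ _ := hf in mf) (let: And3 _ f0 _ := hf in f0).

Hypothesis hf : is_density f.

HB.instance Definition _ := Measure.on (density_probability hf).

Let density_probability_setT : density_probability hf setT = 1%E.
Proof. by case: hf. Qed.

HB.instance Definition _ := Measure_isProbability.Build _ _ _
  (density_probability hf) density_probability_setT.

Lemma integrable_density : mu.-integrable setT (EFin \o f).
Proof.
have [mf f0 f1] := hf; apply/integrableP; split; first exact/measurable_EFinP.
under eq_integral do rewrite /= ger0_norm//.
by rewrite f1 ltry.
Qed.

Lemma integrable_bmfunM_density (g : R -> R) : bmfun g ->
  mu.-integrable setT (EFin \o (fun x => g x * f x)).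
Proof.
move=> [mg [M gM]]; have [mf f0 f1] := hf.
have := integrableZl measurableT M integrable_density.
apply: le_integrable => //; first exact/measurable_EFinP/measurable_funM.
move=> x _; rewrite /= lee_fin normrM (ger0_norm (f0 x)).
by rewrite (le_trans _ (ler_norm _))// ler_wpM2r.
Qed.

Lemma Rintegral_density_probability (g : R -> R) : bmfun g ->
  \int[density_probability hf]_x g x = \int[mu]_x (g x * f x).
Proof.
move=> bg; have [mg [M gM]] := bg; have [mf f0 f1] := hf.
have Dy : (density_probability hf setT < +oo)%E.
  by rewrite density_probability_setT ltry.
have i1 : (density_probability hf).-integrable setT (EFin \o g).
  exact: bmfun_integrable.
have iM : (density_probability hf).-integrable setT (EFin \o (fun _ => M)).
  by apply: bmfun_integrable => //; exact: bmfun_cst.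
(* Adding the bound M reduces the claim to a nonnegative integrand. *)
have gM0 x : 0 <= g x + M by rewrite -lerBlDr sub0r lerNl (le_trans _ (gM x))// ler_normr lexx orbT.
have e : \int[density_probability hf]_x (g x + M) = \int[mu]_x ((g x + M) * f x).
  congr fine.
  rewrite ge0_integral_density_measure//.
  by apply/measurable_EFinP; exact: measurable_funD.
move: e; rewrite RintegralD// Rintegral_cst//= density_probability_setT mulr1.
under [in RHS]eq_Rintegral do rewrite mulrDl.
rewrite RintegralD//; last 2 first.
  exact: integrable_bmfunM_density.
  by apply: integrable_bmfunM_density; exact: bmfun_cst.
rewrite RintegralZl//; last exact: integrable_density.
by rewrite {3}/Rintegral f1/= mulr1 => /addIr.
Qed.

End density_probability.

Section lebesgue_invariance.
Context {R : realType}.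
Notation mu := (@lebesgue_measure R).

(** A map under which intervals keep their length preserves the Lebesgue measure,
    by uniqueness of the latter. *)
Let invariance (phi : measurableTypeR R -> measurableTypeR R) (mphi : measurable_fun setT phi) :
  (forall a b, a < b -> mu (phi @^-1` `]a, b]) = (b - a)%:E) ->
  forall f : R -> R, measurable_fun setT f -> (forall x, 0 <= f x) ->
  (\int[mu]_x (f (phi x))%:E = \int[mu]_x (f x)%:E)%E.
Proof.
move=> phiE f mf f0.
transitivity (\int[mu]_(x in phi @^-1` setT) ((EFin \o f) \o phi) x)%E.
  by rewrite preimage_setT.
have mEf : measurable_fun setT (EFin \o f) by exact/measurable_EFinP.
have f0' : {in setT, forall y, 0 <= (EFin \o f) y}%E.
  by move=> x _; rewrite lee_fin.
rewrite -(ge0_integral_pushforward mphi _ measurableT mEf f0').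
apply: eq_measure_integral => //= A mA _; apply/esym.
apply: lebesgue_measure_unique => // _ [[a b] _ <-]/=.
rewrite /pushforward.
have [ab|ba] := ltP a b; last first.
  by rewrite set_itv_ge ?bnd_simp ?preimage_set0 ?measure0// -leNgt.
by rewrite phiE// lebesgue_measure_itv/= lte_fin ab.
Qed.

Lemma ge0_integral_addl (a : R) (f : R -> R) :
  measurable_fun setT f -> (forall x, 0 <= f x) ->
  (\int[mu]_x (f (a + x))%:E = \int[mu]_x (f x)%:E)%E.
Proof.
apply: invariance => [|b c bc]; first exact: measurable_funD.
have -> : (fun x => a + x) @^-1` `]b, c] = `](b - a), (c - a)]%classic.
  by apply/seteqP; split=> x /=; rewrite !in_itv/=; lra.
rewrite lebesgue_measure_itv/= lte_fin ifT ?ltrD2r//.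
by rewrite -EFinB; congr EFin; lra.
Qed.

Lemma ge0_integral_subl (a : R) (f : R -> R) :
  measurable_fun setT f -> (forall x, 0 <= f x) ->
  (\int[mu]_x (f (a - x))%:E = \int[mu]_x (f x)%:E)%E.
Proof.
apply: invariance => [|b c bc]; first exact: measurable_funB.
have -> : (fun x => a - x) @^-1` `]b, c] = `[(a - c), (a - b)[%classic.
  by apply/seteqP; split=> x /=; rewrite !in_itv/=; lra.
rewrite lebesgue_measure_itv/= lte_fin ifT ?ltrD2l ?ltrN2//.
by rewrite -EFinB; congr EFin; lra.
Qed.

End lebesgue_invariance.

(** * Integrals of powers *)

Section FTC.
Context {R : realType}.
Notation mu := (@lebesgue_measure R).

Lemma integral_FTC2 (f F : R -> R) (a b : R) : a <= b ->
  (forall x, a <= x <= b -> is_derive x 1 F (f x)) ->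
  (forall x, a <= x <= b -> {for x, continuous f}) ->
  (\int[mu]_(x in `[a, b]) (f x)%:E = (F b - F a)%:E)%E.
Proof.
rewrite le_eqVlt => /predU1P[->|ab] dF cf.
  by rewrite set_itv1 integral_set1 subrr.
have cF x : a <= x <= b -> {for x, continuous F}.
  move=> xab; apply/differentiable_continuous/derivable1_diffP.
  by have [] := dF _ xab.
rewrite (@continuous_FTC2 _ f F)//.
- apply: continuous_in_subspaceT => x; rewrite inE/= in_itv/= => xab.
  exact: cf.
- split.
  + move=> x; rewrite in_itv/= => /andP[ax xb].
    by have [|] := dF x; rewrite ?ltW.
  + by apply: cvg_at_right_filter; apply: cF; rewrite lexx ltW.
  + by apply: cvg_at_left_filter; apply: cF; rewrite lexx ltW.
- move=> x; rewrite in_itv/= => /andP[ax xb].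
  rewrite derive1E; apply: derive_val.
  by apply: dF; rewrite !ltW.
Qed.

Lemma Rintegral_FTC2 (f F : R -> R) (a b : R) : a <= b ->
  (forall x, a <= x <= b -> is_derive x 1 F (f x)) ->
  (forall x, a <= x <= b -> {for x, continuous f}) ->
  \int[mu]_(x in `[a, b]) f x = F b - F a.
Proof. by move=> ab dF cf; rewrite /Rintegral (@integral_FTC2 f F). Qed.

Lemma continuous_at_powR (p x : R) : 0 < x -> {for x, continuous (@powR R ^~ p)}.
Proof.
move=> x0; apply/differentiable_continuous/derivable1_diffP.
by have [] := is_derive1_powR p x0.
Qed.

Lemma integral_powR (p a b : R) : p != 0 -> 0 < a -> a <= b ->
  (\int[mu]_(x in `[a, b]) (x `^ (p - 1))%:E =
    (p^-1 * b `^ p - p^-1 * a `^ p)%:E)%E.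
Proof.
move=> p0 a0 ab; apply: (@integral_FTC2 _ (fun x => p^-1 * x `^ p)) => //.
  move=> x /andP[ax _]; have x0 : 0 < x by exact: lt_le_trans ax.
  apply: is_derive_eq.
    by apply: is_deriveZ; exact: is_derive1_powR.
  by rewrite -[_ *: _]/(_ * _) mulKf.
by move=> x /andP[ax _]; apply: continuous_at_powR; exact: lt_le_trans ax.
Qed.

Lemma integral_powRN1 (a b : R) : 0 < a -> a <= b ->
  (\int[mu]_(x in `[a, b]) (x `^ (-1))%:E = (ln b - ln a)%:E)%E.
Proof.
move=> a0 ab; apply: (@integral_FTC2 _ (@ln R)) => //.
  move=> x /andP[ax _]; have x0 : 0 < x by exact: lt_le_trans ax.
  by rewrite powR_inv1 ?ltW//; exact: is_derive1_ln.
by move=> x /andP[ax _]; apply: continuous_at_powR; exact: lt_le_trans ax.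
Qed.

Lemma ge0_integral_bigcup_le d (T : measurableType d) (m : {measure set T -> \bar R})
    (F : (set T)^nat) (f : T -> \bar R) (K : \bar R) :
  {homo F : n m / (n <= m)%N >-> (n <= m)%O} -> (forall i, measurable (F i)) ->
  measurable_fun setT f -> (forall x, 0 <= f x)%E ->
  (forall i, \int[m]_(x in F i) f x <= K)%E ->
  (\int[m]_(x in \bigcup_i F i) f x <= K)%E.
Proof.
move=> Fnd mF mf f0 FK.
have h := @ge0_nondecreasing_set_cvg_integral _ _ _ F f m Fnd mF
  (fun i => measurable_funTS mf) (fun i x _ => f0 x).
by apply: (cvge_to_le h); near=> i; exact: FK.
Unshelve. all: by end_near. Qed.

(** Controls the kernel at the origin, where the exponents are tau/2 - 1.  The
    fundamental theorem applies on [1/n, 1], and the sets increase to ]0, 1]. *)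
Lemma integral_powR_near0 (p : R) : 0 < p ->
  (\int[mu]_(x in `]0%R, 1%R]) (x `^ (p - 1))%:E <= (p^-1)%:E)%E.
Proof.
move=> p0.
have e : `]0%R, 1%R]%classic = \bigcup_n `[(n.+1%:R^-1)%R, 1%R]%classic :> set R.
  apply/seteqP; split=> x /=.
    rewrite in_itv/= => /andP[x0 x1].
    exists (Num.truncn x^-1) => //=; rewrite in_itv/= x1 andbT.
    rewrite invf_ple ?posrE//.
    by rewrite ltW// truncnS_gt.
  move=> [n _ /=]; rewrite !in_itv/= => /andP[nx ->]; rewrite andbT.
  by rewrite (lt_le_trans _ nx)// invr_gt0.
rewrite e; apply: ge0_integral_bigcup_le => //.
- move=> n m nm; apply/subsetPset => x /=; rewrite !in_itv/= => /andP[nx ->].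
  by rewrite andbT (le_trans _ nx)// lef_pV2 ?posrE// ler_nat.
- by apply/measurable_EFinP; exact: measurable_powR.
- by move=> x; rewrite lee_fin powR_ge0.
- move=> n; rewrite integral_powR ?gt_eqF ?invr_gt0//; last first.
    by rewrite invf_le1// ler1n.
  by rewrite lee_fin powR1 mulr1 gerBl mulr_ge0 ?powR_ge0// invr_ge0 ltW.
Qed.

Lemma integral_powR_nearoo (p : R) : p < 0 ->
  (\int[mu]_(x in `[1%R, +oo[) (x `^ (p - 1))%:E <= (- p^-1)%:E)%E.
Proof.
move=> p0.
have e : `[1%R, +oo[%classic = \bigcup_n `[1%R, (n.+1%:R)%R]%classic :> set R.
  apply/seteqP; split=> x /=.
    rewrite in_itv/= andbT => x1.
    exists (Num.truncn x) => //=; rewrite in_itv/= x1/=.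
    by rewrite ltW// truncnS_gt.
  by move=> [n _ /=]; rewrite !in_itv/= => /andP[->].
rewrite e; apply: ge0_integral_bigcup_le => //.
- move=> n m nm; apply/subsetPset => x /=; rewrite !in_itv/= => /andP[-> xn].
  by rewrite (le_trans xn)// ler_nat.
- by apply/measurable_EFinP; exact: measurable_powR.
- by move=> x; rewrite lee_fin powR_ge0.
- move=> n; rewrite integral_powR ?lt_eqF ?ler1n//.
  rewrite lee_fin powR1 mulr1 gerDr mulr_le0_ge0 ?powR_ge0// invr_le0 ltW//.
Qed.

End FTC.

(** * The sine integral *)

Section pointwise_derivatives.
Context {R : realType}.
Implicit Types (f g : R -> R) (x a b c : R).

Lemma is_derive1D f g x a b : is_derive x 1 f a -> is_derive x 1 g b ->
  is_derive x 1 (fun y => f y + g y) (a + b).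
Proof. by move=> df dg; exact: is_deriveD. Qed.

Lemma is_derive1N f x a : is_derive x 1 f a ->
  is_derive x 1 (fun y => - f y) (- a).
Proof. by move=> df; exact: is_deriveN. Qed.

Lemma is_derive1M f g x a b : is_derive x 1 f a -> is_derive x 1 g b ->
  is_derive x 1 (fun y => f y * g y) (a * g x + f x * b).
Proof.
move=> df dg; apply: (is_derive_eq (is_deriveM df dg)).
by rewrite /GRing.scale/= addrC mulrC [f x * b]mulrC mulrC [b * _]mulrC.
Qed.

Lemma is_derive1_scale f x a c : is_derive x 1 f a ->
  is_derive x 1 (fun y => f y * c) (a * c).
Proof.
move=> df; have := is_derive1M df (is_derive_cst c x 1).
by rewrite mulr0 addr0.
Qed.

Lemma is_derive1_mulr x c : is_derive x 1 (fun y => y * c) c.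
Proof. by have := is_derive1_scale c (is_derive_id x 1); rewrite mul1r. Qed.

Lemma is_derive1_expR f x a : is_derive x 1 f a ->
  is_derive x 1 (fun y => expR (f y)) (expR (f x) * a).
Proof. by move=> df; exact: is_derive1_comp. Qed.

Lemma is_derive1_sin f x a : is_derive x 1 f a ->
  is_derive x 1 (fun y => sin (f y)) (cos (f x) * a).
Proof. by move=> df; exact: is_derive1_comp. Qed.

Lemma is_derive1_cos f x a : is_derive x 1 f a ->
  is_derive x 1 (fun y => cos (f y)) (- sin (f x) * a).
Proof. by move=> df; exact: is_derive1_comp. Qed.

Lemma is_derive1_continuous f x a : is_derive x 1 f a -> {for x, continuous f}.
Proof. by move=> df; apply/differentiable_continuous/derivable1_diffP; case: df. Qed.

End pointwise_derivatives.

Section domination.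
Context d (T : measurableType d) (R : realType) (m : {measure set T -> \bar R}).

Lemma le_integrable_norm (D : set T) (f g : T -> R) :
  measurable D -> measurable_fun setT f -> m.-integrable D (EFin \o g) ->
  (forall x, D x -> `|f x| <= g x) -> m.-integrable D (EFin \o f).
Proof.
move=> mD mf ig fg; apply: le_integrable ig => //.
  exact/measurable_EFinP/measurable_funTS.
by move=> x Dx /=; rewrite lee_fin (le_trans (fg _ Dx))// ler_norm.
Qed.

Lemma normr_Rintegral_le (D : set T) (f g : T -> R) :
  measurable D -> measurable_fun setT f -> m.-integrable D (EFin \o g) ->
  (forall x, D x -> `|f x| <= g x) ->
  `|\int[m]_(x in D) f x| <= \int[m]_(x in D) g x.
Proof.
move=> mD mf ig fg.
have iF := le_integrable_norm mD mf ig fg.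
apply: le_trans; first exact: le_normr_Rintegral.
by apply: le_Rintegral => //; exact: integrable_norm.
Qed.

Lemma integrable_EFinZl (D : set T) (c : R) (f : T -> R) :
  measurable D -> m.-integrable D (EFin \o f) ->
  m.-integrable D (EFin \o (fun x => c * f x)).
Proof.
move=> mD iF; have := integrableZl mD c iF.
by apply: eq_integrable => // x _; rewrite /= EFinM.
Qed.

Lemma bmfun_expNabs (f : T -> R) : measurable_fun setT f ->
  bmfun (fun x => expR (- `|f x|)).
Proof.
move=> mf; split.
  apply: measurableT_comp; first exact: measurable_expR.
  by apply: measurable_funN; apply: measurableT_comp.
by exists 1 => z; rewrite ger0_norm ?expR_ge0// -expR0 ler_expR oppr_le0.
Qed.

End domination.

Section dirichlet.
Context {R : realType}.
Notation mu := (@lebesgue_measure R).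

Lemma normr_sin_le (x : R) : `|sin x| <= `|x|.
Proof.
wlog x0 : x / 0 <= x => [hw|].
  have [x0|/ltW x0] := leP 0 x; first exact: hw.
  by rewrite -normrN -sinN -[leRHS]normrN hw// oppr_ge0.
have ds (y : R) : is_derive y 1 (@sin R) (cos y) by exact: is_derive_sin.
have [|c _] := MVT_segment x0 (fun y _ => ds y).
  apply: continuous_subspaceT => y; exact: continuous_sin.
rewrite sin0 !subr0 => ->; rewrite normrM ler_piMl// ler_norml.
by rewrite cos_geN1 cos_le1.
Qed.

Definition sine_integral (b v : R) : R :=
  \int[mu]_(w in `[0, b]) (sin (w * v) / w).

Lemma normr_sinc_le (v w : R) : `|sin (w * v) / w| <= `|v|.
Proof.
have [->|w0] := eqVneq w 0; first by rewrite invr0 mulr0 normr0.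
rewrite normrM normfV ler_pdivrMr ?normr_gt0// -normrM mulrC.
exact: normr_sin_le.
Qed.

Lemma bmfun_sinc (v : R) : bmfun (fun w : R => sin (w * v) / w).
Proof.
split.
  apply: measurable_funM; last exact: measurable_invr.
  by have [] := @bmfun_sin _ _ _ (fun w : R => w * v) (mulrr_measurable _).
by exists `|v| => w; exact: normr_sinc_le.
Qed.

Lemma lebesgue_itv_lty (a b : R) : (mu `[a, b] < +oo)%E.
Proof. by rewrite lebesgue_measure_itv/=; case: ifP; rewrite ?ltry. Qed.

Lemma bmfun_integrable_itv (f : R -> R) (a b : R) : bmfun f ->
  mu.-integrable `[a, b] (EFin \o f).
Proof. by move=> bf; apply: bmfun_integrable => //; exact: lebesgue_itv_lty. Qed.

Lemma le_normr_Rintegral_cst (f : R -> R) (a b M : R) : a <= b ->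
  measurable_fun setT f ->
  (forall x, a <= x <= b -> `|f x| <= M) ->
  `|\int[mu]_(x in `[a, b]) f x| <= M * (b - a).
Proof.
move=> ab mf fM.
have -> : M * (b - a) = \int[mu]_(x in `[a, b]) M.
  rewrite Rintegral_cst//= lebesgue_measure_itv/= lte_fin.
  by move: ab; rewrite le_eqVlt => /predU1P[->|->//]; rewrite ltxx subrr.
apply: normr_Rintegral_le => //.
by apply: bmfun_integrable_itv; exact: bmfun_cst.
Qed.

Lemma sine_integral_le (b v : R) : 0 <= b -> `|sine_integral b v| <= b * `|v|.
Proof.
move=> b0; rewrite mulrC -[b]subr0 /sine_integral subr0 -[X in _ * X]subr0.
apply: le_normr_Rintegral_cst => //; first by case: (bmfun_sinc v).
by move=> w _; exact: normr_sinc_le.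
Qed.

Lemma sine_integralN (b v : R) : sine_integral b (- v) = - sine_integral b v.
Proof.
transitivity (\int[mu]_(w in `[0, b]) (-1 * (sin (w * v) / w))).
  by apply: eq_Rintegral => w _; rewrite mulrN sinN mulN1r mulNr.
rewrite RintegralZl ?mulN1r//.
by apply: bmfun_integrable_itv; exact: bmfun_sinc.
Qed.

Lemma Rintegral_expN (b s : R) : 0 <= b -> s != 0 ->
  \int[mu]_(w in `[0, b]) expR (- (w * s)) = (1 - expR (- (b * s))) / s.
Proof.
move=> b0 s0.
have dE (x : R) : is_derive x 1 (fun w => expR (- (w * s)))
    (expR (- (x * s)) * - s).
  by apply: is_derive1_expR; apply: is_derive1N; exact: is_derive1_mulr.
pose F w := - (expR (- (w * s)) / s).
transitivity (F b - F 0); last by rewrite /F mul0r oppr0 expR0; field.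
apply: Rintegral_FTC2 => //.
- move=> x _; rewrite /F.
  apply: (is_derive_eq (is_derive1N (is_derive1_scale s^-1 (dE x)))).
  by field.
- by move=> x _; apply: is_derive1_continuous; exact: dE.
Qed.

(** Up to sign, the primitive in w of exp(-ws) sin(wv). *)
Let E (v s w : R) := expR (- (w * s)) * (sin (w * v) * s + cos (w * v) * v) /
  (s ^+ 2 + v ^+ 2).

Let Rintegral_expN_sin (b v s : R) : 0 <= b -> 0 < v ->
  \int[mu]_(w in `[0, b]) (expR (- (w * s)) * sin (w * v)) =
  v / (s ^+ 2 + v ^+ 2) - E v s b.
Proof.
move=> b0 v0.
have n0 : s ^+ 2 + v ^+ 2 != 0 by rewrite gt_eqF// ltr_wpDl ?sqr_ge0// exprn_gt0.
have dx (x c : R) : is_derive x 1 (fun w => w * c) c by exact: is_derive1_mulr.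
have dE (x : R) : is_derive x 1 (fun w => expR (- (w * s)))
    (expR (- (x * s)) * - s).
  by apply: is_derive1_expR; apply: is_derive1N.
have dS (x : R) : is_derive x 1 (fun w => sin (w * v)) (cos (x * v) * v).
  exact: is_derive1_sin.
have dC (x : R) : is_derive x 1 (fun w => cos (w * v)) (- sin (x * v) * v).
  exact: is_derive1_cos.
pose F w := - E v s w.
transitivity (F b - F 0).
  apply: Rintegral_FTC2 => //; last first.
    move=> x _; apply: is_derive1_continuous; exact: (is_derive1M (dE x) (dS x)).
  move=> x _; rewrite /F.
  apply: (is_derive_eq (is_derive1N (is_derive1_scale (s ^+ 2 + v ^+ 2)^-1
    (is_derive1M (dE x) (is_derive1D (is_derive1_scale s (dS x))
      (is_derive1_scale v (dC x))))))).
  by field; rewrite n0.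
by rewrite /F /E !mul0r oppr0 expR0 sin0 cos0; field; rewrite n0.
Qed.

Let Rintegral_poisson (N v : R) : 0 <= N -> 0 < v ->
  \int[mu]_(s in `[0, N]) (v / (s ^+ 2 + v ^+ 2)) = atan (N / v).
Proof.
move=> N0 v0.
have n0 (s : R) : s ^+ 2 + v ^+ 2 != 0.
  by rewrite gt_eqF// ltr_wpDl ?sqr_ge0// exprn_gt0.
transitivity (atan (N / v) - atan (0 / v)); last by rewrite mul0r atan0 subr0.
apply: (@Rintegral_FTC2 _ _ (fun s => atan (s / v))) => // s _.
  have := @is_derive1_comp _ (@atan R) (fun y => y * v^-1) s _ _
    (is_derive1_atan (s / v)) (is_derive1_mulr s v^-1).
  move=> h; apply: (is_derive_eq h); field.
  by rewrite n0 gt_eqF.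
apply: cvgM; first exact: cvg_cst.
apply: cvgV; first exact: n0.
by apply: cvgD; [exact: exprn_continuous|exact: cvg_cst].
Qed.

Let measurable_sum_sqr (v : R) :
  measurable_fun setT (fun s : R => (s ^+ 2 + v ^+ 2)^-1).
Proof.
apply: measurableT_comp; first exact: measurable_invr.
by apply: measurable_funD.
Qed.

Let measurable_E (v b : R) : measurable_fun setT (fun s => E v s b).
Proof.
apply: measurable_funM; last exact: measurable_sum_sqr.
apply: measurable_funM; last by apply: measurable_funD.
apply: measurableT_comp; first exact: measurable_expR.
by apply: measurable_funN.
Qed.

Let normr_E_le (b v s : R) : 0 < v -> 0 <= s ->
  `|E v s b| <= 2 / v * expR (- (s * b)).
Proof.
move=> v0 s0; rewrite [s * b]mulrC.
have n0 : 0 < s ^+ 2 + v ^+ 2 by rewrite ltr_wpDl ?sqr_ge0// exprn_gt0.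
rewrite /E normrM normfV (gtr0_norm n0) normrM gtr0_norm ?expR_gt0//.
rewrite -mulrA [leLHS]mulrC ler_pM2r ?expR_gt0//.
rewrite ler_pdivrMr// mulrAC ler_pdivlMr//.
have : `|sin (b * v) * s + cos (b * v) * v| <= s + v.
  rewrite (le_trans (ler_normD _ _))// !normrM (ger0_norm s0) (gtr0_norm v0).
  by rewrite lerD// ler_piMl ?(ltW v0)// ler_norml ?sin_geN1 ?sin_le1 ?cos_geN1 ?cos_le1.
have := sqr_ge0 (s - v); move: `|_| => X.
nra.
Qed.

(** The integral of exp(-ws) sin(wv) over the rectangle [0, b] x [0, N], computed
    first in s and first in w, is the sine integral on the one hand and the
    arctangent on the other, each up to an error that vanishes for large N and
    b. *)
Lemma sine_integral_atan (b v N : R) : 0 < b -> 0 < v -> 0 < N ->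
  `|sine_integral b v - atan (N / v)| <= 2 / v / b + v / N.
Proof.
move=> b0 v0 N0.
(* The absolute value makes the integrand bounded on the whole plane. *)
pose F (z : R * R) := expR (- `|z.1 * z.2|) * sin (z.1 * v).
have bF : bmfun F.
  apply: bmfunM; last by apply: bmfun_sin; exact: measurable_funM.
  by apply: bmfun_expNabs; exact: measurable_funM.
have iv : mu.-integrable `[0, N] (EFin \o cst v^-1).
  by apply: bmfun_integrable_itv; exact: bmfun_cst.
have iexp (c M : R) : mu.-integrable `[0, M] (EFin \o (fun s => expR (- (s * c)))).
  apply: continuous_compact_integrable; first exact: segment_compact.
  apply: continuous_subspaceT => x.
  exact: (is_derive1_continuous (is_derive1_expR (is_derive1N (is_derive1_mulr x c)))).
have iE : mu.-integrable `[0, N] (EFin \o (fun s => 2 / v * expR (- (s * b)))).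
  exact: integrable_EFinZl.
have e1 : `|\int[mu]_(w in `[0, b]) (sin (w * v) / w * expR (- `|w * N|))| <= v / N.
  have mf : measurable_fun setT
      (fun w : R => sin (w * v) / w * expR (- `|w * N|)).
    apply: measurable_funM; first by case: (bmfun_sinc v).
    by have [] := @bmfun_expNabs _ _ _ _ (mulrr_measurable (D := setT) N).
  have ig : mu.-integrable `[0, b] (EFin \o (fun w => v * expR (- (w * N)))).
    exact: integrable_EFinZl.
  apply: (le_trans (@normr_Rintegral_le _ _ _ mu _ _ _ _ mf ig _)) => //.
    move=> w /=; rewrite in_itv/= => /andP[w0 wb].
    rewrite normrM ler_pM//.
      by rewrite -(gtr0_norm v0) (le_trans (normr_sinc_le _ _))// normr_id.
    by rewrite !ger0_norm ?expR_ge0// mulr_ge0// ltW.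
  rewrite RintegralZl// (Rintegral_expN (ltW b0)) ?gt_eqF// ler_pM2l//.
  by rewrite ler_pdivrMr// mulVf ?gt_eqF// lerBlDr lerDl expR_ge0.
have e2 : `|\int[mu]_(s in `[0, N]) E v s b| <= 2 / v / b.
  apply: (le_trans (@normr_Rintegral_le _ _ _ mu _ _ _ _ (measurable_E v b) iE _)) => //.
    by move=> s /=; rewrite in_itv/= => /andP[s0 _]; exact: normr_E_le.
  rewrite RintegralZl// (Rintegral_expN (ltW N0)) ?gt_eqF// ler_pM2l ?divr_gt0//.
  by rewrite ler_pdivrMr// mulVf ?gt_eqF// lerBlDr lerDl expR_ge0.
have key : sine_integral b v -
      \int[mu]_(w in `[0, b]) (sin (w * v) / w * expR (- `|w * N|)) =
    atan (N / v) - \int[mu]_(s in `[0, N]) E v s b.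
  transitivity (\int[mu]_(w in `[0, b]) \int[mu]_(s in `[0, N]) F (w, s)).
    apply/esym.
    rewrite /sine_integral -RintegralB//; last 2 first.
      by apply: bmfun_integrable_itv; exact: bmfun_sinc.
      apply: bmfun_integrable_itv; apply: bmfunM; first exact: bmfun_sinc.
      by apply: bmfun_expNabs; exact: mulrr_measurable.
    apply: eq_Rintegral => w; rewrite inE/= in_itv/= => /andP[w0 wb].
    have [->|wn0] := eqVneq w 0.
      rewrite invr0 mulr0 mul0r subr0 /F/= mul0r.
      under eq_Rintegral do rewrite sin0 mulr0.
      by rewrite Rintegral_cst ?mul0r.
    transitivity (\int[mu]_(s in `[0, N]) (sin (w * v) * expR (- (s * w)))).
      apply: eq_Rintegral => s; rewrite inE/= in_itv/= => /andP[s0 sN].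
      by rewrite /F/= ger0_norm ?mulr_ge0// mulrC [s * w]mulrC.
    rewrite RintegralZl// (Rintegral_expN (ltW N0) wn0) ger0_norm.
      by rewrite [N * w]mulrC; field.
    by rewrite mulr_ge0// ltW.
  transitivity (\int[mu]_(s in `[0, N]) \int[mu]_(w in `[0, b]) F (w, s)).
    by apply: bmfun_Fubini => //; exact: lebesgue_itv_lty.
  rewrite -(Rintegral_poisson (ltW N0) v0) -RintegralB//; last 2 first.
  - apply: le_integrable_norm iv _ => //.
      by apply: measurable_funM => //; exact: measurable_sum_sqr.
    move=> s _; have n0 : 0 < s ^+ 2 + v ^+ 2.
      by rewrite ltr_wpDl ?sqr_ge0// exprn_gt0.
    rewrite ger0_norm; last by rewrite divr_ge0 ?ltW.
    rewrite ler_pdivrMr// -ler_pdivrMl ?invr_gt0// invrK -expr2.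
    by rewrite lerDr sqr_ge0.
  - apply: (@le_integrable_norm _ _ _ mu _ _ _ _ (measurable_E v b) iE) => //.
    by move=> s /=; rewrite in_itv/= => /andP[s0 _]; exact: normr_E_le.
  apply: eq_Rintegral => s; rewrite inE/= in_itv/= => /andP[s0 sN].
  rewrite -Rintegral_expN_sin ?ltW//; apply: eq_Rintegral => w.
  rewrite inE/= in_itv/= => /andP[w0 wb].
  by rewrite /F/= ger0_norm ?mulr_ge0.
move: e1 e2; rewrite !ler_norml => /andP[? ?] /andP[? ?].
apply/andP; split; lra.
Qed.

End dirichlet.

Section dirichlet_consequences.
Context {R : realType}.
Notation mu := (@lebesgue_measure R).

(** N tends to infinity in the previous bound. *)
Lemma sine_integral_pi2 (b v : R) : 0 < b -> 0 < v ->
  `|sine_integral b v - pi / 2| <= 2 / v / b.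
Proof.
move=> b0 v0; apply/ler_addgt0Pr => e e0.
have /cvgrPdist_le/(_ (e / 2)) := @cvgy_atan R.
rewrite divr_gt0// => /(_ isT)[M [_ HM]].
pose N := Num.max (v * (`|M| + 1)) (v / (e / 2)).
have N0 : 0 < N by rewrite lt_max mulr_gt0// ltr_wpDl.
have e1 : v / N <= e / 2.
  by rewrite ler_pdivrMr// -ler_pdivrMl ?divr_gt0// mulrC le_max lexx orbT.
have e2 : `|pi / 2 - atan (N / v)| <= e / 2.
  apply: HM; rewrite ltr_pdivlMr// lt_max; apply/orP; left.
  by rewrite mulrC ltr_pM2l// (le_lt_trans (ler_norm M))// ltrDl.
have := sine_integral_atan b0 v0 N0.
move: e1 e2; rewrite !ler_norml => e1 /andP[? ?] /andP[? ?].
by apply/andP; split; lra.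
Qed.

(** For bv <= 1 the integrand is at most v; beyond that the distance to pi/2 is at
    most 2. *)
Lemma sine_integral_bounded (b v : R) : 0 <= b -> `|sine_integral b v| <= 4.
Proof.
move=> b0; wlog v0 : v / 0 < v => [hw|].
  have [v0|v0|->] := ltgtP v 0; last 2 first.
  - exact: hw.
  - by rewrite (le_trans (sine_integral_le _ b0))// normr0 mulr0.
  - by rewrite -normrN -sine_integralN hw// oppr_gt0.
have [bv|bv] := leP (b * v) 1.
  by rewrite (le_trans (sine_integral_le _ b0))// gtr0_norm// (le_trans bv)// ler1n.
have b1 : 0 < b by rewrite -(pmulr_lgt0 _ v0) (lt_trans ltr01).
have := sine_integral_pi2 b1 v0.
have : 2 / v / b <= 2.
  by rewrite -mulrA -invfM ler_pdivrMr ?mulr_gt0// ler_peMr// ltW// mulrC.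
have := @pihalf_02 R => /andP[p0 p2].
rewrite !ler_norml => ? /andP[? ?]; apply/andP; split; lra.
Qed.

End dirichlet_consequences.

(** * Means of bounded functions and characteristic functions *)

Section bounded_expectation.
Context d (T : measurableType d) (R : realType) (P : probability T R).
Implicit Types f g : T -> R.

Lemma probability_setT_lty : (P setT < +oo)%E.
Proof. by rewrite probability_setT ltry. Qed.

Lemma bmfun_integrableP f : bmfun f -> P.-integrable setT (EFin \o f).
Proof. by apply: bmfun_integrable => //; exact: probability_setT_lty. Qed.

Lemma bmeanD f g : bmfun f -> bmfun g ->
  \int[P]_t (f t + g t) = \int[P]_t f t + \int[P]_t g t.
Proof. by move=> bf bg; apply: RintegralD => //; exact: bmfun_integrableP. Qed.

Lemma bmeanB f g : bmfun f -> bmfun g ->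
  \int[P]_t (f t - g t) = \int[P]_t f t - \int[P]_t g t.
Proof. by move=> bf bg; apply: RintegralB => //; exact: bmfun_integrableP. Qed.

Lemma bmeanZl c f : bmfun f -> \int[P]_t (c * f t) = c * \int[P]_t f t.
Proof. by move=> bf; apply: RintegralZl => //; exact: bmfun_integrableP. Qed.

Lemma mean_cst c : \int[P]_t c = c.
Proof. by rewrite Rintegral_cst//= probability_setT mulr1. Qed.

Lemma ler_bmean f g : bmfun f -> bmfun g -> (forall t, f t <= g t) ->
  \int[P]_t f t <= \int[P]_t g t.
Proof.
by move=> bf bg fg; apply: le_Rintegral => //; exact: bmfun_integrableP.
Qed.

Lemma normr_bmean_le f M : bmfun f -> (forall t, `|f t| <= M) ->
  `|\int[P]_t f t| <= M.
Proof.
move=> bf fM; rewrite -[leRHS](mean_cst M).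
apply: le_trans.
  by apply: le_normr_Rintegral => //; exact: bmfun_integrableP.
by apply: ler_bmean => //; [exact: bmfun_norm|exact: bmfun_cst].
Qed.

End bounded_expectation.

Section characteristic_function.
Context d (T : measurableType d) (R : realType) (P : probability T R).
Variables (X : T -> R) (mX : measurable_fun setT X).

(** Real and imaginary parts of the characteristic function of X.  The
    characteristic functions are handled through this pair of real functions. *)
Definition cosmean (w : R) := \int[P]_t cos (w * X t).
Definition sinmean (w : R) := \int[P]_t sin (w * X t).

Let mwX (w : R) : measurable_fun setT (fun t => w * X t).
Proof. exact: measurable_funM. Qed.

Lemma bmfun_cosX (w : R) : bmfun (fun t => cos (w * X t)).
Proof. exact: bmfun_cos. Qed.

Lemma bmfun_sinX (w : R) : bmfun (fun t => sin (w * X t)).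
Proof. exact: bmfun_sin. Qed.

Let joint : measurable_fun setT (fun z : R * T => z.1 * X z.2).
Proof.
apply: measurable_funM; first exact: measurable_fst.
by apply: measurableT_comp => //; exact: measurable_snd.
Qed.

Lemma bmfun_cosmean : bmfun cosmean.
Proof.
have bF : bmfun (fun z : R * T => cos (z.1 * X z.2)) by exact: bmfun_cos.
exact: (bmfun_Rintegral measurableT (probability_setT_lty P) bF).
Qed.

Lemma bmfun_sinmean : bmfun sinmean.
Proof.
have bF : bmfun (fun z : R * T => sin (z.1 * X z.2)) by exact: bmfun_sin.
exact: (bmfun_Rintegral measurableT (probability_setT_lty P) bF).
Qed.

Lemma cosmeanN w : cosmean (- w) = cosmean w.
Proof. by apply: eq_Rintegral => t _; rewrite mulNr cosN. Qed.

Lemma sinmeanN w : sinmean (- w) = - sinmean w.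
Proof.
transitivity (\int[P]_t (-1 * sin (w * X t))).
  by apply: eq_Rintegral => t _; rewrite [- w * _]mulNr sinN mulN1r.
by rewrite bmeanZl ?mulN1r//; exact: bmfun_sinX.
Qed.

Lemma mean_cos_shift w m : \int[P]_t cos (w * (X t - m)) =
  cosmean w * cos (w * m) + sinmean w * sin (w * m).
Proof.
under eq_Rintegral do rewrite mulrBr cosB mulrC [sin _ * _]mulrC.
rewrite bmeanD; [|exact: bmfunM (bmfun_cst _) (bmfun_cosX _)|
  exact: bmfunM (bmfun_cst _) (bmfun_sinX _)].
rewrite !bmeanZl; [|exact: bmfun_sinX|exact: bmfun_cosX].
by rewrite mulrC [sinmean _ * _]mulrC.
Qed.

Lemma mean_sin_shift w m : \int[P]_t sin (w * (X t - m)) =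
  sinmean w * cos (w * m) - cosmean w * sin (w * m).
Proof.
under eq_Rintegral do rewrite mulrBr sinB mulrC [cos _ * _]mulrC.
rewrite bmeanB; [|exact: bmfunM (bmfun_cst _) (bmfun_sinX _)|
  exact: bmfunM (bmfun_cst _) (bmfun_cosX _)].
rewrite !bmeanZl; [|exact: bmfun_cosX|exact: bmfun_sinX].
by rewrite mulrC [cosmean _ * _]mulrC.
Qed.

(** |E e^{iwX}| <= 1, from the nonnegative mean of |e^{iwX} - E e^{iwX}|^2. *)
Lemma cosmean_sinmean_le1 w : cosmean w ^+ 2 + sinmean w ^+ 2 <= 1.
Proof.
pose c := cosmean w; pose s := sinmean w.
have : 0 <= \int[P]_t (1 + (c ^+ 2 + s ^+ 2) - 2 *
    (c * cos (w * X t) + s * sin (w * X t))).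
  apply: Rintegral_ge0 => t _; have := cos2Dsin2 (w * X t).
  have := sqr_ge0 (cos (w * X t) - c); have := sqr_ge0 (sin (w * X t) - s).
  by rewrite !sqrrB; lra.
have bc := bmfunM (bmfun_cst c) (bmfun_cosX w).
have bs := bmfunM (bmfun_cst s) (bmfun_sinX w).
rewrite bmeanB; [|exact: bmfun_cst|exact: bmfunM (bmfun_cst _) (bmfunD bc bs)].
rewrite mean_cst bmeanZl; last exact: bmfunD.
rewrite bmeanD// !bmeanZl; [|exact: bmfun_sinX|exact: bmfun_cosX].
by rewrite -/(cosmean w) -/(sinmean w) -/c -/s; lra.
Qed.

End characteristic_function.

(** * Choosing a centre for the error *)

Section centering.
Context d (T : measurableType d) (R : realType) (P : probability T R).
Variables (X : T -> R) (mX : measurable_fun setT X).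
Notation mu := (@lebesgue_measure R).
Notation c := (cosmean P X).
Notation s := (sinmean P X).

(** 1 - Re (e^{-iwm} phi(w)), for phi = c + is. *)
Definition cos_defect (c s : R -> R) (m w : R) : R :=
  1 - (c w * cos (w * m) + s w * sin (w * m)).

Lemma cos_defect_ge0 m w : 0 <= cos_defect c s m w.
Proof.
have := cosmean_sinmean_le1 P mX w; have := cos2Dsin2 (w * m).
have := sqr_ge0 (c w - cos (w * m)); have := sqr_ge0 (s w - sin (w * m)).
by rewrite /cos_defect !sqrrB; lra.
Qed.

Let bE w : bmfun (fun t => c w * cos (w * X t) + s w * sin (w * X t)).
Proof.
apply: bmfunD; apply: bmfunM; [exact: bmfun_cst|exact: bmfun_cosX|
  exact: bmfun_cst|exact: bmfun_sinX].
Qed.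

Lemma bmfun_cos_defect w : bmfun (fun t => cos_defect c s (X t) w).
Proof. by apply: bmfunB; [exact: bmfun_cst|exact: bE]. Qed.

Lemma mean_cos_defect w :
  \int[P]_t cos_defect c s (X t) w = 1 - (c w ^+ 2 + s w ^+ 2).
Proof.
rewrite bmeanB; [|exact: bmfun_cst|exact: bE].
rewrite mean_cst bmeanD; [|exact: bmfunM (bmfun_cst _) (bmfun_cosX mX w)|
  exact: bmfunM (bmfun_cst _) (bmfun_sinX mX w)].
by rewrite !bmeanZl; [|exact: bmfun_sinX|exact: bmfun_cosX].
Qed.

(** A probabilistic existence argument.  If m is drawn at random with the law of X
    itself, the mean of the defect at w is 1 - |phi(w)|^2 <= b w^tau; by Tonelli
    the integral over w then has a finite mean, so it is finite for some m.  The
    weight w^{-1 - tau/2} is strong enough to control the kernel at 0 in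
    [dkern_near0] and still leaves the integrable power w^{tau/2 - 1}. *)
Lemma exists_centering (b tau : R) : 0 < tau -> 0 <= b ->
  (forall w, 0 < w <= 1 -> 1 - (c w ^+ 2 + s w ^+ 2) <= b * w `^ tau) ->
  exists m, (\int[mu]_(w in `]0%R, 1%R])
    (cos_defect c s m w * w `^ (- 1 - tau / 2))%:E < +oo)%E.
Proof.
move=> tau0 b0 E2.
pose g (z : T * R) := cos_defect c s (X z.1) z.2 * z.2 `^ (- 1 - tau / 2) *
  \1_(`]0%R, 1%R]%classic : set R) z.2.
have g0 z : 0 <= g z.
  by rewrite /g !mulr_ge0 ?powR_ge0 ?cos_defect_ge0.
have mXz (k : T * R -> R) : k = (fun z => z.2 * X z.1) -> measurable_fun setT k.
  move=> ->; apply: measurable_funM; first exact: measurable_snd.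
  by apply: measurableT_comp => //; exact: measurable_fst.
have mc (f : R -> R) : bmfun f -> measurable_fun setT (fun z : T * R => f z.2).
  by move=> [mf _]; apply: measurableT_comp => //; exact: measurable_snd.
have mg : measurable_fun setT (EFin \o g).
  apply/measurable_EFinP; rewrite /g; apply: measurable_funM.
    apply: measurable_funM.
      apply: measurable_funB => //; apply: measurable_funD; apply: measurable_funM.
      - by apply: mc; exact: bmfun_cosmean.
      - by have [] := bmfun_cos (mXz _ erefl).
      - by apply: mc; exact: bmfun_sinmean.
      - by have [] := bmfun_sin (mXz _ erefl).
    exact: (measurableT_comp (measurable_powR _) measurable_snd).
  apply: (mc (\1_(`]0%R, 1%R]%classic : set R))).
  by apply: bmfun_indic; exact: measurable_itv.
have inner m : (\int[mu]_w (EFin \o g) (m, w) = \int[mu]_(w in `]0%R, 1%R])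
    (cos_defect c s (X m) w * w `^ (- 1 - tau / 2))%:E)%E.
  rewrite [RHS]integral_mkcond; apply: eq_integral => w _.
  by rewrite /patch /g/= indicE; case: (w \in _); rewrite ?mulr1// mulr0.
apply: contrapT => /forallNP H.
have F := @fubini_tonelli _ _ T (measurableTypeR R) R P mu (EFin \o g) mg
  (fun z => g0 z).
have : (\int[P]_x \int[mu]_y (EFin \o g) (x, y) = +oo)%E.
  under eq_integral => x _.
    rewrite inner.
    have /negP := H (X x); rewrite -leNgt leye_eq => /eqP ->.
    over.
  rewrite integral_cst//.
  by rewrite [X in (_ * X)%E](_ : _ = 1%E); [rewrite mule1|exact: probability_setT].
have : (\int[mu]_y \int[P]_x (EFin \o g) (x, y) < +oo)%E.
  apply: (@le_lt_trans _ _ (\int[mu]_(w in `]0%R, 1%R]) (b * w `^ (tau / 2 - 1))%:E)%E).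
    rewrite [leRHS]integral_mkcond; apply: ge0_le_integral => //.
    - by move=> w _; apply: integral_ge0 => t _; rewrite lee_fin.
    - exact: measurable_fun_fubini_tonelli_G.
    - apply/(measurable_restrictT _ _).1 => //.
      apply: measurable_funTS; apply/measurable_EFinP.
      by apply: (measurable_funM (measurable_cst _)); exact: measurable_powR.
    - move=> w _; rewrite /patch; case: ifPn => w01; last first.
        rewrite integral0_eq// => t _.
        by rewrite /g/= indicE (negbTE w01) mulr0.
      have w1 : 0 < w <= 1 by move: w01; rewrite inE/= in_itv/=.
      have -> : (\int[P]_x (EFin \o g) (x, w) =
          (\int[P]_t (w `^ (- 1 - tau / 2) * cos_defect c s (X t) w))%:E)%E.
        rewrite /Rintegral fineK.
          by apply: eq_integral => t _; rewrite /g/= indicE w01 mulr1 mulrC.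
        apply: integrable_fin_num => //.
        by apply: bmfun_integrableP; apply: bmfunM;
          [exact: bmfun_cst|exact: bmfun_cos_defect].
      rewrite bmeanZl; last exact: bmfun_cos_defect.
      rewrite mean_cos_defect lee_fin.
      apply: (@le_trans _ _ (w `^ (-1 - tau / 2) * (b * w `^ tau))).
        by rewrite ler_wpM2l ?powR_ge0// E2.
      rewrite mulrCA -powRD; last by apply/implyP => _; rewrite gt_eqF//; case/andP: w1.
      by rewrite (_ : -1 - tau / 2 + tau = tau / 2 - 1)//; lra.
  under eq_integral do rewrite EFinM.
  have mp : measurable_fun (`]0%R, 1%R]%classic : set R)
      (fun w => (w `^ (tau / 2 - 1))%:E).
    by apply: measurable_funTS; apply/measurable_EFinP; exact: measurable_powR.
  rewrite ge0_integralZl//; last by move=> w _; rewrite lee_fin powR_ge0.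
  rewrite lte_mul_pinfty// ?lee_fin//.
  by rewrite (le_lt_trans (integral_powR_near0 _)) ?divr_gt0// ltry.
by rewrite -F => + e; rewrite e.
Qed.

End centering.

(** * The deconvolution kernel and its low frequencies *)

Section interval_integrals.
Context (R : realType).
Notation mu := (@lebesgue_measure R).

Lemma integrable_itv_cat (f : R -> R) (a e b : R) : a <= e -> e <= b ->
  measurable_fun setT f ->
  mu.-integrable `[a, e] (EFin \o f) -> mu.-integrable `[e, b] (EFin \o f) ->
  mu.-integrable `[a, b] (EFin \o f).
Proof.
move=> ae eb mf /integrableP[_ i1] /integrableP[_ i2]; apply/integrableP; split.
  exact/measurable_EFinP/measurable_funTS.
have mn : measurable_fun setT (abse \o (EFin \o f)).
  by apply: measurableT_comp => //; exact/measurable_EFinP.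
rewrite (@itv_bndbnd_setU _ _ _ (BRight e)) ?bnd_simp// ge0_integral_setU//=.
- rewrite lte_add_pinfty// (le_lt_trans _ i2)//.
  apply: ge0_subset_integral => //; first exact: measurable_funTS.
  by apply: subset_itv; rewrite bnd_simp.
- exact: measurable_funTS.
- apply/disj_setPS => y [/=]; rewrite 2!in_itv/= => /andP[_ yx] /andP[].
  by rewrite ltNge yx.
Qed.

Lemma Rintegral_itv_cat (f : R -> R) (a e b : R) : a <= e -> e <= b ->
  mu.-integrable `[a, b] (EFin \o f) ->
  \int[mu]_(x in `[a, b]) f x =
  \int[mu]_(x in `[a, e]) f x + \int[mu]_(x in `[e, b]) f x.
Proof.
move=> ae eb iF; have := Rintegral_itvB (x := e) iF; rewrite !bnd_simp => /(_ ae eb).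
rewrite Rintegral_itv_obnd_cbnd; last first.
  by apply: integrableS iF => //; apply: subset_itv; rewrite bnd_simp.
by move=> <-; rewrite addrC subrK.
Qed.

End interval_integrals.

Section kernel.
Context (R : realType).
Notation mu := (@lebesgue_measure R).
Variables (c s : R -> R).
Hypotheses (bc : bmfun c) (bs : bmfun s).
Notation r w := (c w ^+ 2 + s w ^+ 2).

(** Im (e^{iwu} / phi(w)) / w for phi = c + is. *)
Definition dkern (w u : R) : R :=
  w^-1 * ((c w * sin (w * u) - s w * cos (w * u)) / (c w ^+ 2 + s w ^+ 2)).

Definition dint (a b u : R) : R := \int[mu]_(w in `[a, b]) dkern w u.

(** Let v = w(u - m), e^{-iwm} phi(w) = p + iq and r = |phi(w)|^2 <= 1.  The
    difference D between Im (e^{iwu}/phi(w)) and sin v satisfies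
    D^2 r <= ((p - r)^2 + q^2)/r = 1 - 2p + r <= 2 (1 - p): it is small when the
    defect 1 - p is.  As only D^2, not D, is controlled by the defect,
    |D| <= (D^2/x + x)/2 is applied with x = w^{tau/2}; this costs the additional
    term w^{tau/2 - 1}. *)
Lemma dkern_near0 (m tau c0 w u : R) : 0 < c0 -> c0 <= r w -> r w <= 1 -> 0 < w ->
  `|dkern w u - sin (w * (u - m)) / w| <=
    cos_defect c s m w * w `^ (- 1 - tau / 2) / c0 + w `^ (tau / 2 - 1) / 2.
Proof.
move=> c00 c0r r1 w0.
pose th := w * m; pose v := w * (u - m).
have wu : w * u = v + th by rewrite /v /th mulrBr subrK.
have r0 : 0 < r w by exact: lt_le_trans c0r.
pose p := c w * cos th + s w * sin th; pose q := s w * cos th - c w * sin th.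
(* D is w times the difference to be bounded. *)
pose D := (c w * sin (w * u) - s w * cos (w * u)) / r w - sin v.
have pq : p ^+ 2 + q ^+ 2 = r w.
  rewrite -[RHS]mulr1 -(cos2Dsin2 th) /p /q; ring.
have DE : D * r w = (p - r w) * sin v - q * cos v.
  rewrite /D mulrBl divfK ?gt_eqF// wu sinD cosD /p /q; ring.
have h0 : 0 <= 1 - p.
  suff : p <= 1 by lra.
  have := sqr_ge0 q; have := sqr_ge0 (p - 1); nra.
have D2 : D ^+ 2 <= 2 * (1 - p) / c0.
  have e : (D * r w) ^+ 2 <= (p - r w) ^+ 2 + q ^+ 2.
    have := sqr_ge0 ((p - r w) * cos v + q * sin v).
    have -> : ((p - r w) * cos v + q * sin v) ^+ 2 =
        ((p - r w) ^+ 2 + q ^+ 2) * (cos v ^+ 2 + sin v ^+ 2) - (D * r w) ^+ 2.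
      rewrite DE; ring.
    by rewrite cos2Dsin2 mulr1 subr_ge0.
  have {}e : D ^+ 2 * r w <= 2 * (1 - p).
    have e1 : (p - r w) ^+ 2 + q ^+ 2 = r w * (1 - 2 * p + r w) by rewrite -pq; ring.
    have : D ^+ 2 * r w * r w <= r w * (1 - 2 * p + r w) by rewrite -e1 -mulrA -expr2 -exprMn.
    rewrite [leRHS]mulrC ler_pM2r// => h; apply: (le_trans h); lra.
  rewrite ler_pdivlMr//; apply: le_trans e.
  by rewrite ler_wpM2l ?sqr_ge0.
have dE : dkern w u - sin (w * (u - m)) / w = w^-1 * D.
  by rewrite /dkern /D [RHS]mulrBr [sin _ / w]mulrC.
rewrite dE normrM normfV (gtr0_norm w0).
have wn0 : (w == 0) = false by rewrite gt_eqF.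
have e1 : w `^ (- 1 - tau / 2) = w^-1 * w `^ (- (tau / 2)).
  by rewrite powRD ?wn0 ?implybT// powR_inv1// ltW.
have e2 : w `^ (tau / 2 - 1) = w^-1 * w `^ (tau / 2).
  by rewrite powRD ?wn0 ?implybT// powR_inv1 1?ltW// mulrC.
rewrite e1 e2.
have -> : cos_defect c s m w = 1 - p by [].
have -> : (1 - p) * (w^-1 * w `^ (- (tau / 2))) / c0 + w^-1 * w `^ (tau / 2) / 2 =
  w^-1 * ((2 * (1 - p) / c0 * w `^ (- (tau / 2)) + w `^ (tau / 2)) / 2).
  by field; rewrite (gt_eqF w0) (gt_eqF c00).
rewrite ler_pM2l ?invr_gt0//.
set x := w `^ (tau / 2).
have x0 : 0 < x by rewrite powR_gt0.
rewrite powRN -/x.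
apply: (@le_trans _ _ ((D ^+ 2 / x + x) / 2)).
  rewrite ler_pdivlMr// -(ler_pM2r x0) mulrDl divfK ?gt_eqF// -expr2.
  rewrite -(real_normK (num_real D)); have := sqr_ge0 (`|D| - x); nra.
by rewrite ler_pM2r ?invr_gt0// lerD2r ler_pM2r ?invr_gt0.
Qed.

Lemma measurable_dkern : measurable_fun setT (fun z : R * R => dkern z.1 z.2).
Proof.
have m1 (f : R -> R) : measurable_fun setT f ->
    measurable_fun setT (fun z : R * R => f z.1).
  by move=> mf; apply: measurableT_comp => //; exact: measurable_fst.
have mp : measurable_fun setT (fun z : R * R => z.1 * z.2).
  by apply: measurable_funM; [exact: measurable_fst|exact: measurable_snd].
apply: measurable_funM; first by apply: m1; exact: measurable_invr.
apply: measurable_funM.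
  apply: measurable_funB; apply: measurable_funM.
  - by apply: m1; case: bc.
  - by case: (bmfun_sin mp).
  - by apply: m1; case: bs.
  - by case: (bmfun_cos mp).
apply: (m1 (fun w => (r w)^-1)).
apply: measurableT_comp; first exact: measurable_invr.
by apply: measurable_funD; apply: measurable_funX; [case: bc|case: bs].
Qed.

Lemma measurable_dkern1 u : measurable_fun setT (dkern ^~ u).
Proof.
exact: (measurableT_comp measurable_dkern (measurable_pair2 u)).
Qed.

Lemma measurable_dint a b : measurable_fun setT (dint a b).
Proof.
have mF : measurable_fun setT (fun z : R * R => dkern z.2 z.1).
  apply: (measurableT_comp (f := fun z : R * R => dkern z.1 z.2)
    (g := fun z : R * R => (z.2, z.1))).
    exact: measurable_dkern.
  exact: measurable_fun_pair measurable_snd measurable_fst.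
exact: (@measurable_Rintegral_section _ _ _ R (measurableTypeR R) mu _ _ _ mF).
Qed.

(** On an interval away from 0 the kernel is a combination of sines and cosines
    with bounded coefficients; the indicator makes the weight bounded on the
    whole line. *)
Definition kernel_weight (a b w : R) : R := \1_(`[a, b]%classic : set R) w * (w^-1 * (r w)^-1).

Hypothesis r_lb : forall B : R, exists2 c0, 0 < c0 & forall w, 0 <= w <= B -> c0 <= r w.

Lemma bmfun_kernel_weight a b : 0 < a -> bmfun (kernel_weight a b).
Proof.
move=> a0; split.
  apply: measurable_funM; first by apply: measurable_indic; exact: measurable_itv.
  apply: measurable_funM; first exact: measurable_invr.
  apply: measurableT_comp; first exact: measurable_invr.
  by apply: measurable_funD; apply: measurable_funX; [case: bc|case: bs].
have [c0 c00 rc] := r_lb b.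
exists (a^-1 * c0^-1) => w; rewrite /kernel_weight indicE.
have [|_] := boolP (w \in _); last by rewrite mul0r normr0 mulr_ge0// invr_ge0 ltW.
rewrite inE/= in_itv/= => /andP[aw wb]; rewrite mul1r.
have w0 : 0 < w by exact: lt_le_trans aw.
have rw : c0 <= r w by rewrite rc// (ltW w0).
have r0 : 0 < r w by exact: lt_le_trans rw.
rewrite normrM !normfV (gtr0_norm w0) (gtr0_norm r0).
by rewrite ler_pM ?invr_ge0 ?(ltW w0) ?(ltW r0)// lef_pV2.
Qed.

Lemma dkernE a b w u : a <= w <= b -> dkern w u =
  kernel_weight a b w * c w * sin (w * u) + (- (kernel_weight a b w * s w)) * cos (w * u).
Proof.
move=> awb; rewrite /dkern /kernel_weight indicE mem_set/=; last by rewrite in_itv.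
by rewrite mul1r; ring.
Qed.

Lemma integrable_dkern a b u : 0 < a -> mu.-integrable `[a, b] (EFin \o dkern ^~ u).
Proof.
move=> a0.
have : mu.-integrable `[a, b] (EFin \o (fun w =>
    kernel_weight a b w * c w * sin (w * u) + (- (kernel_weight a b w * s w)) * cos (w * u))).
  apply: bmfun_integrable_itv; have bk := bmfun_kernel_weight b a0.
  apply: bmfunD; apply: bmfunM.
  - exact: bmfunM.
  - by apply: bmfun_sin; exact: mulrr_measurable.
  - by apply: bmfunN; exact: bmfunM.
  - by apply: bmfun_cos; exact: mulrr_measurable.
apply: eq_integrable => // w; rewrite inE/= in_itv/= => awb.
by rewrite -dkernE.
Qed.

Variables (m : R) (H : R -> R).
Hypotheses (iH : mu.-integrable `[0, 1] (EFin \o H))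
  (dkernH : forall w u, 0 <= w <= 1 -> `|dkern w u - sin (w * (u - m)) / w| <= H w).

Let integrable_diff u e : e <= 1 ->
  mu.-integrable `[0, e] (EFin \o (fun w => dkern w u - sin (w * (u - m)) / w)).
Proof.
move=> e1; apply: (@le_integrable_norm _ _ _ mu _ _ H) => //.
- by apply: measurable_funB; [exact: measurable_dkern1|case: (bmfun_sinc (u - m))].
- apply: integrableS iH => //; apply: subset_itvl; rewrite bnd_simp//.
- move=> w /=; rewrite in_itv/= => /andP[w0 we]; apply: dkernH.
  by rewrite w0 (le_trans we).
Qed.

Lemma integrable_dkern0 b u : 0 <= b -> mu.-integrable `[0, b] (EFin \o dkern ^~ u).
Proof.
move=> b0; have h e : e <= 1 -> mu.-integrable `[0, e] (EFin \o dkern ^~ u).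
  move=> e1; have iS : mu.-integrable `[0, e] (EFin \o (fun w => sin (w * (u - m)) / w)).
    by apply: bmfun_integrable_itv; exact: bmfun_sinc.
  have := integrableD _ (integrable_diff u e1) iS.
  move=> /(_ (measurable_itv _)).
  by apply: eq_integrable => // w _; rewrite /= -EFinD subrK.
have [b1|b1] := leP b 1; first exact: h.
apply: (@integrable_itv_cat _ _ _ 1) => //; first exact: ltW.
- exact: measurable_dkern1.
- exact: h.
- exact: integrable_dkern.
Qed.

(** The sine integral of [dkern_near0] absorbs the dependence on u. *)
Lemma dint0_bounded e u : 0 <= e <= 1 ->
  `|dint 0 e u| <= 4 + \int[mu]_(w in `[0, 1]) H w.
Proof.
move=> /andP[e0 e1].
have -> : dint 0 e u = sine_integral e (u - m) +
    \int[mu]_(w in `[0, e]) (dkern w u - sin (w * (u - m)) / w).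
  rewrite RintegralB//; [by rewrite addrC subrK|exact: integrable_dkern0|].
  by apply: bmfun_integrable_itv; exact: bmfun_sinc.
rewrite (le_trans (ler_normD _ _))// lerD ?sine_integral_bounded//.
have iHe : mu.-integrable `[0, e] (EFin \o H).
  by apply: integrableS iH => //; apply: subset_itvl; rewrite bnd_simp.
apply: (@le_trans _ _ (\int[mu]_(w in `[0, e]) H w)).
  apply: normr_Rintegral_le => //.
    by apply: measurable_funB; [exact: measurable_dkern1|case: (bmfun_sinc (u - m))].
  move=> w /=; rewrite in_itv/= => /andP[w0 we]; apply: dkernH.
  by rewrite w0 (le_trans we).
rewrite (@Rintegral_itv_cat _ _ _ e 1)// lerDl; apply: Rintegral_ge0 => w /=.
rewrite in_itv/= => /andP[ew w1].
by rewrite (le_trans _ (dkernH 0 _))// w1 (le_trans e0).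
Qed.

Lemma dint0_cvg0 u : dint 0 n.+1%:R^-1 u @[n --> \oo] --> 0.
Proof.
have h := parameterized_integral_cvg_left ltr01 (integrable_dkern0 u ler01).
apply: cvg_comp h; exact: cvg_harmonic.
Qed.

End kernel.

(** * Second moment of a random trigonometric integral *)

Section quadratic_form.
Context d (T : measurableType d) (R : realType) (P : probability T R).
Variables (U : T -> R) (mU : measurable_fun setT U).
Notation mu := (@lebesgue_measure R).
Variables (p q : R -> R) (a b : R).
Hypotheses (bp : bmfun p) (bq : bmfun q).

Let Q w t := p w * sin (w * U t) + q w * cos (w * U t).

Let N w := p w ^+ 2 + q w ^+ 2.

(** The modulus of the characteristic function of U. *)
Definition charmod w := Num.sqrt (cosmean P U w ^+ 2 + sinmean P U w ^+ 2).

Lemma bmfun_charmod : bmfun charmod.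
Proof.
split.
  apply: measurableT_comp; first by apply: continuous_measurable_fun; exact: sqrt_continuous.
  apply: measurable_funD; apply: measurable_funX.
    by case: (bmfun_cosmean P mU).
  by case: (bmfun_sinmean P mU).
exists 1 => w; rewrite ger0_norm ?sqrtr_ge0// -sqrtr1 ler_sqrt//.
exact: cosmean_sinmean_le1.
Qed.

Lemma charmodN w : charmod (- w) = charmod w.
Proof. by rewrite /charmod cosmeanN (sinmeanN P mU) sqrrN. Qed.

(** Cauchy-Schwarz followed by sqrt (n n') <= (n + n')/2. *)
Lemma normr_linear_le (A B c s n n' : R) : A ^+ 2 + B ^+ 2 = n * n' ->
  0 <= n -> 0 <= n' ->
  `|A * c + B * s| <= (n + n') / 2 * Num.sqrt (c ^+ 2 + s ^+ 2).
Proof.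
move=> AB n0 n'0; have cs0 : 0 <= c ^+ 2 + s ^+ 2 by rewrite addr_ge0 ?sqr_ge0.
rewrite -(@ler_pXn2r _ 2)// ?nnegrE; last by rewrite mulr_ge0 ?sqrtr_ge0// divr_ge0 ?addr_ge0.
rewrite real_normK ?num_real// exprMn sqr_sqrtr//.
apply: (@le_trans _ _ (n * n' * (c ^+ 2 + s ^+ 2))).
  rewrite -AB -subr_ge0.
  by rewrite (_ : _ - _ = (A * s - B * c) ^+ 2) ?sqr_ge0//; ring.
rewrite ler_wpM2r// -subr_ge0.
by rewrite (_ : _ - _ = ((n - n') / 2) ^+ 2) ?sqr_ge0//; field.
Qed.

Let bQ w : bmfun (Q w).
Proof.
apply: bmfunD; apply: bmfunM; [exact: bmfun_cst|exact: bmfun_sinX|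
  exact: bmfun_cst|exact: bmfun_cosX].
Qed.

Let Theta w w' := charmod (w - w') + charmod (w + w').

(** The product formulas express Q w * Q w' through the frequencies w - w' and
    w + w', each with coefficients whose squared norm is N w * N w'. *)
Let mean_QQ w w' : `|\int[P]_t (Q w t * Q w' t)| <=
  (N w + N w') / 4 * Theta w w'.
Proof.
have N0 v : 0 <= N v by rewrite addr_ge0 ?sqr_ge0.
pose A1 := p w * p w' + q w * q w'; pose B1 := p w * q w' - q w * p w'.
pose A2 := q w * q w' - p w * p w'; pose B2 := p w * q w' + q w * p w'.
have bAB A B v : bmfun (fun t => A * cos (v * U t) + B * sin (v * U t)).
  apply: bmfunD; apply: bmfunM; [exact: bmfun_cst|exact: bmfun_cosX|
    exact: bmfun_cst|exact: bmfun_sinX].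
have mAB A B v : \int[P]_t (A * cos (v * U t) + B * sin (v * U t)) =
    A * cosmean P U v + B * sinmean P U v.
  rewrite bmeanD; [|exact: bmfunM (bmfun_cst _) (bmfun_cosX mU v)|
    exact: bmfunM (bmfun_cst _) (bmfun_sinX mU v)].
  by rewrite !bmeanZl; [|exact: bmfun_sinX|exact: bmfun_cosX].
have -> : \int[P]_t (Q w t * Q w' t) = 2^-1 *
    (A1 * cosmean P U (w - w') + B1 * sinmean P U (w - w')
   + (A2 * cosmean P U (w + w') + B2 * sinmean P U (w + w'))).
  rewrite -!mAB -bmeanD// -bmeanZl; last exact: bmfunD.
  apply: eq_Rintegral => t _.
  rewrite /Q [(w - w') * _]mulrBl [(w + w') * _]mulrDl sinB cosB sinD cosD.
  by rewrite /A1 /A2 /B1 /B2; field.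
rewrite normrM gtr0_norm ?invr_gt0//.
have h1 : `|A1 * cosmean P U (w - w') + B1 * sinmean P U (w - w')| <=
    (N w + N w') / 2 * charmod (w - w').
  by apply: normr_linear_le => //; rewrite /A1 /B1 /N; ring.
have h2 : `|A2 * cosmean P U (w + w') + B2 * sinmean P U (w + w')| <=
    (N w + N w') / 2 * charmod (w + w').
  by apply: normr_linear_le => //; rewrite /A2 /B2 /N; ring.
rewrite ler_pdivrMl//; apply: le_trans (ler_normD _ _) _.
apply: le_trans (lerD h1 h2) _; rewrite /Theta le_eqVlt; apply/orP; left.
by apply/eqP; field.
Qed.

Variable X : R.
Hypothesis charmod_integral : (\int[mu]_w (charmod w)%:E <= X%:E)%E.

Let m1 : measurable_fun setT (fun z : R * R => z.1 - z.2).
Proof. by apply: measurable_funB; [exact: measurable_fst|exact: measurable_snd]. Qed.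

Let m2 : measurable_fun setT (fun z : R * R => z.1 + z.2).
Proof. by apply: measurable_funD; [exact: measurable_fst|exact: measurable_snd]. Qed.

Let bTheta : bmfun (fun z : R * R => Theta z.1 z.2).
Proof.
by apply: bmfunD; [exact: bmfun_comp bmfun_charmod m1|exact: bmfun_comp bmfun_charmod m2].
Qed.

Let bTheta1 w : bmfun (Theta w).
Proof. exact: (bmfun_comp bTheta (measurable_pair1 w)). Qed.

Let ThetaC w w' : Theta w w' = Theta w' w.
Proof. by rewrite /Theta -charmodN opprB addrC addrC [w + w']addrC. Qed.

Let Theta_integral w : \int[mu]_(w' in `[a, b]) Theta w w' <= 2 * X.
Proof.
have bc : measurable_fun setT charmod by case: bmfun_charmod.
have ch0 v : 0 <= charmod v by exact: sqrtr_ge0.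
rewrite -lee_fin /Rintegral fineK; last first.
  by apply: integrable_fin_num => //; exact: bmfun_integrable_itv.
apply: (@le_trans _ _ (\int[mu]_w' (charmod (w - w') + charmod (w + w'))%:E)%E).
  apply: ge0_subset_integral => //.
    by apply/measurable_EFinP; case: (bTheta1 w).
  by move=> v _; rewrite lee_fin addr_ge0.
under eq_integral do rewrite EFinD.
rewrite ge0_integralD//=; last 4 first.
- by move=> v _; rewrite lee_fin.
- apply/measurable_EFinP; exact: (measurableT_comp bc
    (measurable_funB (measurable_cst w) (@measurable_id _ _ setT))).
- by move=> v _; rewrite lee_fin.
- apply/measurable_EFinP; exact: (measurableT_comp bc
    (measurable_funD (measurable_cst w) (@measurable_id _ _ setT))).
by rewrite ge0_integral_subl// ge0_integral_addl// mulr_natl mulr2n EFinD leeD.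
Qed.

Let Dy : (mu `[a, b] < +oo)%E := lebesgue_itv_lty a b.
Let Py : (P setT < +oo)%E := probability_setT_lty P.
Let mD : measurable (`[a, b]%classic : set (measurableTypeR R)).
Proof. exact: measurable_itv. Qed.

Let mwU : measurable_fun setT (fun z : T * R => z.2 * U z.1).
Proof.
apply: measurable_funM; first exact: measurable_snd.
by apply: measurableT_comp => //; exact: measurable_fst.
Qed.

Let bsnd (f : R -> R) : bmfun f -> bmfun (fun z : T * R => f z.2).
Proof. by move=> bf; exact: bmfun_comp bf measurable_snd. Qed.

Let bQj : bmfun (fun z : T * R => Q z.2 z.1).
Proof.
apply: bmfunD; apply: bmfunM; [exact: bsnd|exact: bmfun_sin|exact: bsnd|exact: bmfun_cos].
Qed.

Let I t := \int[mu]_(w in `[a, b]) Q w t.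

Let bI : bmfun I.
Proof. exact: (@bmfun_Rintegral R _ _ T (measurableTypeR R) mu _ mD Dy _ bQj). Qed.

Let bN : bmfun N.
Proof. by apply: bmfunD; exact: bmfunX. Qed.

Let bQt t : bmfun (Q^~ t).
Proof. exact: (bmfun_comp bQj (measurable_pair1 t)). Qed.

(** Schur's test: the square of the integral is a double integral over (w, w'),
    whose mean is bounded by (N w + N w')/4 * Theta w w'.  By symmetry both terms
    contribute equally, and Theta w has integral at most 2X by translation and
    reflection invariance. *)
Lemma mean_square_trig_integral :
  \int[P]_t (\int[mu]_(w in `[a, b]) (p w * sin (w * U t) + q w * cos (w * U t))) ^+ 2
  <= X * \int[mu]_(w in `[a, b]) (p w ^+ 2 + q w ^+ 2).
Proof.
rewrite -/(I _).
pose J w := \int[P]_t (Q w t * I t).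
have e1 : \int[P]_t I t ^+ 2 = \int[mu]_(w in `[a, b]) J w.
  rewrite /J -(@bmfun_Fubini R _ _ T (measurableTypeR R) P mu setT `[a, b]%classic
    (fun z => Q z.2 z.1 * I z.1))//; last first.
    by apply: bmfunM => //; exact: bmfun_comp bI measurable_fst.
  apply: eq_Rintegral => t _; rewrite expr2 {1}/I -RintegralZr//.
  exact: bmfun_integrable_itv.
have e2 w : J w = \int[mu]_(w' in `[a, b]) \int[P]_t (Q w t * Q w' t).
  rewrite -(@bmfun_Fubini R _ _ T (measurableTypeR R) P mu setT `[a, b]%classic
    (fun z => Q w z.1 * Q z.2 z.1))//; last first.
    by apply: bmfunM => //; exact: bmfun_comp (bQ w) measurable_fst.
  apply: eq_Rintegral => t _ /=; rewrite RintegralZl//.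
  exact: bmfun_integrable_itv.
have bfst (f : R -> R) : bmfun f -> bmfun (fun z : R * R => f z.1).
  by move=> bf; exact: bmfun_comp bf measurable_fst.
have bsnd' (f : R -> R) : bmfun f -> bmfun (fun z : R * R => f z.2).
  by move=> bf; exact: bmfun_comp bf measurable_snd.
have bNT1 : bmfun (fun z : R * R => N z.1 * Theta z.1 z.2).
  by apply: bmfunM => //; exact: bfst.
have bNT2 : bmfun (fun z : R * R => N z.2 * Theta z.1 z.2).
  by apply: bmfunM => //; exact: bsnd'.
have section (F : R * R -> R) w : bmfun F -> bmfun (fun w' => F (w, w')).
  by move=> bF; exact: (bmfun_comp bF (measurable_pair1 w)).
have inner (F : R * R -> R) : bmfun F ->
    bmfun (fun w => \int[mu]_(w' in `[a, b]) F (w, w')).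
  by move=> bF; exact: (@bmfun_Rintegral R _ _ _ (measurableTypeR R) mu _ mD Dy _ bF).
pose S1 := \int[mu]_(w in `[a, b]) \int[mu]_(w' in `[a, b]) (N w * Theta w w').
pose S2 := \int[mu]_(w in `[a, b]) \int[mu]_(w' in `[a, b]) (N w' * Theta w w').
have S1le : S1 <= 2 * X * \int[mu]_(w in `[a, b]) N w.
  rewrite -RintegralZl//; last exact: bmfun_integrable_itv.
  apply: le_Rintegral => //.
  - by apply: bmfun_integrable_itv; exact: (inner (fun z => N z.1 * Theta z.1 z.2)).
  - by apply: bmfun_integrable_itv; apply: bmfunM => //; exact: bmfun_cst.
  move=> w _; rewrite RintegralZl//; last exact: bmfun_integrable_itv.
  by rewrite mulrC ler_wpM2r// addr_ge0 ?sqr_ge0.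
have bJ : bmfun J.
  have bF : bmfun (fun z : R * T => Q z.1 z.2 * I z.2).
    apply: bmfunM; last exact: bmfun_comp bI measurable_snd.
    exact: (bmfun_comp (g := fun z : R * T => (z.2, z.1)) bQj
      (measurable_fun_pair measurable_snd measurable_fst)).
  exact: (bmfun_Rintegral measurableT Py bF).
have Jle w : J w <= 4^-1 * (\int[mu]_(w' in `[a, b]) (N w * Theta w w') +
    \int[mu]_(w' in `[a, b]) (N w' * Theta w w')).
  have b1 : bmfun (fun w' => N w * Theta w w').
    exact: (section (fun z => N z.1 * Theta z.1 z.2)).
  have b2 : bmfun (fun w' => N w' * Theta w w').
    exact: (section (fun z => N z.2 * Theta z.1 z.2)).
  rewrite e2 -RintegralD//; [|exact: bmfun_integrable_itv|exact: bmfun_integrable_itv].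
  rewrite -RintegralZl//; last by apply: bmfun_integrable_itv; exact: bmfunD.
  apply: le_Rintegral => //.
  - apply: bmfun_integrable_itv.
    have bF : bmfun (fun z : R * T => Q w z.2 * Q z.1 z.2).
      apply: bmfunM; first exact: bmfun_comp (bQ w) measurable_snd.
      exact: (bmfun_comp (g := fun z : R * T => (z.2, z.1)) bQj
        (measurable_fun_pair measurable_snd measurable_fst)).
    exact: (bmfun_Rintegral measurableT Py bF).
  - apply: bmfun_integrable_itv; apply: bmfunM; first exact: bmfun_cst.
    exact: bmfunD.
  move=> w' _; apply: le_trans (ler_norm _) _; apply: le_trans (mean_QQ _ _) _.
  by rewrite le_eqVlt; apply/orP; left; apply/eqP; field.
rewrite e1; apply: (@le_trans _ _ (4^-1 * (S1 + S2))).
  rewrite -RintegralD//; last 2 first.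
  - by apply: bmfun_integrable_itv; exact: (inner (fun z => N z.1 * Theta z.1 z.2)).
  - by apply: bmfun_integrable_itv; exact: (inner (fun z => N z.2 * Theta z.1 z.2)).
  have b12 : bmfun (fun w => \int[mu]_(w' in `[a, b]) (N w * Theta w w') +
      \int[mu]_(w' in `[a, b]) (N w' * Theta w w')).
    by apply: bmfunD; [exact: (inner (fun z => N z.1 * Theta z.1 z.2))|
      exact: (inner (fun z => N z.2 * Theta z.1 z.2))].
  rewrite -RintegralZl//; last exact: bmfun_integrable_itv.
  apply: le_Rintegral => //; first exact: bmfun_integrable_itv.
  by apply: bmfun_integrable_itv; apply: bmfunM => //; exact: bmfun_cst.
have -> : S2 = S1.
  transitivity (\int[mu]_(w' in `[a, b]) \int[mu]_(w in `[a, b]) (N w' * Theta w w')).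
    exact: (@bmfun_Fubini R _ _ (measurableTypeR R) (measurableTypeR R) mu mu _ _
      (fun z => N z.2 * Theta z.1 z.2) mD mD Dy Dy bNT2).
  by apply: eq_Rintegral => w _; apply: eq_Rintegral => w' _; rewrite ThetaC.
move: S1le; rewrite -/(N _); move: S1 (\int[mu]_(w in _) N w) => s1 iN; lra.
Qed.

End quadratic_form.

(** * Inversion of the characteristic function *)

Section bounded_convergence.
Context d (T : measurableType d) (R : realType) (P : probability T R).

Lemma bounded_convergence (f_ : (T -> R)^nat) (f : T -> R) (M : R) (N : set T) :
  (forall n, measurable_fun setT (f_ n)) -> measurable_fun setT f ->
  (forall n t, `|f_ n t| <= M) -> measurable N -> P N = 0%E ->
  (forall t, ~ N t -> f_ n t @[n --> \oo] --> f t) ->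
  \int[P]_t f_ n t @[n --> \oo] --> \int[P]_t f t.
Proof.
move=> mf_ mf fM mN N0 cf.
have [|||||iF _ h] := @dominated_convergence _ T R P setT measurableT
    (fun n => EFin \o f_ n) (EFin \o f) (cst M%:E).
- by move=> n; exact/measurable_EFinP.
- exact/measurable_EFinP.
- exists N; split => // t; apply: contra_notP => Nt _.
  by apply: cvg_EFin; [exact: nearW|exact: cf].
- by apply: bmfun_integrableP; exact: bmfun_cst.
- by apply/aeW => t n _ /=; rewrite lee_fin.
apply: fine_cvg; rewrite fineK; last exact: integrable_fin_num.
exact: h.
Qed.

End bounded_convergence.

Section bias.
Context d (T : measurableType d) (R : realType) (P : probability T R).
Notation mu := (@lebesgue_measure R).

(** Im (e^{-iwt0} E e^{iwX}) / w. *)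
Definition inversion_integrand (X : T -> R) (t0 w : R) : R :=
  w^-1 * (sinmean P X w * cos (w * t0) - cosmean P X w * sin (w * t0)).

(** In the mean the noise cancels: E e^{iwY} / phi(w) = E e^{iwX}.  The interval
    stays away from 0, where the weight of [dkernE] is bounded and Fubini
    applies. *)
Lemma mean_dint (c s : R -> R) (X Y : T -> R) (t0 a b : R) :
  bmfun c -> bmfun s ->
  (forall B : R, exists2 c0, 0 < c0 &
    forall w, 0 <= w <= B -> c0 <= c w ^+ 2 + s w ^+ 2) ->
  measurable_fun setT X -> measurable_fun setT Y ->
  (forall w, cosmean P Y w = cosmean P X w * c w - sinmean P X w * s w) ->
  (forall w, sinmean P Y w = sinmean P X w * c w + cosmean P X w * s w) ->
  0 < a ->
  \int[P]_t dint c s a b (Y t - t0) =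
  \int[mu]_(w in `[a, b]) inversion_integrand X t0 w.
Proof.
move=> bc bs r_lb mX mY cY sY a0.
have bk := bmfun_kernel_weight bc bs r_lb b a0.
pose k := kernel_weight c s a b.
pose F (z : T * R) := k z.2 * c z.2 * sin (z.2 * (Y z.1 - t0)) +
  (- (k z.2 * s z.2)) * cos (z.2 * (Y z.1 - t0)).
have mwY : measurable_fun setT (fun z : T * R => z.2 * (Y z.1 - t0)).
  apply: measurable_funM; first exact: measurable_snd.
  by apply: measurable_funB => //; apply: measurableT_comp => //; exact: measurable_fst.
have bsnd (f : R -> R) : bmfun f -> bmfun (fun z : T * R => f z.2).
  by move=> bf; exact: bmfun_comp bf measurable_snd.
have bF : bmfun F.
  apply: bmfunD; apply: bmfunM.
  - by apply: bmfunM; exact: bsnd.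
  - exact: bmfun_sin.
  - by apply: bmfunN; apply: bmfunM; exact: bsnd.
  - exact: bmfun_cos.
transitivity (\int[P]_t \int[mu]_(w in `[a, b]) F (t, w)).
  apply: eq_Rintegral => t _; apply: eq_Rintegral => w.
  by rewrite inE/= in_itv/= => awb; rewrite (dkernE _ _ _ awb).
rewrite (@bmfun_Fubini R _ _ T (measurableTypeR R) P mu setT `[a, b]%classic)//;
  [|exact: probability_setT_lty|exact: lebesgue_itv_lty].
apply: eq_Rintegral => w; rewrite inE/= in_itv/= => awb.
have mYt : measurable_fun setT (fun t => w * (Y t - t0)).
  by apply: measurable_funM => //; exact: measurable_funB.
rewrite /F/= bmeanD; last 2 first.
- by apply: bmfunM; [exact: bmfun_cst|exact: bmfun_sin].
- by apply: bmfunM; [exact: bmfun_cst|exact: bmfun_cos].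
rewrite !bmeanZl; [|exact: bmfun_cos|exact: bmfun_sin].
rewrite mean_sin_shift// mean_cos_shift// cY sY.
have [aw wb] := andP awb; have w0 : 0 < w by exact: lt_le_trans aw.
have [c0 c00 /(_ w)] := r_lb b; rewrite (ltW w0) wb => /(_ isT) cr.
have r0 : c w ^+ 2 + s w ^+ 2 != 0 by rewrite gt_eqF// (lt_le_trans c00).
rewrite /inversion_integrand /k /kernel_weight indicE mem_set/=; last by rewrite in_itv.
by field; rewrite r0 gt_eqF.
Qed.

(** The previous lemma without noise (phi = 1) turns the left-hand side into the
    mean of a difference of sine integrals at X - t0, which are bounded and
    converge to pi/2 times the sign of X - t0 outside of the null event X = t0. *)
Lemma gil_pelaez (X : T -> R) (t0 : R) : measurable_fun setT X ->
  P [set t | X t = t0] = 0%E ->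
  \int[mu]_(w in `[n.+1%:R^-1, n.+1%:R]) inversion_integrand X t0 w @[n --> \oo] -->
  pi * (2^-1 - fine (P [set t | X t <= t0])).
Proof.
move=> mX X0.
have d1 (w u : R) : dkern (cst 1) (cst 0) w u = sin (w * u) / w.
  by rewrite /dkern/= !expr1n expr0n/= addr0 mul1r mul0r subr0 divr1 mulrC.
have eS n (u : R) : dint (cst 1) (cst 0) n.+1%:R^-1 n.+1%:R u =
    sine_integral n.+1%:R u - sine_integral n.+1%:R^-1 u.
  rewrite /dint; under eq_Rintegral do rewrite d1.
  rewrite /sine_integral
    [X in X - _](@Rintegral_itv_cat R (fun w => sin (w * u) / w) 0 n.+1%:R^-1 n.+1%:R).
  - by rewrite addrAC subrr add0r.
  - by rewrite invr_ge0.
  - by rewrite (@le_trans _ _ 1)// ?invf_le1// ler1n.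
  - by apply: bmfun_integrable_itv; exact: bmfun_sinc.
have -> : (fun n => \int[mu]_(w in `[n.+1%:R^-1, n.+1%:R]) inversion_integrand X t0 w) =
    (fun n => \int[P]_t dint (cst 1) (cst 0) n.+1%:R^-1 n.+1%:R (X t - t0)).
  apply/funext => n; rewrite (@mean_dint _ _ X)//.
  - exact: bmfun_cst.
  - exact: bmfun_cst.
  - by move=> B; exists 1 => // w _; rewrite expr1n expr0n/= addr0.
  - by move=> w; rewrite mulr1 mulr0 subr0.
  - by move=> w; rewrite mulr1 mulr0 addr0.
have mle : measurable [set t | X t <= t0].
  by rewrite -[X in measurable X]setTI; exact: (measurable_fun_ler mX (measurable_cst t0)).
have meq : measurable [set t | X t = t0].
  rewrite (_ : mkset _ = X @^-1` [set t0])//.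
  by rewrite -[X in measurable X]setTI; apply: mX.
have -> : pi * (2^-1 - fine (P [set t | X t <= t0])) =
    \int[P]_t (pi / 2 - pi * \1_[set t | X t <= t0] t).
  rewrite bmeanB; [|exact: bmfun_cst|by apply: bmfunM; [exact: bmfun_cst|exact: bmfun_indic]].
  rewrite mean_cst bmeanZl; last exact: bmfun_indic.
  by rewrite mulrBr /Rintegral integral_indic// setIT.
apply: (@bounded_convergence _ _ _ _ _ _ 8 [set t | X t = t0]) => //.
- move=> n; apply: (measurableT_comp (measurable_dint _ _ _ _)).
  + exact: bmfun_cst.
  + exact: bmfun_cst.
  + exact: measurable_funB.
- exact: (proj1 (bmfunB (bmfun_cst (pi / 2)) (bmfunM (bmfun_cst pi) (bmfun_indic mle)))).
- move=> n t; rewrite eS (le_trans (ler_normB _ _))//.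
  have -> : 8 = 4 + 4 :> R by lra.
  by rewrite lerD// sine_integral_bounded// invr_ge0.
move=> t /= Xt0.
under eq_fun do rewrite eS.
have c1 : sine_integral n.+1%:R^-1 (X t - t0) @[n --> \oo] --> (0 : R).
  apply/norm_cvg0P; apply: (@squeeze_cvgr _ _ _ _ (cst 0) (fun n => n.+1%:R^-1 * `|X t - t0|)).
  - by apply: nearW => n; rewrite normr_ge0 sine_integral_le// invr_ge0.
  - exact: cvg_cst.
  - rewrite -[X in _ --> X](mul0r `|X t - t0|); apply: cvgM; last exact: cvg_cst.
    exact: cvg_harmonic.
have c2 v : 0 < v -> sine_integral n.+1%:R v @[n --> \oo] --> (pi / 2 : R).
  move=> v0; apply/cvgrPdist_le => e e0.
  near=> n; rewrite distrC (le_trans (sine_integral_pi2 _ v0))//.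
  rewrite ler_pdivrMr// -ler_pdivrMl//; near: n.
  by apply: filterS (nbhs_infty_ger (e^-1 * (2 / v))) => n hn; rewrite (le_trans hn)// ler_nat.
have -> : (pi : R) / 2 - pi * \1_[set t | X t <= t0] t =
    (if 0 < X t - t0 then pi / 2 else - (pi / 2)) - 0.
  rewrite indicE subr0 subr_gt0; case: ltP => h.
    by rewrite memNset ?mulr0 ?subr0//= => h'; move: h; rewrite ltNge h'.
  by rewrite mem_set//= mulr1; lra.
apply: cvgB c1; case: ifPn => [|h]; first exact: c2.
have h' : 0 < - (X t - t0).
  by rewrite oppr_gt0 lt_neqAle subr_eq0 leNgt h andbT; exact/eqP.
under eq_fun do rewrite -[X t - t0]opprK sine_integralN.
by apply: cvgN; exact: c2.
Unshelve. all: by end_near. Qed.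

End bias.

(** * Bias of the truncated inversion *)

(** What the estimates require of phi = c + is.  The last two fields say that, near
    0, the kernel differs from the sine kernel centred at m by an integrable
    function, uniformly in u. *)
Record admissible_kernel (R : realType) (c s : R -> R) (m : R) (H : R -> R) : Prop :=
  AdmissibleKernel {
  kernel_bc : bmfun c;
  kernel_bs : bmfun s;
  kernel_lb : forall B : R, exists2 c0, 0 < c0 &
    forall w, 0 <= w <= B -> c0 <= c w ^+ 2 + s w ^+ 2;
  kernel_iH : (@lebesgue_measure R).-integrable `[0, 1] (EFin \o H);
  kernel_near0 : forall w u, 0 <= w <= 1 ->
    `|dkern c s w u - sin (w * (u - m)) / w| <= H w }.

Section kernel_bounds.
Context (R : realType).
Notation mu := (@lebesgue_measure R).
Variables (c s : R -> R) (m : R) (H : R -> R).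
Hypothesis adm : admissible_kernel c s m H.

Let bc := kernel_bc adm.
Let bs := kernel_bs adm.
Let lb := kernel_lb adm.

Lemma bmfun_dint a b : 0 < a -> bmfun (dint c s a b).
Proof.
move=> a0; have bk := bmfun_kernel_weight bc bs lb b a0.
pose k := kernel_weight c s a b.
have bsnd (f : R -> R) : bmfun f -> bmfun (fun z : R * R => f z.2).
  by move=> bf; exact: bmfun_comp bf measurable_snd.
have mp : measurable_fun setT (fun z : R * R => z.2 * z.1).
  by apply: measurable_funM; [exact: measurable_snd|exact: measurable_fst].
have bF : bmfun (fun z : R * R => k z.2 * c z.2 * sin (z.2 * z.1) +
    (- (k z.2 * s z.2)) * cos (z.2 * z.1)).
  apply: bmfunD; apply: bmfunM.
  - by apply: bmfunM; exact: bsnd.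
  - exact: bmfun_sin.
  - by apply: bmfunN; apply: bmfunM; exact: bsnd.
  - exact: bmfun_cos.
have := @bmfun_Rintegral R _ _ R (measurableTypeR R) mu _
  (measurable_itv `[a, b]) (lebesgue_itv_lty a b) _ bF.
rewrite (_ : (fun x => _) = dint c s a b)//.
apply/funext => u; apply: eq_Rintegral => w.
by rewrite inE/= in_itv/= => awb; rewrite (dkernE _ _ _ awb).
Qed.

Lemma dint_cat e b u : 0 <= e -> e <= b ->
  dint c s 0 b u = dint c s 0 e u + dint c s e b u.
Proof.
move=> e0 eb; apply: Rintegral_itv_cat => //.
by apply: (integrable_dkern0 bc bs lb (kernel_iH adm) (kernel_near0 adm)); exact: le_trans eb.
Qed.

Lemma bmfun_dint0 b : 1 <= b -> bmfun (dint c s 0 b).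
Proof.
move=> b1.
have -> : dint c s 0 b = (fun u => dint c s 0 1 u + dint c s 1 b u).
  by apply/funext => u; apply: dint_cat.
apply: bmfunD; last exact: bmfun_dint.
split; first exact: measurable_dint.
eexists => u; apply: (dint0_bounded bc bs lb (kernel_iH adm) (kernel_near0 adm)).
by rewrite ler01 lexx.
Qed.

Section bias.
Context d (T : measurableType d) (P : probability T R).
Variables (X Y : T -> R) (t0 : R).
Hypotheses (mX : measurable_fun setT X) (mY : measurable_fun setT Y).
Hypotheses
  (cY : forall w, cosmean P Y w = cosmean P X w * c w - sinmean P X w * s w)
  (sY : forall w, sinmean P Y w = sinmean P X w * c w + cosmean P X w * s w).

Lemma integrable_inversion a b : 0 < a ->
  mu.-integrable `[a, b] (EFin \o inversion_integrand P X t0).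
Proof.
move=> a0.
have bk : bmfun (kernel_weight (cst 1) (cst 0) a b : R -> R).
  apply: bmfun_kernel_weight => //; [exact: bmfun_cst|exact: bmfun_cst|].
  by move=> B; exists 1 => // w _; rewrite expr1n expr0n/= addr0.
have : mu.-integrable `[a, b] (EFin \o (fun w => kernel_weight (cst 1) (cst 0) a b w *
    (sinmean P X w * cos (w * t0) - cosmean P X w * sin (w * t0)))).
  apply: bmfun_integrable_itv; apply: bmfunM => //; apply: bmfunB; apply: bmfunM.
  - exact: bmfun_sinmean.
  - by apply: bmfun_cos; exact: mulrr_measurable.
  - exact: bmfun_cosmean.
  - by apply: bmfun_sin; exact: mulrr_measurable.
apply: eq_integrable => // w wab.
by rewrite /= /kernel_weight indicE wab expr1n expr0n/= addr0 invr1 mulr1 mul1r.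
Qed.

(** On [1/n, lambda] the mean of the noisy kernel is exactly the inversion
    integral, and that integral over [1/n, n] converges to pi (1/2 - F(t0)).  The
    difference is the inversion integral over [lambda, n], bounded by
    hypothesis, and the piece over [0, 1/n], which vanishes by bounded
    convergence. *)
Lemma bias_bound (lambda B : R) : 1 <= lambda -> P [set t | X t = t0] = 0%E ->
  (forall Lambda, lambda <= Lambda ->
    `|\int[mu]_(w in `[lambda, Lambda]) inversion_integrand P X t0 w| <= B) ->
  `|\int[P]_t (2^-1 - pi^-1 * dint c s 0 lambda (Y t - t0)) -
    fine (P [set t | X t <= t0])| <= B / pi.
Proof.
move=> l1 X0 HB; set F := fine _.
pose a_ (n : nat) : R := n.+1%:R^-1.
have a0 n : 0 < a_ n by rewrite invr_gt0.
have a1 n : a_ n <= 1 by rewrite invf_le1// ler1n.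
have mYt : measurable_fun setT (fun t => Y t - t0) by exact: measurable_funB.
have bD : bmfun (fun t => dint c s 0 lambda (Y t - t0)).
  by apply: (bmfun_comp _ mYt); exact: bmfun_dint0.
have bDa n : bmfun (fun t => dint c s (a_ n) lambda (Y t - t0)).
  by apply: (bmfun_comp _ mYt); exact: bmfun_dint.
set E := \int[P]_t dint c s 0 lambda (Y t - t0).
have -> : \int[P]_t (2^-1 - pi^-1 * dint c s 0 lambda (Y t - t0)) = 2^-1 - pi^-1 * E.
  rewrite bmeanB; [|exact: bmfun_cst|exact: bmfunM (bmfun_cst _) bD].
  by rewrite mean_cst bmeanZl.
have cu := gil_pelaez mX X0; rewrite -/F in cu.
pose v_ n := \int[P]_t dint c s (a_ n) lambda (Y t - t0).
have cv : v_ n @[n --> \oo] --> E.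
  have vE n : v_ n = E - \int[P]_t dint c s 0 (a_ n) (Y t - t0).
    have e t : dint c s 0 (a_ n) (Y t - t0) =
        dint c s 0 lambda (Y t - t0) - dint c s (a_ n) lambda (Y t - t0).
      by rewrite (@dint_cat (a_ n) lambda) ?(ltW (a0 n)) ?(le_trans (a1 n))// addrK.
    under [in RHS]eq_Rintegral do rewrite e.
    by rewrite bmeanB// -/E -/(v_ n) opprB addrC subrK.
  have h : \int[P]_t dint c s 0 (a_ n) (Y t - t0) @[n --> \oo] --> \int[P]_t (0 : R).
    apply: (@bounded_convergence _ _ _ _ _ _ (4 + \int[mu]_(w in `[0, 1]) H w) set0) => //.
    - by move=> n; apply: (measurableT_comp (measurable_dint bc bs _ _)).
    - move=> n t; apply: (dint0_bounded bc bs lb (kernel_iH adm) (kernel_near0 adm)).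
      by rewrite a1 ltW.
    - move=> t _; exact: (dint0_cvg0 bc bs lb (kernel_iH adm) (kernel_near0 adm)).
  rewrite mean_cst in h.
  rewrite (_ : v_ = fun n => E - \int[P]_t dint c s 0 (a_ n) (Y t - t0)).
    have := cvgB (cvg_cst E) h; rewrite subr0.
    apply.
  by apply/funext => n; exact: vE.
have cuv : \int[mu]_(w in `[n.+1%:R^-1, n.+1%:R]) inversion_integrand P X t0 w - v_ n
    @[n --> \oo] --> pi * (2^-1 - F) - E.
  exact: cvgB cu cv.
have pi0 : 0 < pi :> R := pi_gt0 R.
suff h : `|pi * (2^-1 - F) - E| <= B.
  rewrite (_ : 2^-1 - pi^-1 * E - F = (pi * (2^-1 - F) - E) / pi); last first.
    by move: pi0; move: (pi : R) => p p0; field; rewrite gt_eqF.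
  by rewrite normrM normfV (gtr0_norm pi0) ler_pM2r// invr_gt0.
apply: (cvgr_to_le (cvg_norm cuv)).
have := nbhs_infty_ger lambda; apply: filterS => n ln.
have ln1 : lambda <= n.+1%:R by rewrite (le_trans ln)// ler_nat.
rewrite /= /v_ (mean_dint t0 lambda bc bs lb mX mY cY sY (a0 n)).
rewrite (@Rintegral_itv_cat R _ (a_ n) lambda n.+1%:R) ?(le_trans (a1 n))//.
  by rewrite addrAC subrr add0r HB.
exact: integrable_inversion.
Qed.

End bias.
End kernel_bounds.

(** * Powers of 1 + w^2 *)

Section bracket.
Context (R : realType).
Notation mu := (@lebesgue_measure R).

Lemma addr1sqr_gt0 (w : R) : 0 < 1 + w ^+ 2.
Proof. by rewrite ltr_wpDr// sqr_ge0. Qed.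

Lemma bracket_powR_le (x w : R) : 1 <= w ->
  (1 + w ^+ 2) `^ x <= 2 `^ `|x| * w `^ (2 * x).
Proof.
move=> w1; have w0 : 0 <= w by exact: le_trans w1.
have -> : w `^ (2 * x) = (w ^+ 2) `^ x by rewrite powRrM powR_mulrn.
have w2 : 1 <= w ^+ 2 by rewrite exprn_ege1.
have [x0|x0] := leP 0 x.
  rewrite ger0_norm// -powRM// ?sqr_ge0//; apply: ge0_ler_powR => //.
  - by rewrite nnegrE ltW// addr1sqr_gt0.
  - by rewrite nnegrE mulr_ge0// sqr_ge0.
  - lra.
apply: (@le_trans _ _ ((w ^+ 2) `^ x)).
  have w20 : 0 < w ^+ 2 by exact: lt_le_trans w2.
  rewrite -[x]opprK 2!(powRN _ (- x)) lef_pV2 ?posrE ?powR_gt0 ?addr1sqr_gt0//.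
  apply: ge0_ler_powR.
  - by rewrite oppr_ge0 ltW.
  - by rewrite nnegrE sqr_ge0.
  - by rewrite nnegrE ltW// addr1sqr_gt0.
  - by rewrite lerDr.
rewrite ler_peMl ?powR_ge0//.
by rewrite -[X in X <= _](powRr0 2) ler_powR// ler1n.
Qed.

Lemma continuous_bracket_powR (x : R) : continuous (fun w : R => (1 + w ^+ 2) `^ x).
Proof.
move=> w; apply: (@cvg_comp _ _ _ (fun w : R => 1 + w ^+ 2) (@powR R ^~ x)
    _ (nbhs (1 + w ^+ 2))).
  by apply: cvgD; [exact: cvg_cst|exact: exprn_continuous].
exact: continuous_at_powR (addr1sqr_gt0 w).
Qed.

(** By symmetry it is twice the integral over the half line, which is split at 1,
    with the integrand at most 1 below and a pure power above. *)
Lemma integral_bracket_powR (g : R) : 1 / 2 < g ->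
  exists2 K : R, 0 <= K & (\int[mu]_w ((1 + w ^+ 2) `^ (- g))%:E <= K%:E)%E.
Proof.
move=> g2; have g0 : 0 < g by apply: lt_trans g2; rewrite divr_gt0.
pose K := 2 * (1 + 2 `^ `|- g| * (- (1 - 2 * g)^-1)).
have K0 : 0 <= K.
  rewrite /K mulr_ge0// addr_ge0// mulr_ge0 ?powR_ge0// oppr_ge0 invr_le0; lra.
exists K => //; rewrite ge0_symfun_integralT.
- rewrite /K EFinM lee_wpmul2l// -set_itvcy (@itv_bndbnd_setU _ _ _ (BLeft 1)) ?bnd_simp//.
  have mb : measurable_fun setT (EFin \o (fun w : R => (1 + w ^+ 2) `^ (- g))).
    apply/measurable_EFinP; apply: continuous_measurable_fun.
    exact: continuous_bracket_powR.
  rewrite ge0_integral_setU//=.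
  + rewrite EFinD leeD//.
      apply: (@le_trans _ _ (\int[mu]_(w in `[0%R, 1%R[) (cst 1%E) w)%E).
        apply: ge0_le_integral => //.
        * by move=> w _; rewrite lee_fin powR_ge0.
        * exact: measurable_funTS.
        * move=> w _; rewrite lee_fin powRN invf_le1 ?powR_gt0 ?addr1sqr_gt0//.
          rewrite -[X in X <= _](powRr0 (1 + w ^+ 2)) ler_powR ?lerDl ?sqr_ge0//.
          exact: ltW.
      by rewrite integral_cst//= mul1e lebesgue_measure_itv/= lte_fin ltr01 oppr0 adde0.
    apply: (@le_trans _ _ (\int[mu]_(w in `[1%R, +oo[)
        (2 `^ `|- g| * w `^ ((1 - 2 * g) - 1))%:E)%E).
      apply: ge0_le_integral => //.
      * by move=> w _; rewrite lee_fin powR_ge0.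
      * exact: measurable_funTS.
      * apply: measurable_funTS; apply/measurable_EFinP.
        by apply: (measurable_funM (measurable_cst _)); exact: measurable_powR.
      * move=> w /=; rewrite in_itv/= andbT => w1; rewrite lee_fin.
        rewrite (_ : 1 - 2 * g - 1 = 2 * - g); last by lra.
        exact: bracket_powR_le.
    under eq_integral do rewrite EFinM.
    have mp : measurable_fun (`[1%R, +oo[%classic : set R)
        (fun w => (w `^ (1 - 2 * g - 1))%:E).
      by apply: measurable_funTS; apply/measurable_EFinP; exact: measurable_powR.
    rewrite ge0_integralZl//; last by move=> w _; rewrite lee_fin powR_ge0.
    rewrite EFinM lee_wpmul2l ?lee_fin ?powR_ge0//.
    by apply: integral_powR_nearoo; lra.
  + exact: measurable_funTS.
  + by move=> w _; rewrite lee_fin powR_ge0.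
  + apply/disj_setPS => y [/=]; rewrite 2!in_itv/= => /andP[_ y1].
    by rewrite andbT leNgt y1.
- by move=> w; rewrite powR_ge0.
- exact: continuous_bracket_powR.
- by move=> w /=; rewrite sqrrN.
Qed.

End bracket.

(** * Size and second moment of the high frequencies *)

Section kernel_moments.
Context (R : realType).
Notation mu := (@lebesgue_measure R).
Variables (c s : R -> R) (m : R) (H : R -> R).
Hypothesis adm : admissible_kernel c s m H.
Variables (beta cz : R).
Hypotheses (beta0 : 0 < beta) (cz0 : 0 < cz).
Hypothesis lbz : forall w,
  cz * (1 + w ^+ 2) `^ (- beta / 2) <= Num.sqrt (c w ^+ 2 + s w ^+ 2).

Let r w := c w ^+ 2 + s w ^+ 2.
Let k := 2 `^ (beta / 2) / cz.

Let k0 : 0 <= k.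
Proof. by rewrite divr_ge0 ?powR_ge0// ltW. Qed.

Let sqrt_r_gt0 w : 0 < Num.sqrt (r w).
Proof.
by apply: lt_le_trans (lbz w); rewrite mulr_gt0// powR_gt0// addr1sqr_gt0.
Qed.

Let r_sqr w : r w = Num.sqrt (r w) ^+ 2.
Proof. by rewrite sqr_sqrtr// addr_ge0 ?sqr_ge0. Qed.

Let inv_modulus_le w : 1 <= w -> (Num.sqrt (r w))^-1 <= k * w `^ beta.
Proof.
move=> w1.
have b0 : 0 < (1 + w ^+ 2) `^ (beta / 2) by rewrite powR_gt0// addr1sqr_gt0.
apply: (@le_trans _ _ (cz^-1 * (1 + w ^+ 2) `^ (beta / 2))).
  have := lbz w; rewrite mulNr powRN -/(r w) => h.
  rewrite -[leRHS]invrK lef_pV2 ?posrE ?invr_gt0 ?mulr_gt0 ?invr_gt0//.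
  by rewrite invfM invrK.
rewrite /k [_ / cz]mulrC -mulrA ler_pM2l ?invr_gt0//.
have := bracket_powR_le (beta / 2) w1.
rewrite ger0_norm; last by rewrite divr_ge0// ltW.
by rewrite (_ : 2 * (beta / 2) = beta)//; field.
Qed.

Lemma normr_dkern_le w u : 1 <= w -> `|dkern c s w u| <= k * w `^ (beta - 1).
Proof.
move=> w1; have w0 : 0 < w by exact: lt_le_trans w1.
have h : `|c w * sin (w * u) - s w * cos (w * u)| <= Num.sqrt (r w).
  rewrite -sqrtr_sqr ler_sqrt ?addr_ge0 ?sqr_ge0// -subr_ge0.
  have -> : r w = r w * (cos (w * u) ^+ 2 + sin (w * u) ^+ 2) by rewrite cos2Dsin2 mulr1.
  rewrite (_ : _ - _ = (c w * cos (w * u) + s w * sin (w * u)) ^+ 2) ?sqr_ge0//.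
  by rewrite /r; ring.
rewrite /dkern -/(r w) !normrM !normfV (gtr0_norm w0).
have -> : `|r w| = Num.sqrt (r w) * Num.sqrt (r w).
  by rewrite ger0_norm ?addr_ge0 ?sqr_ge0// {1}r_sqr expr2.
have -> : k * w `^ (beta - 1) = w^-1 * (k * w `^ beta).
  rewrite powRD; last by rewrite (gt_eqF w0) implybT.
  by rewrite powR_inv1 ?(ltW w0)//; ring.
rewrite ler_pM2l ?invr_gt0//; apply: le_trans (inv_modulus_le w1).
rewrite invfM mulrA -[leRHS]mul1r ler_pM2r ?invr_gt0//.
by rewrite ler_pdivrMr// mul1r.
Qed.

Lemma normr_dint1_le lambda u : 1 <= lambda ->
  `|dint c s 1 lambda u| <= k / beta * lambda `^ beta.
Proof.
move=> l1.
have ip : mu.-integrable `[1, lambda] (EFin \o (fun w => w `^ (beta - 1))).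
  apply/integrableP; split.
    by apply: measurable_funTS; apply/measurable_EFinP; exact: measurable_powR.
  under eq_integral do rewrite /= ger0_norm ?powR_ge0//.
  by rewrite integral_powR ?ltry// gt_eqF.
have ikp := @integrable_EFinZl _ _ _ mu _ k _ (measurable_itv `[1, lambda]) ip.
apply: (@le_trans _ _ (\int[mu]_(w in `[1, lambda]) (k * w `^ (beta - 1)))).
  apply: (@normr_Rintegral_le _ _ _ mu _ _ _ _ _ ikp) => //.
    exact: (measurable_dkern1 (kernel_bc adm) (kernel_bs adm)).
  by move=> w /=; rewrite in_itv/= => /andP[w1 _]; exact: normr_dkern_le.
rewrite RintegralZl// -mulrA ler_wpM2l//.
rewrite /Rintegral integral_powR ?gt_eqF//= lerBlDr lerDl.
by rewrite mulr_ge0 ?powR_ge0// invr_ge0 ltW.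
Qed.

Section second_moment.
Context d (T : measurableType d) (P : probability T R).
Variables (Y : T -> R) (t0 X0 : R).
Hypotheses (mY : measurable_fun setT Y).
Hypothesis charmod_integral : (\int[mu]_w (charmod P Y w)%:E <= X0%:E)%E.

Let mYt : measurable_fun setT (fun t => Y t - t0).
Proof. exact: measurable_funB. Qed.

Let charmod_shift w : charmod P (fun t => Y t - t0) w = charmod P Y w.
Proof.
rewrite /charmod /cosmean /sinmean mean_cos_shift// mean_sin_shift//.
congr Num.sqrt; rewrite -[RHS]mulr1 -(cos2Dsin2 (w * t0)).
by rewrite /cosmean /sinmean; ring.
Qed.

(** [mean_square_trig_integral] for the law of Y - t0, whose characteristic
    function has the same modulus as that of Y; the squared coefficients add up
    to (w |phi(w)|)^{-2}. *)
Lemma mean_square_dint1 lambda : 1 <= lambda ->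
  \int[P]_t (dint c s 1 lambda (Y t - t0)) ^+ 2 <=
  X0 * (k ^+ 2 * \int[mu]_(w in `[1, lambda]) w `^ (2 * beta - 2)).
Proof.
move=> l1.
have X00 : 0 <= X0.
  rewrite -lee_fin; apply: le_trans charmod_integral.
  by apply: integral_ge0 => w _; rewrite lee_fin sqrtr_ge0.
pose W := kernel_weight c s 1 lambda.
have bW : bmfun W.
  by apply: (bmfun_kernel_weight (kernel_bc adm) (kernel_bs adm) (kernel_lb adm)).
have bp : bmfun (fun w => W w * c w) by apply: bmfunM => //; exact: kernel_bc adm.
have bq : bmfun (fun w => - (W w * s w)).
  by apply: bmfunN; apply: bmfunM => //; exact: kernel_bs adm.
have hX : (\int[mu]_w (charmod P (fun t => Y t - t0) w)%:E <= X0%:E)%E.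
  by under eq_integral do rewrite charmod_shift.
have -> : \int[P]_t (dint c s 1 lambda (Y t - t0)) ^+ 2 =
    \int[P]_t (\int[mu]_(w in `[1, lambda]) (W w * c w * sin (w * (Y t - t0)) +
       (- (W w * s w)) * cos (w * (Y t - t0)))) ^+ 2.
  apply: eq_Rintegral => t _; congr (_ ^+ 2); apply: eq_Rintegral => w.
  by rewrite inE/= in_itv/= => wl; rewrite (dkernE _ _ _ wl).
apply: le_trans (mean_square_trig_integral mYt 1 lambda bp bq hX) _.
rewrite ler_wpM2l//.
have bl : 0 < lambda by exact: lt_le_trans l1.
have ip : mu.-integrable `[1, lambda] (EFin \o (fun w => w `^ (2 * beta - 2))).
  apply: continuous_compact_integrable; first exact: segment_compact.
  apply: continuous_in_subspaceT => w; rewrite inE/= in_itv/= => /andP[w1 _].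
  by apply: continuous_at_powR; exact: lt_le_trans w1.
rewrite -RintegralZl//; apply: le_Rintegral => //.
- by apply: bmfun_integrable_itv; apply: bmfunD; apply: bmfunX.
- exact: integrable_EFinZl.
move=> w /=; rewrite in_itv/= => /andP[w1 wl].
have w0 : 0 < w by exact: lt_le_trans w1.
have rn0 : r w != 0 by rewrite r_sqr expf_neq0// gt_eqF.
have -> : (W w * c w) ^+ 2 + (- (W w * s w)) ^+ 2 = (w^-1 * (Num.sqrt (r w))^-1) ^+ 2.
  rewrite [RHS]exprMn ![in RHS]exprVn -r_sqr /W /kernel_weight indicE mem_set/=; last first.
    by rewrite in_itv/= w1.
  by rewrite mul1r /r in rn0 *; field; rewrite rn0 gt_eqF.
have -> : k ^+ 2 * w `^ (2 * beta - 2) = (w^-1 * (k * w `^ beta)) ^+ 2.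
  have -> : 2 * beta - 2 = (beta + beta) + (-1 + -1) by lra.
  rewrite !powRD ?(gt_eqF w0) ?implybT// powR_inv1 ?(ltW w0)//; ring.
rewrite ler_pXn2r ?nnegrE//; last 2 first.
- by rewrite mulr_ge0// invr_ge0 ?sqrtr_ge0// ltW.
- by rewrite mulr_ge0 ?mulr_ge0 ?powR_ge0// invr_ge0 ltW.
by rewrite ler_pM2l ?invr_gt0// inv_modulus_le.
Qed.

End second_moment.
End kernel_moments.

(** * Consequences of Sobolev smoothness *)

Lemma integrable_EFinD d (T : measurableType d) (R : realType)
    (m : {measure set T -> \bar R}) (D : set T) (f g : T -> R) :
  measurable D -> m.-integrable D (EFin \o f) -> m.-integrable D (EFin \o g) ->
  m.-integrable D (EFin \o (fun x => f x + g x)).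
Proof.
move=> mD iF iG; have := integrableD mD iF iG.
by apply: eq_integrable => // x _; rewrite /= EFinD.
Qed.

Section sobolev_bounds.
Context (R : realType) d (T : measurableType d) (P : probability T R).
Notation mu := (@lebesgue_measure R).
Variables (X : T -> R) (mX : measurable_fun setT X) (alpha A : R).
Hypothesis sobolev : (\int[mu]_w
  (charmod P X w ^+ 2 * (1 + w ^+ 2) `^ alpha)%:E <= A%:E)%E.

Let S (w : R) := charmod P X w ^+ 2 * (1 + w ^+ 2) `^ alpha.

Let mS : measurable_fun setT S.
Proof.
apply: measurable_funM.
  by apply: measurable_funX; case: (bmfun_charmod P mX).
apply: continuous_measurable_fun; exact: continuous_bracket_powR.
Qed.

Let S0 w : 0 <= S w.
Proof. by rewrite mulr_ge0 ?powR_ge0 ?sqr_ge0. Qed.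

Let iS : mu.-integrable setT (EFin \o S).
Proof.
apply/integrableP; split; first exact/measurable_EFinP.
under eq_integral do rewrite /= ger0_norm//.
by apply: le_lt_trans sobolev _; rewrite ltry.
Qed.

(** Let chi be the characteristic function of X and b = (1 + w^2)^alpha.  For any
    k > 0, the inequality |chi|/w <= (k |chi|^2 b + 1/(k w^2 b))/2 splits the integrand
    into a part controlled by the Sobolev norm and a power.  The choice
    k = lambda^{-(alpha + 1/2)} balances the two integrals. *)
Lemma inversion_tail_le (t0 lambda Lambda : R) : - (1 / 2) < alpha ->
  1 <= lambda -> lambda <= Lambda ->
  `|\int[mu]_(w in `[lambda, Lambda]) inversion_integrand P X t0 w| <=
  (A + 2 `^ `|alpha| / (2 * alpha + 1)) / 2 * lambda `^ (- (alpha + 1 / 2)).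
Proof.
move=> alpha2 l1 lL.
have l0 : 0 < lambda by exact: lt_le_trans l1.
have al0 : 0 < 2 * alpha + 1 by lra.
set k := lambda `^ (- (alpha + 1 / 2)).
have k0 : 0 < k by rewrite powR_gt0.
pose B := 2 `^ `|alpha| : R.
have B0 : 0 <= B by exact: powR_ge0.
have iSl : mu.-integrable `[lambda, Lambda] (EFin \o S).
  exact: (@integrableS _ _ _ mu setT).
have ip : mu.-integrable `[lambda, Lambda] (EFin \o (fun w => w `^ (- (2 * alpha + 1) - 1))).
  apply: continuous_compact_integrable; first exact: segment_compact.
  apply: continuous_in_subspaceT => w; rewrite inE/= in_itv/= => /andP[w1 _].
  by apply: continuous_at_powR; exact: lt_le_trans w1.
pose g w := k / 2 * S w + B / (2 * k) * w `^ (- (2 * alpha + 1) - 1).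
have ig1 : mu.-integrable `[lambda, Lambda] (EFin \o (fun w => k / 2 * S w)).
  exact: integrable_EFinZl.
have ig2 : mu.-integrable `[lambda, Lambda]
    (EFin \o (fun w => B / (2 * k) * w `^ (- (2 * alpha + 1) - 1))).
  exact: integrable_EFinZl.
have ig : mu.-integrable `[lambda, Lambda] (EFin \o g).
  exact: integrable_EFinD.
have mi : measurable_fun setT (inversion_integrand P X t0).
  apply: measurable_funM; first exact: measurable_invr.
  apply: measurable_funB; apply: measurable_funM.
  - by case: (bmfun_sinmean P mX).
  - by have [] := @bmfun_cos _ _ _ _ (mulrr_measurable (D := setT) t0).
  - by case: (bmfun_cosmean P mX).
  - by have [] := @bmfun_sin _ _ _ _ (mulrr_measurable (D := setT) t0).
apply: (@le_trans _ _ (\int[mu]_(w in `[lambda, Lambda]) g w)).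
  apply: (@normr_Rintegral_le _ _ _ mu _ _ _ _ mi ig) => //.
  move=> w /=; rewrite in_itv/= => /andP[lw _].
  have w1 : 1 <= w by exact: le_trans lw.
  have w0 : 0 < w by exact: lt_le_trans w1.
  have h1 : `|inversion_integrand P X t0 w| <= w^-1 * charmod P X w.
    rewrite /inversion_integrand normrM normfV (gtr0_norm w0).
    rewrite ler_pM2l ?invr_gt0// -sqrtr_sqr /charmod.
    rewrite ler_sqrt ?addr_ge0 ?sqr_ge0// -subr_ge0.
    rewrite -[cosmean P X w ^+ 2 + _]mulr1 -(cos2Dsin2 (w * t0)).
    rewrite (_ : _ - _ = (cosmean P X w * cos (w * t0) + sinmean P X w * sin (w * t0)) ^+ 2).
      exact: sqr_ge0.
    ring.
  apply: (le_trans h1).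
  pose b := (1 + w ^+ 2) `^ alpha.
  have b0 : 0 < b by rewrite powR_gt0// addr1sqr_gt0.
  have h2 : w^-1 ^+ 2 / b <= B * w `^ (- (2 * alpha + 1) - 1).
    rewrite -[b^-1]powRN.
    rewrite (_ : - (2 * alpha + 1) - 1 = 2 * - alpha + (-1 + -1)); last by lra.
    rewrite powRD ?(gt_eqF w0) ?implybT// [w `^ (-1 + -1)]powRD ?(gt_eqF w0) ?implybT//.
    rewrite powR_inv1 ?(ltW w0)// -expr2 mulrC mulrA ler_pM2r ?exprn_gt0 ?invr_gt0//.
    by have := bracket_powR_le (- alpha) w1; rewrite normrN.
  rewrite /g.
  apply: (@le_trans _ _ (k / 2 * S w + (w^-1 ^+ 2 / b) / (2 * k))); last first.
    rewrite lerD2l -[leRHS]mulrA [_^-1 * _]mulrC [leRHS]mulrA.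
    by rewrite ler_pM2r// invr_gt0 mulr_gt0.
  have -> : k / 2 * S w + w^-1 ^+ 2 / b / (2 * k) =
     ((k * charmod P X w * b) ^+ 2 + (w^-1) ^+ 2) / (2 * k * b).
    by rewrite /S -/b; field; rewrite !gt_eqF.
  rewrite ler_pdivlMr ?mulr_gt0//.
  have := sqr_ge0 (k * charmod P X w * b - w^-1); rewrite sqrrB; lra.
rewrite RintegralD// !RintegralZl//.
have h1 : \int[mu]_(w in `[lambda, Lambda]) S w <= A.
  rewrite -lee_fin /Rintegral fineK; last exact: integrable_fin_num.
  apply: le_trans sobolev; apply: ge0_subset_integral => //.
    exact/measurable_EFinP.
  by move=> w _; rewrite lee_fin.
have h2 : \int[mu]_(w in `[lambda, Lambda]) w `^ (- (2 * alpha + 1) - 1) <=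
    k ^+ 2 / (2 * alpha + 1).
  rewrite /Rintegral integral_powR ?oppr_eq0 ?gt_eqF//=.
  have -> : k ^+ 2 = lambda `^ (- (2 * alpha + 1)).
    rewrite /k expr2 -powRD; last by rewrite (gt_eqF l0) implybT.
    by congr (_ `^ _); lra.
  rewrite invrN !mulNr opprK addrC mulrC lerBlDr lerDl.
  by rewrite mulr_ge0 ?powR_ge0// invr_ge0 ltW.
apply: (@le_trans _ _ (k / 2 * A + B / (2 * k) * (k ^+ 2 / (2 * alpha + 1)))).
  apply: lerD; first by rewrite ler_pM2l ?divr_gt0.
  by rewrite ler_wpM2l// divr_ge0// mulr_ge0// ltW.
rewrite le_eqVlt; apply/orP; left; apply/eqP; rewrite -/B.
by field; rewrite !gt_eqF.
Qed.

(** The modulus is |chi| |phi|, where chi is the characteristic function of X and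
    |phi| <= Cz (1 + w^2)^{-beta/2}; the product is at most half the sum of the squares
    of |chi| (1 + w^2)^{alpha/2} and Cz (1 + w^2)^{-(alpha + beta)/2}. *)
Lemma charmod_integral_le (Y : T -> R) (c s : R -> R) (Cz beta K : R) :
  measurable_fun setT Y ->
  (forall w, cosmean P Y w = cosmean P X w * c w - sinmean P X w * s w) ->
  (forall w, sinmean P Y w = sinmean P X w * c w + cosmean P X w * s w) ->
  (forall w, Num.sqrt (c w ^+ 2 + s w ^+ 2) <= Cz * (1 + w ^+ 2) `^ (- beta / 2)) ->
  (\int[mu]_w ((1 + w ^+ 2) `^ (- (alpha + beta)))%:E <= K%:E)%E ->
  (\int[mu]_w (charmod P Y w)%:E <= ((A + Cz ^+ 2 * K) / 2)%:E)%E.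
Proof.
move=> mY cY sY ubz IK.
pose J (w : R) := (1 + w ^+ 2) `^ (- (alpha + beta)).
have mJ : measurable_fun setT J.
  apply: continuous_measurable_fun; exact: continuous_bracket_powR.
have chY w : charmod P Y w = charmod P X w * Num.sqrt (c w ^+ 2 + s w ^+ 2).
  rewrite /charmod -sqrtrM ?addr_ge0 ?sqr_ge0// cY sY; congr Num.sqrt; ring.
have ch0 w : 0 <= charmod P X w by exact: sqrtr_ge0.
apply: (@le_trans _ _ (\int[mu]_w (2^-1 * S w + Cz ^+ 2 / 2 * J w)%:E)%E).
  apply: ge0_le_integral => //.
  - by move=> w _; rewrite lee_fin sqrtr_ge0.
  - by apply/measurable_EFinP; case: (bmfun_charmod P mY).
  - apply/measurable_EFinP; apply: measurable_funD;
      exact: (measurable_funM (measurable_cst _)).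
  - move=> w _; rewrite lee_fin chY.
    apply: le_trans (ler_wpM2l (ch0 w) (ubz w)) _.
    pose a := (1 + w ^+ 2) `^ (alpha / 2); pose e := (1 + w ^+ 2) `^ (- beta / 2).
    have g0 := addr1sqr_gt0 w.
    have a0 : 0 < a by rewrite powR_gt0.
    have -> : S w = (charmod P X w * a) ^+ 2.
      rewrite /S exprMn; congr (_ * _).
      by rewrite [RHS]expr2 /a -powRD ?(gt_eqF g0) ?implybT//; congr (_ `^ _); field.
    have -> : J w = (e / a) ^+ 2.
      by rewrite /J [RHS]expr2 /a /e -powRN -!powRD ?(gt_eqF g0) ?implybT//; congr (_ `^ _); field.
    rewrite -/e.
    have -> : charmod P X w * (Cz * e) = (charmod P X w * a) * (Cz * (e / a)).
      by field; rewrite gt_eqF.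
    have := sqr_ge0 (charmod P X w * a - Cz * (e / a)); rewrite sqrrB exprMn; lra.
under eq_integral do rewrite EFinD !EFinM.
have mSE : measurable_fun setT (fun w : measurableTypeR R => (S w)%:E).
  exact/measurable_EFinP.
have mJE : measurable_fun setT (fun w : measurableTypeR R => (J w)%:E).
  exact/measurable_EFinP.
have J0 w : 0 <= J w by exact: powR_ge0.
have C0 : 0 <= Cz ^+ 2 / 2 by rewrite divr_ge0 ?sqr_ge0.
rewrite ge0_integralD//; last 4 first.
- by move=> w _; rewrite -EFinM lee_fin mulr_ge0 ?S0 ?invr_ge0.
- exact: measurable_funeM.
- by move=> w _; rewrite -EFinM lee_fin (mulr_ge0 C0 (J0 _)).
- exact: measurable_funeM.
rewrite (ge0_integralZl _ _ mSE)//; last by move=> w _; rewrite lee_fin.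
rewrite (ge0_integralZl _ _ mJE)//; last by move=> w _; rewrite lee_fin.
have -> : (A + Cz ^+ 2 * K) / 2 = 2^-1 * A + Cz ^+ 2 / 2 * K by field.
rewrite EFinD !EFinM; apply: leeD.
  by rewrite lee_wpmul2l.
by rewrite lee_wpmul2l// lee_fin.
Qed.

End sobolev_bounds.

(** * The kernel of an error density *)

Section error_density.
Context (R : realType) (fz : R -> R) (hf : is_density fz).
Notation mu := (@lebesgue_measure R).
Notation PZ := (density_probability hf).

Definition fourier_re w := complex.Re (fourier fz w).
Definition fourier_im w := complex.Im (fourier fz w).

Lemma fourier_reE w : fourier_re w = cosmean PZ id w.
Proof.
rewrite /cosmean Rintegral_density_probability; last first.
  by apply: bmfun_cos; apply: measurable_funM.
by apply: eq_Rintegral => x _; rewrite mulrC.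
Qed.

Lemma fourier_imE w : fourier_im w = sinmean PZ id w.
Proof.
rewrite /sinmean Rintegral_density_probability; last first.
  by apply: bmfun_sin; apply: measurable_funM.
by apply: eq_Rintegral => x _; rewrite mulrC.
Qed.

Lemma cmodE w : cmod (fourier fz w) = Num.sqrt (fourier_re w ^+ 2 + fourier_im w ^+ 2).
Proof. by []. Qed.

Lemma Im_cexpi_div (t w : R) : complex.Im (cexpi t / fourier fz w) =
  (fourier_re w * sin t - fourier_im w * cos t) /
  (fourier_re w ^+ 2 + fourier_im w ^+ 2).
Proof.
rewrite /fourier_re /fourier_im; case: (fourier fz w) => a b /=.
by ring.
Qed.

Let r w := fourier_re w ^+ 2 + fourier_im w ^+ 2.

Let r_le1 w : r w <= 1.
Proof. by rewrite /r fourier_reE fourier_imE; exact: cosmean_sinmean_le1. Qed.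

(** (E1) keeps |phi| away from 0 on bounded intervals.  (E2) bounds |phi| from
    below, hence 1 - |phi|^2 = (1 - |phi|)(1 + |phi|) from above, on ]0, w0]; on
    the rest of ]0, 1] the trivial bound 1 is at most (w/w0)^tau. *)
Lemma admissible_density (beta : R) : cond_E1 fz beta -> cond_E2 fz ->
  exists m H, admissible_kernel fourier_re fourier_im m H.
Proof.
move=> [beta0 [cz [Cz [cz0 Cz0 E1]]]] [w0 [b [tau [w00 b0 tau0 E2]]]].
have reE : fourier_re = cosmean PZ id by apply/funext => w; exact: fourier_reE.
have imE : fourier_im = sinmean PZ id by apply/funext => w; exact: fourier_imE.
have bre : bmfun fourier_re by rewrite reE; exact: bmfun_cosmean.
have bim : bmfun fourier_im by rewrite imE; exact: bmfun_sinmean.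
have r0 w : 0 <= r w by rewrite addr_ge0 ?sqr_ge0.
have lb (B : R) : exists2 c0, 0 < c0 & forall w, 0 <= w <= B -> c0 <= r w.
  exists ((cz * (1 + B ^+ 2) `^ (- beta / 2)) ^+ 2).
    by rewrite exprn_gt0// mulr_gt0// powR_gt0// addr1sqr_gt0.
  move=> w /andP[w_0 wB].
  have B_0 : 0 <= B by exact: le_trans wB.
  rewrite -[leRHS]sqr_sqrtr// ler_pXn2r ?nnegrE ?sqrtr_ge0//; last first.
    by rewrite mulr_ge0 ?powR_ge0// ltW.
  have /andP[+ _] := E1 w; rewrite cmodE; apply: le_trans.
  rewrite ler_pM2l// mulNr !powRN lef_pV2 ?posrE ?powR_gt0 ?addr1sqr_gt0//.
  apply: ge0_ler_powR.
  - by rewrite divr_ge0// ltW.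
  - by rewrite nnegrE ltW// addr1sqr_gt0.
  - by rewrite nnegrE ltW// addr1sqr_gt0.
  - by rewrite lerD2l ler_pXn2r ?nnegrE.
have E2' w : 0 < w <= 1 -> 1 - r w <= (2 * b + (w0 `^ tau)^-1) * w `^ tau.
  move=> /andP[w_0 w1]; have [ww0|w0w] := leP w w0.
    have := E2 w; rewrite gtr0_norm// => /(_ ww0); rewrite cmodE -/(r w) => h.
    apply: (@le_trans _ _ (2 * b * w `^ tau)); last first.
      by rewrite ler_wpM2r ?powR_ge0// lerDl invr_ge0 powR_ge0.
    have s1 : Num.sqrt (r w) <= 1 by rewrite -sqrtr1 ler_sqrt.
    have s0 := sqrtr_ge0 (r w).
    have -> : 1 - r w = (1 - Num.sqrt (r w)) * (1 + Num.sqrt (r w)).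
      by rewrite -{1}(sqr_sqrtr (r0 w)); ring.
    have bw : 0 <= b * w `^ tau by rewrite mulr_ge0 ?powR_ge0// ltW.
    nra.
  apply: (@le_trans _ _ 1); first by rewrite lerBlDr lerDl.
  apply: (@le_trans _ _ ((w0 `^ tau)^-1 * w `^ tau)).
    rewrite ler_pdivlMl ?powR_gt0// mulr1; apply: ge0_ler_powR; rewrite ?nnegrE;
      exact: ltW.
  by rewrite ler_wpM2r ?powR_ge0// lerDr mulr_ge0// ltW.
have b'0 : 0 <= 2 * b + (w0 `^ tau)^-1.
  by rewrite addr_ge0 ?mulr_ge0 ?invr_ge0 ?powR_ge0 1?ltW.
have := @exists_centering _ _ R PZ id (@measurable_id _ _ _) _ tau tau0 b'0.
rewrite -reE -imE => /(_ E2')[m im].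
have [c0 c00 c0r] := lb 1.
(* The dominating function is the right-hand side of [dkern_near0]. *)
exists m, (fun w => c0^-1 * (cos_defect fourier_re fourier_im m w * w `^ (- 1 - tau / 2)) +
  2^-1 * w `^ (tau / 2 - 1)).
have itv01 (f : R -> R) : measurable_fun setT f -> (forall w, 0 <= f w) ->
    (\int[mu]_(w in `]0%R, 1%R]) (f w)%:E < +oo)%E ->
    mu.-integrable `[0, 1] (EFin \o f).
  move=> mf f0 fy; apply/integrableP; split.
    by apply: measurable_funTS; apply/measurable_EFinP.
  under eq_integral do rewrite /= ger0_norm//.
  rewrite -integral_itv_obnd_cbnd//.
  by apply: measurable_funTS; apply/measurable_EFinP.
split=> //.
- apply: integrable_EFinD => //; apply: integrable_EFinZl => //; apply: itv01.
  + apply: measurable_funM; last exact: measurable_powR.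
    apply: measurable_funB => //; apply: measurable_funD; apply: measurable_funM.
    * by case: bre.
    * by have [] := @bmfun_cos R _ _ _ (mulrr_measurable (D := setT) m).
    * by case: bim.
    * by have [] := @bmfun_sin R _ _ _ (mulrr_measurable (D := setT) m).
  + move=> w; rewrite mulr_ge0 ?powR_ge0// reE imE.
    exact: cos_defect_ge0.
  + exact: im.
  + exact: measurable_powR.
  + by move=> w; exact: powR_ge0.
  + apply: le_lt_trans (integral_powR_near0 _) _; first by rewrite divr_gt0.
    by rewrite ltry.
- move=> w u /andP[w_0 w1].
  have defect0 : 0 <= cos_defect fourier_re fourier_im m w.
    by rewrite reE imE; exact: cos_defect_ge0.
  move: w_0; rewrite le_eqVlt => /predU1P[<-|w_0].
    rewrite /dkern invr0 mul0r mulr0 subrr normr0.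
    rewrite addr_ge0// mulr_ge0 ?powR_ge0 ?invr_ge0 ?(ltW c00)//.
    rewrite mulr_ge0 ?powR_ge0// reE imE; exact: cos_defect_ge0.
  have := @dkern_near0 R fourier_re fourier_im m tau c0 w u c00.
  rewrite c0r ?w1 ?(ltW w_0)// => /(_ isT (r_le1 w) w_0) h; apply: (le_trans h).
  by rewrite [_ / c0]mulrC [w `^ _ / 2]mulrC.
Qed.

End error_density.

(** * Cut-off and rate *)

Section rates.
Context (R : realType).
Notation mu := (@lebesgue_measure R).
Variables (alpha beta : R).
Hypotheses (alpha2 : - (1 / 2) < alpha) (beta0 : 0 < beta) (ab2 : 1 / 2 < alpha + beta).

Let Rintegral_powR (p a : R) : p != 0 -> 1 <= a ->
  \int[mu]_(w in `[1, a]) w `^ (p - 1) = p^-1 * a `^ p - p^-1.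
Proof. by move=> p0 a1; rewrite /Rintegral integral_powR//= powR1 mulr1. Qed.

(** Every term is a power of z (times a logarithm when beta = 1/2), and each case
    compares exponents.  The integral of w^{2 beta - 2} grows like
    lambda^{2 beta - 1}, like ln lambda, or stays bounded.  The restriction z >= e is used when beta = 1/2, where it makes
    ln z >= 1, so that the logarithm dominates the constants. *)
Lemma rates : exists2 k : R, 0 < k & forall z, expR 1 <= z ->
  let l := rate_lambda alpha beta z in let psi := rate_psi alpha beta z in
  [/\ 1 <= l, 0 < psi, l `^ beta <= z * psi,
      1 + \int[mu]_(w in `[1, l]) w `^ (2 * beta - 2) <= k * (z * psi ^+ 2) &
      l `^ (- (alpha + 1 / 2)) <= psi].
Proof.
have a2 := alpha2; have b0 := beta0; have ab := ab2.
have e1 : 1 < expR 1 :> R by rewrite expR_gt1.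
have pm (x y p : R) : 1 <= y -> x <= p -> y `^ x <= y `^ p by move=> *; exact: ler_powR.
have zsqrt (z : R) : 0 < z -> z * (1 / Num.sqrt z) = Num.sqrt z.
  move=> z0; have s0 : Num.sqrt z != 0 by rewrite gt_eqF// sqrtr_gt0.
  by rewrite -{1}(sqr_sqrtr (ltW z0)); field.
have hsqrt (z : R) : 0 < z -> z `^ (- (1 / 2)) = 1 / Num.sqrt z.
  by move=> z0; rewrite powRN div1r mul1r powR12_sqrt// ltW.
have e2 : 2 * beta - 2 = (2 * beta - 1) - 1 by lra.
case: (ltgtP (1 / 2) beta) => hb.
- have g0 : 0 < 2 * alpha + 2 * beta by lra.
  have b1 : 0 < 2 * beta - 1 by lra.
  exists (1 + (2 * beta - 1)^-1); first by rewrite addr_gt0// invr_gt0.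
  move=> z ez l psi.
  have z1 : 1 <= z by apply: le_trans ez; exact: ltW.
  have z0 : 0 < z by exact: lt_le_trans z1.
  have zn0 := gt_eqF z0.
  have lE x : l `^ x = z `^ (x / (2 * alpha + 2 * beta)).
    rewrite /l /rate_lambda max_l; last by lra.
    by rewrite -powRrM; congr (_ `^ _); field; rewrite gt_eqF.
  have l1 : 1 <= l.
    rewrite -[l]powRr1; last exact: powR_ge0.
    by rewrite lE -[X in X <= _](powRr0 z) pm// divr_ge0// ltW.
  have psiE : psi = z `^ (- (2 * alpha + 1) / (4 * alpha + 4 * beta)).
    by rewrite /psi /rate_psi hb.
  have zpsi : z * psi = z `^ (1 - (2 * alpha + 1) / (4 * alpha + 4 * beta)).
    by rewrite psiE powRD ?zn0 ?implybT// powRr1 ?(ltW z0)// mulNr.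
  split => //.
  + by rewrite psiE powR_gt0.
  + rewrite lE zpsi pm// -subr_ge0.
    rewrite (_ : _ - _ = (2 * alpha + 2 * beta - 1) / (4 * alpha + 4 * beta)).
      by rewrite divr_ge0//; lra.
    by field; rewrite !gt_eqF//; lra.
  + rewrite e2 Rintegral_powR ?gt_eqF//.
    have -> : z * psi ^+ 2 = l `^ (2 * beta - 1).
      rewrite expr2 mulrA zpsi psiE -powRD ?zn0 ?implybT// lE; congr (_ `^ _).
      by field; rewrite !gt_eqF//; lra.
    have : 1 <= l `^ (2 * beta - 1) by rewrite -[X in X <= _](powRr0 l) pm// ltW.
    have : 0 < (2 * beta - 1)^-1 by rewrite invr_gt0.
    by move: (_^-1) (l `^ (2 * beta - 1)) => i L i0 L1; rewrite mulrDl mul1r; lra.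
  + rewrite lE psiE le_eqVlt; apply/orP; left; apply/eqP; congr (_ `^ _).
    by field; rewrite !gt_eqF//; lra.
- have g1 : 1 < 2 * alpha + 1 by lra.
  have g0 : 0 < 2 * alpha + 1 by lra.
  have b1 : 0 < 1 - 2 * beta by lra.
  exists (1 + (1 - 2 * beta)^-1); first by rewrite addr_gt0// invr_gt0.
  move=> z ez l psi.
  have z1 : 1 <= z by apply: le_trans ez; exact: ltW.
  have z0 : 0 < z by exact: lt_le_trans z1.
  have lE x : l `^ x = z `^ (x / (2 * alpha + 1)).
    rewrite /l /rate_lambda max_r; last by lra.
    by rewrite -powRrM; congr (_ `^ _); field; rewrite gt_eqF.
  have l1 : 1 <= l.
    rewrite -[l]powRr1; last exact: powR_ge0.
    by rewrite lE -[X in X <= _](powRr0 z) pm// divr_ge0// ltW.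
  have psiE : psi = 1 / Num.sqrt z.
    by rewrite /psi /rate_psi ifF ?ifF//; [rewrite lt_eqF|rewrite ltNge ltW].
  have s0 : 0 < Num.sqrt z by rewrite sqrtr_gt0.
  split => //.
  + by rewrite psiE divr_gt0.
  + rewrite lE psiE zsqrt// -powR12_sqrt ?(ltW z0)// pm//.
    by rewrite ler_pdivrMr// -subr_ge0; lra.
  + have -> : z * psi ^+ 2 = 1 by rewrite psiE expr2 mulrA zsqrt// div1r divff ?gt_eqF.
    rewrite mulr1 lerD2l.
    rewrite e2 Rintegral_powR ?lt_eqF//; last by lra.
    have h : 0 <= l `^ (2 * beta - 1) by exact: powR_ge0.
    have i : (2 * beta - 1)^-1 = - (1 - 2 * beta)^-1 by rewrite -invrN; congr (_^-1); lra.
    have : 0 <= (1 - 2 * beta)^-1 by rewrite invr_ge0 ltW.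
    by rewrite i; move: (_^-1) (l `^ (2 * beta - 1)) h => j L L0 j0; nra.
  + rewrite lE psiE -hsqrt// le_eqVlt; apply/orP; left; apply/eqP; congr (_ `^ _).
    by field; rewrite gt_eqF.
- have g1 : 1 < 2 * alpha + 1 by lra.
  have g0 : 0 < 2 * alpha + 1 by lra.
  exists (1 + (2 * alpha + 1)^-1); first by rewrite addr_gt0// invr_gt0.
  move=> z ez l psi.
  have z1 : 1 <= z by apply: le_trans ez; exact: ltW.
  have z0 : 0 < z by exact: lt_le_trans z1.
  have lE x : l `^ x = z `^ (x / (2 * alpha + 1)).
    rewrite /l /rate_lambda max_r; last by lra.
    by rewrite -powRrM; congr (_ `^ _); field; rewrite gt_eqF.
  have l1 : 1 <= l.
    rewrite -[l]powRr1; last exact: powR_ge0.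
    by rewrite lE -[X in X <= _](powRr0 z) pm// divr_ge0// ltW.
  have l0 : 0 < l by exact: lt_le_trans l1.
  have lnz : 1 <= ln z by rewrite -[X in X <= _](expRK 1) ler_ln ?posrE ?expR_gt0.
  have psiE : psi = Num.sqrt (ln z / z).
    by rewrite /psi /rate_psi hb ltxx eqxx.
  have psi_ge : 1 / Num.sqrt z <= psi.
    have ln0 : 0 < ln z by exact: lt_le_trans lnz.
    rewrite psiE div1r -sqrtrV ?(ltW z0)// ler_sqrt ?divr_ge0 ?(ltW ln0) ?(ltW z0)//.
    by rewrite ler_peMl// invr_ge0 ltW.
  have s0 : 0 < Num.sqrt z by rewrite sqrtr_gt0.
  split => //.
  + by apply: lt_le_trans psi_ge; rewrite divr_gt0.
  + apply: (@le_trans _ _ (z * (1 / Num.sqrt z))); last by rewrite ler_pM2l.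
    rewrite lE zsqrt// -powR12_sqrt ?(ltW z0)// pm//.
    by rewrite ler_pdivrMr// -subr_ge0; lra.
  + rewrite psiE sqr_sqrtr; last by rewrite divr_ge0 ?(ltW z0)// (le_trans ler01).
    have -> : z * (ln z / z) = ln z by field; rewrite gt_eqF.
    rewrite (_ : 2 * beta - 2 = -1); last by rewrite -hb; lra.
    rewrite /Rintegral integral_powRN1//= ln1 subr0.
    have -> : ln l = ln z / (2 * alpha + 1).
      rewrite -[l]powRr1 ?(ltW l0)// lE ln_powR; field.
      by rewrite gt_eqF.
    by rewrite [leRHS]mulrDl mul1r [_^-1 * _]mulrC lerD2r.
  + apply: le_trans psi_ge; rewrite lE -hsqrt// le_eqVlt; apply/orP; left; apply/eqP.
    by congr (_ `^ _); field; rewrite gt_eqF.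
Qed.

End rates.

(** * Estimates for the kernel of the estimator *)

Section kernel_estimates.
Context (R : realType) (fz : R -> R) (hf : is_density fz).
Notation mu := (@lebesgue_measure R).

Definition deconv_kernel (t0 lambda y : R) : R :=
  2^-1 - pi^-1 * dint (fourier_re fz) (fourier_im fz) 0 lambda (y - t0).

Lemma pi_ge1 : 1 <= pi :> R.
Proof. by have := @pi_ge2 R; lra. Qed.

(** The integral is split at frequency 1: the part over [0, 1] is bounded by the
    constant M uniformly in y, the part over [1, lambda] carries the growth in
    lambda.  The constant k depends on the error density, alpha, beta and the
    Sobolev radius A only. *)
Lemma kernel_estimates (beta alpha A : R) : cond_E1 fz beta -> cond_E2 fz ->
  - (1 / 2) < alpha -> 1 / 2 < alpha + beta ->
  exists2 k : R, 0 < k & forall t0 lambda : R, 1 <= lambda ->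
  [/\ bmfun (deconv_kernel t0 lambda),
      forall y, `|deconv_kernel t0 lambda y| <= k * lambda `^ beta &
      forall d (T : measurableType d) (P : probability T R) (X Y : T -> R),
      measurable_fun setT X -> measurable_fun setT Y ->
      (forall w, cosmean P Y w =
        cosmean P X w * fourier_re fz w - sinmean P X w * fourier_im fz w) ->
      (forall w, sinmean P Y w =
        sinmean P X w * fourier_re fz w + cosmean P X w * fourier_im fz w) ->
      P [set t | X t = t0] = 0%E ->
      (\int[mu]_w (charmod P X w ^+ 2 * (1 + w ^+ 2) `^ alpha)%:E <= A%:E)%E ->
      \int[P]_t (deconv_kernel t0 lambda (Y t)) ^+ 2 <=
        k * (1 + \int[mu]_(w in `[1, lambda]) w `^ (2 * beta - 2)) /\
      `|\int[P]_t deconv_kernel t0 lambda (Y t) - fine (P [set t | X t <= t0])| <=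
        k * lambda `^ (- (alpha + 1 / 2))].
Proof.
move=> E1 E2 alpha2 ab2.
have [m [H adm]] := admissible_density hf E1 E2.
have [beta0 [cz [Cz [cz0 Cz0 E1']]]] := E1.
have lbz w : cz * (1 + w ^+ 2) `^ (- beta / 2) <=
    Num.sqrt (fourier_re fz w ^+ 2 + fourier_im fz w ^+ 2).
  by have /andP[] := E1' w; rewrite cmodE.
have ubz w : Num.sqrt (fourier_re fz w ^+ 2 + fourier_im fz w ^+ 2) <=
    Cz * (1 + w ^+ 2) `^ (- beta / 2).
  by have /andP[] := E1' w; rewrite cmodE.
have [K K0 IK] := integral_bracket_powR ab2.
pose M := 4 + \int[mu]_(w in `[0, 1]) H w.
pose kd := 2 `^ (beta / 2) / cz.
pose X0 := (A + Cz ^+ 2 * K) / 2.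
pose kb := (A + 2 `^ `|alpha| / (2 * alpha + 1)) / 2.
have kd0 : 0 <= kd by rewrite divr_ge0 ?powR_ge0// ltW.
have d0M u : `|dint (fourier_re fz) (fourier_im fz) 0 1 u| <= M.
  apply: (dint0_bounded (kernel_bc adm) (kernel_bs adm) (kernel_lb adm)
    (kernel_iH adm) (kernel_near0 adm)).
  by rewrite ler01 lexx.
have M0 : 0 <= M by exact: le_trans (d0M 0).
have pi1 : pi^-1 <= 1 :> R by rewrite invf_le1 ?pi_gt0// pi_ge1.
have ip0 : 0 < pi^-1 :> R by rewrite invr_gt0 pi_gt0.
have Kle t0 lambda y : 1 <= lambda -> `|deconv_kernel t0 lambda y| <=
    (1 + M) + `|dint (fourier_re fz) (fourier_im fz) 1 lambda (y - t0)|.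
  move=> l1; rewrite /deconv_kernel (dint_cat adm _ ler01 l1).
  have := d0M (y - t0).
  move: (dint _ _ 0 1 _) (dint _ _ 1 lambda _) => D0 D1 hD0.
  rewrite (le_trans (ler_normB _ _))// normrM (gtr0_norm ip0).
  rewrite (@gtr0_norm _ 2^-1) ?invr_gt0//.
  have h : `|D0 + D1| <= M + `|D1|.
    by rewrite (le_trans (ler_normD _ _))// lerD2r.
  rewrite -addrA lerD//; first lra.
  by apply: le_trans h; rewrite ler_piMl.
pose k := 1 + (1 + M + kd / beta) + (2 * (1 + M) ^+ 2 + 2 * (`|X0| * kd ^+ 2)) + `|kb|.
have q0 : 0 <= kd / beta by rewrite divr_ge0// ltW.
have q1 : 0 <= 2 * (1 + M) ^+ 2 by exact: mulr_ge0 (ler0n _ _) (sqr_ge0 _).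
have q2 : 0 <= 2 * (`|X0| * kd ^+ 2).
  exact: mulr_ge0 (ler0n _ _) (mulr_ge0 (normr_ge0 _) (sqr_ge0 _)).
have q3 : 0 <= `|kb| by [].
exists k; first by rewrite /k; lra.
move=> t0 lambda l1.
have lb1 : 1 <= lambda `^ beta.
  by rewrite -[X in X <= _](powRr0 lambda) ler_powR// ltW.
have bK : bmfun (deconv_kernel t0 lambda).
  apply: bmfunB; first exact: bmfun_cst.
  apply: bmfunM; first exact: bmfun_cst.
  apply: (bmfun_comp (bmfun_dint0 adm l1)).
  exact: measurable_funB.
split => //.
  move=> y; apply: le_trans (Kle t0 lambda y l1) _.
  have := normr_dint1_le adm beta0 cz0 lbz (y - t0) l1; rewrite -/kd.
  move: (`|dint _ _ _ _ _|) (lambda `^ beta) lb1 => D L L1 DL.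
  apply: (@le_trans _ _ ((1 + M) * L + kd / beta * L)).
    by apply: lerD => //; rewrite ler_peMr// addr_ge0.
  rewrite -mulrDl ler_wpM2r ?(le_trans ler01)// /k; lra.
move=> d T P X Y mX mY cY sY X0t sob.
have hX0 := charmod_integral_le mX sob mY cY sY ubz IK; rewrite -/X0 in hX0.
split.
- have bD : bmfun (fun t => dint (fourier_re fz) (fourier_im fz) 1 lambda (Y t - t0)).
    apply: (bmfun_comp (bmfun_dint adm lambda ltr01)).
    exact: measurable_funB.
  have bKY : bmfun (fun t => deconv_kernel t0 lambda (Y t)) by exact: bmfun_comp bK mY.
  have h2 := mean_square_dint1 adm beta0 cz0 lbz t0 mY hX0 l1; rewrite -/kd in h2.
  set V := \int[mu]_(w in `[1, lambda]) _ in h2 *.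
  have V0 : 0 <= V by apply: Rintegral_ge0 => w _; exact: powR_ge0.
  apply: (@le_trans _ _ (\int[P]_t (2 * (1 + M) ^+ 2 + 2 *
     (dint (fourier_re fz) (fourier_im fz) 1 lambda (Y t - t0)) ^+ 2))).
    apply: ler_bmean.
    + exact: bmfunX.
    + apply: bmfunD; first exact: bmfun_cst.
      by apply: bmfunM; [exact: bmfun_cst|exact: bmfunX].
    move=> t; have := Kle t0 lambda (Y t) l1.
    rewrite -(real_normK (num_real (deconv_kernel t0 lambda (Y t)))).
    rewrite -(real_normK (num_real (dint _ _ _ _ _))).
    move: (`|deconv_kernel _ _ _|) (normr_ge0 (deconv_kernel t0 lambda (Y t))).
    move: (`|dint _ _ _ _ _|) (normr_ge0 (dint (fourier_re fz) (fourier_im fz) 1 lambda (Y t - t0))).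
    move=> D D0 N N0 ND.
    apply: (@le_trans _ _ ((1 + M + D) ^+ 2)).
      by rewrite ler_pXn2r ?nnegrE// (le_trans N0 ND).
    have := sqr_ge0 (1 + M - D); rewrite sqrrB sqrrD; lra.
  rewrite bmeanD; [|exact: bmfun_cst|by apply: bmfunM; [exact: bmfun_cst|exact: bmfunX]].
  rewrite mean_cst bmeanZl; last exact: bmfunX.
  have h3 : X0 * (kd ^+ 2 * V) <= `|X0| * kd ^+ 2 * V.
    by rewrite mulrA ler_wpM2r// ler_wpM2r ?sqr_ge0// ler_norm.
  move: h2 => /le_trans/(_ h3); move: (\int[P]_t _) => I IV.
  rewrite mulrDr mulr1; apply: (@le_trans _ _ (2 * (1 + M) ^+ 2 + 2 * (`|X0| * kd ^+ 2) * V)).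
    by rewrite lerD2l -mulrA ler_pM2l// mulrA.
  apply: lerD; first by rewrite /k; lra.
  by rewrite ler_wpM2r// /k; lra.
- have := bias_bound adm mX mY cY sY l1 X0t
    (fun L lL => inversion_tail_le mX sob t0 alpha2 l1 lL).
  rewrite -/kb => h; apply: (le_trans h).
  set l := lambda `^ _; have l0 : 0 <= l by exact: powR_ge0.
  rewrite mulrC mulrA ler_wpM2r// mulrC.
  apply: (@le_trans _ _ (`|kb| * 1)); last by rewrite mulr1 /k; lra.
  by rewrite (le_trans (ler_norm _))// normrM (gtr0_norm ip0) ler_wpM2l.
Qed.

End kernel_estimates.

(** * Factorisation of means under independence *)

Section factorisation.
Context d (T : measurableType d) (R : realType) (P : probability T R).

Lemma mean_indic (A : set T) : measurable A -> \int[P]_t \1_A t = fine (P A).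
Proof. by move=> mA; rewrite /Rintegral integral_indic// setIT. Qed.

(** The measure with density W and the measure c P have the same image under
    (U1, U2), since the two images agree on rectangles, a pi-system that generates
    the product sigma-algebra.  Integrating g against the two images gives the
    factorisation. *)
Section weighted_law.
Variables (W : T -> R) (U1 U2 : T -> R) (c : R).
Hypotheses (bW : bmfun W) (W0 : forall t, 0 <= W t) (c0 : 0 <= c).
Hypotheses (mU1 : measurable_fun setT U1) (mU2 : measurable_fun setT U2).
Hypothesis rectangles : forall B C : set R, measurable B -> measurable C ->
  \int[P]_t (W t * (\1_B (U1 t) * \1_C (U2 t))) =
  c * \int[P]_t (\1_B (U1 t) * \1_C (U2 t)).

Let mW : measurable_fun setT W. Proof. by case: bW. Qed.
Let V t := (U1 t, U2 t).
Let mV : measurable_fun setT V. Proof. exact: measurable_fun_pair. Qed.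

Let mem_preimage (A : set (R * R)) t : (t \in V @^-1` A) = (V t \in A).
Proof. by apply/idP/idP => /set_mem ?; exact/mem_set. Qed.

Let nu1 := pushforward (density_measure P mW W0) V.
Let nu2 := pushforward (mscale (NngNum c0) P) V.

Let nu1E A : measurable A -> nu1 A = (\int[P]_t (W t * \1_A (V t)))%:E.
Proof.
move=> mA; have mVA : measurable (V @^-1` A) by rewrite -[X in measurable X]setTI; exact: mV.
rewrite /nu1 /pushforward /density_measure/= /Rintegral fineK; last first.
  apply: integrable_fin_num => //; apply: bmfun_integrableP; apply: bmfunM => //.
  by apply: (bmfun_comp _ mV); exact: bmfun_indic.
rewrite [LHS]integral_mkcond; apply: eq_integral => t _.
by rewrite /patch indicE mem_preimage; case: ifP; rewrite ?mulr1// mulr0.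
Qed.

Let nu2E A : measurable A -> nu2 A = (c * \int[P]_t \1_A (V t))%:E.
Proof.
move=> mA; have mVA : measurable (V @^-1` A) by rewrite -[X in measurable X]setTI; exact: mV.
rewrite /nu2 /pushforward /mscale/= EFinM; congr (_ * _)%E.
rewrite (_ : (fun t => _) = \1_(V @^-1` A)).
  by rewrite mean_indic// fineK ?fin_num_measure.
by apply/funext => t; rewrite !indicE mem_preimage.
Qed.

Let law_eq A : measurable A -> nu1 A = nu2 A.
Proof.
pose G : set (set (R * R)) :=
  [set D | exists B, measurable B /\ exists C, measurable C /\ D = B `*` C].
apply: (measure_unique G (fun _ => setT)) => //.
- rewrite measurable_prod_measurableType; congr (<<s _ >>).
  rewrite predeqE => D; split => [[B mB [C mC <-]]|[B [mB [C [mC ->]]]]].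
    by exists B; split => //; exists C.
  by exists B => //; exists C.
- move=> _ _ [B [mB [C [mC ->]]]] [B' [mB' [C' [mC' ->]]]].
  rewrite -setXI; exists (B `&` B'); split; first exact: measurableI.
  by exists (C `&` C'); split => //; exact: measurableI.
- by move=> _; exists setT; split => //; exists setT; split => //; rewrite setXTT.
- by rewrite bigcup_const.
- move=> _ [B [mB [C [mC ->]]]].
  have e t : \1_(B `*` C) (V t) = \1_B (U1 t) * \1_C (U2 t) :> R.
    by rewrite !indicE in_setX -natrM mulnb.
  apply: (etrans (nu1E (measurableX mB mC))).
  apply: (etrans _ (esym (nu2E (measurableX mB mC)))).
  congr EFin; under eq_Rintegral do rewrite e.
  under [in RHS]eq_Rintegral do rewrite e.
  exact: rectangles.
- by move=> _; apply: (@le_lt_trans _ _ (nu1 setT)); rewrite // nu1E// ltry.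
Qed.

Lemma ge0_mean_factor (g : R * R -> R) : bmfun g -> (forall z, 0 <= g z) ->
  \int[P]_t (W t * g (U1 t, U2 t)) = c * \int[P]_t g (U1 t, U2 t).
Proof.
move=> bg g0; have mg : measurable_fun setT (EFin \o g).
  by apply/measurable_EFinP; case: bg.
have e1 : (\int[nu1]_z (EFin \o g) z = \int[P]_t (W t * g (U1 t, U2 t))%:E)%E.
  rewrite ge0_integral_pushforward//; last by move=> z _; rewrite lee_fin.
  rewrite preimage_setT ge0_integral_density_measure//.
  - by apply: eq_integral => t _; rewrite /= -EFinM mulrC.
  - exact: measurableT_comp.
  - by move=> t; rewrite lee_fin.
have e2 : (\int[nu2]_z (EFin \o g) z = c%:E * \int[P]_t (g (U1 t, U2 t))%:E)%E.
  rewrite ge0_integral_pushforward//; last by move=> z _; rewrite lee_fin.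
  rewrite preimage_setT ge0_integral_mscale//.
  - exact: measurableT_comp.
  - by move=> t _; rewrite lee_fin.
rewrite /Rintegral -e1 -[c in RHS]/(fine c%:E) -fineM//; last first.
  apply: integrable_fin_num => //; apply: bmfun_integrableP.
  exact: (bmfun_comp bg mV).
rewrite -e2; congr fine; apply: eq_measure_integral => A mA _; exact: law_eq.
Qed.

End weighted_law.

(** The sign restrictions disappear after adding constants to W and to g; the
    hypothesis on rectangles identifies c as the mean of W. *)
Lemma mean_factor (W U1 U2 : T -> R) (c : R) (g : R * R -> R) :
  bmfun W -> measurable_fun setT U1 -> measurable_fun setT U2 ->
  (forall B C : set R, measurable B -> measurable C ->
    \int[P]_t (W t * (\1_B (U1 t) * \1_C (U2 t))) =
    c * \int[P]_t (\1_B (U1 t) * \1_C (U2 t))) ->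
  bmfun g ->
  \int[P]_t (W t * g (U1 t, U2 t)) = c * \int[P]_t g (U1 t, U2 t).
Proof.
move=> bW mU1 mU2 rect bg.
have mV : measurable_fun setT (fun t => (U1 t, U2 t)) by exact: measurable_fun_pair.
have bgV : bmfun (fun t => g (U1 t, U2 t)) by exact: (bmfun_comp bg mV).
have [_ [M WM]] := bW; have [_ [M' gM']] := bg.
have nonneg (x B : R) : `|x| <= B -> 0 <= x + B.
  by rewrite ler_norml => /andP[]; lra.
have bind (B : set R) (U : T -> R) : measurable B -> measurable_fun setT U ->
    bmfun (fun t => \1_B (U t) : R).
  by move=> mB mU; apply: (bmfun_comp _ mU); exact: bmfun_indic.
have cW : c = \int[P]_t W t.
  have := rect setT setT measurableT measurableT.
  under eq_Rintegral do rewrite !indicT !mulr1.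
  under [in RHS]eq_Rintegral do rewrite !indicT !mulr1.
  by rewrite mean_cst mulr1 => ->.
have c0 : 0 <= c + M.
  rewrite cW -[M in _ + M](mean_cst P M) -bmeanD//; last exact: bmfun_cst.
  by apply: Rintegral_ge0 => t _; exact: nonneg.
have bWM : bmfun (fun t => W t + M) by apply: bmfunD => //; exact: bmfun_cst.
have bgM : bmfun (fun z => g z + M') by apply: bmfunD => //; exact: bmfun_cst.
have rect' (B C : set R) : measurable B -> measurable C ->
    \int[P]_t ((W t + M) * (\1_B (U1 t) * \1_C (U2 t))) =
    (c + M) * \int[P]_t (\1_B (U1 t) * \1_C (U2 t)).
  move=> mB mC; have bBC : bmfun (fun t => \1_B (U1 t) * \1_C (U2 t) : R).
    by apply: bmfunM; exact: bind.
  under eq_Rintegral do rewrite mulrDl.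
  rewrite bmeanD; [|exact: bmfunM|by apply: bmfunM => //; exact: bmfun_cst].
  by rewrite rect// bmeanZl// mulrDl.
have := @ge0_mean_factor _ U1 U2 _ bWM (fun t => nonneg _ _ (WM t)) c0 mU1 mU2 rect'
  _ bgM (fun z => nonneg _ _ (gM' z)).
have bWg : bmfun (fun t => W t * g (U1 t, U2 t)) by exact: bmfunM.
have bMg : bmfun (fun t => M * g (U1 t, U2 t)) by apply: bmfunM => //; exact: bmfun_cst.
have bWM' : bmfun (fun t => W t * M') by apply: bmfunM => //; exact: bmfun_cst.
under eq_Rintegral do rewrite mulrDl !mulrDr.
rewrite (bmeanD P (bmfunD bWg bWM') (bmfunD bMg (bmfun_cst (M * M')))).
rewrite (bmeanD P bWg bWM') (bmeanD P bMg (bmfun_cst (M * M'))) bmeanZl//.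
rewrite (bmeanD P bgV (bmfun_cst M')) !mean_cst.
have -> : \int[P]_t (W t * M') = c * M'.
  by under eq_Rintegral do rewrite mulrC; rewrite bmeanZl// -cW mulrC.
lra.
Qed.

End factorisation.

Section independence.
Context d (T : measurableType d) (R : realType) (P : probability T R).

Lemma mean_prod_indic (I : finType) (V : I -> {RV P >-> R}) (J : {set I})
    (D : I -> set R) : mutually_independent V -> (forall i, measurable (D i)) ->
  \int[P]_t (\prod_(i in J) \1_(D i) (V i t)) =
  \prod_(i in J) \int[P]_t \1_(D i) (V i t).
Proof.
move=> ind mD.
have mVD i : measurable (V i @^-1` D i).
  by rewrite -[X in measurable X]setTI; apply: measurable_funPT.
have e i t : \1_(D i) (V i t) = \1_(V i @^-1` D i) t :> R.
  by rewrite !indicE; congr (nat_of_bool _)%:R; apply/idP/idP => /set_mem ?; exact/mem_set.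
have m1 i : \int[P]_t \1_(D i) (V i t) = fine (P (V i @^-1` D i)).
  by under eq_Rintegral do rewrite e; rewrite mean_indic.
have mcap : measurable (\big[setI/setT]_(i in J) (V i @^-1` D i)).
  by apply: (big_ind (fun A : set T => measurable A)) => //; exact: measurableI.
have -> : \int[P]_t (\prod_(i in J) \1_(D i) (V i t)) =
    fine (P (\big[setI/setT]_(i in J) (V i @^-1` D i))).
  rewrite -mean_indic//; apply: eq_Rintegral => t _.
  rewrite (big_morph (fun A : set T => \1_A t : R) (id1 := 1) (op1 := *%R)).
  - by apply: eq_bigr => i _; rewrite e.
  - by move=> A B; rewrite indicI.
  - by rewrite indicT.
rewrite ind// (eq_bigr (fun i => (\int[P]_t \1_(D i) (V i t))%:E)); last first.
  by move=> i _; rewrite m1 fineK ?fin_num_measure.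
by rewrite prodEFin.
Qed.

Context (n : nat) (X zeta : 'I_n -> {RV P >-> R}).
Hypothesis ind : mutually_independent
  (fun k : 'I_n + 'I_n => match k with inl j => X j | inr j => zeta j end).

Let mX j : measurable_fun setT (X j). Proof. exact: measurable_funPT. Qed.
Let mzeta j : measurable_fun setT (zeta j). Proof. exact: measurable_funPT. Qed.

Lemma mean_indic_pair j (B C : set R) : measurable B -> measurable C ->
  \int[P]_t (\1_B (X j t) * \1_C (zeta j t)) =
  \int[P]_t \1_B (X j t) * \int[P]_t \1_C (zeta j t).
Proof.
move=> mB mC.
have := @mean_prod_indic _ _ [set inl j; inr j]%SET
  (fun k : 'I_n + 'I_n => match k with inl _ => B | inr _ => C end) ind.
have nin : inl j \notin [set (inr j : 'I_n + 'I_n)]%SET by rewrite finset.in_set1.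
rewrite big_setU1//= big_set1/= => <-; last by case.
by apply: eq_Rintegral => t _; rewrite big_setU1//= big_set1.
Qed.

Definition rectangle_factor j (q : T -> R) := exists B C : set R,
  [/\ measurable B, measurable C & q = fun t => \1_B (X j t) * \1_C (zeta j t)].

Definition sum_factor j (q : T -> R) := exists g : R -> R,
  bmfun g /\ q = fun t => g (X j t + zeta j t).

Let bind (B : set R) (U : T -> R) : measurable B -> measurable_fun setT U ->
  bmfun (fun t => \1_B (U t) : R).
Proof. by move=> mB mU; apply: (bmfun_comp _ mU); exact: bmfun_indic. Qed.

Let rectangle_bmfun j q : rectangle_factor j q -> bmfun q.
Proof.
by move=> [B [C [mB mC ->]]]; apply: bmfunM; apply: bind.
Qed.

Let sum_bmfun j q : sum_factor j q -> bmfun q.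
Proof. by move=> [g [bg ->]]; apply: (bmfun_comp bg); exact: measurable_funD. Qed.

Let mean_prod_rectangle (q : 'I_n -> T -> R) : (forall j, rectangle_factor j (q j)) ->
  \int[P]_t (\prod_j q j t) = \prod_j \int[P]_t q j t.
Proof.
move=> /choice[B /choice[C hq]].
pose D (k : 'I_n + 'I_n) := match k with inl j => B j | inr j => C j end.
have mD k : measurable (D k) by case: k => j; have [] := hq j.
have := @mean_prod_indic _ _ [set: 'I_n + 'I_n]%SET D ind mD.
rewrite (eq_bigl xpredT) => [|k]; last exact: finset.in_setT.
rewrite big_sumType/= -big_split/= => e.
transitivity (\prod_j (\int[P]_t \1_(B j) (X j t) * \int[P]_t \1_(C j) (zeta j t))).
  rewrite -e; apply: eq_Rintegral => t _.
  rewrite [RHS](eq_bigl xpredT) => [|k]; last exact: finset.in_setT.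
  rewrite big_sumType/= -big_split/=; apply: eq_bigr => j _.
  by have [_ _ ->] := hq j.
apply: eq_bigr => j _; have [mB mC ->] := hq j.
by rewrite mean_indic_pair.
Qed.

(** Induction on the number k of factors allowed to be functions of a sum.  The
    factor of index k is freed by [mean_factor], with W the product of the other
    factors; the hypothesis on rectangles that this asks for is the induction
    hypothesis.  It is for this induction that the two kinds of factors are
    mixed in one statement. *)
Lemma mean_prod_factors (k : nat) (q : 'I_n -> T -> R) :
  (forall j, rectangle_factor j (q j) \/ sum_factor j (q j)) ->
  (forall j : 'I_n, (k <= j)%N -> rectangle_factor j (q j)) ->
  \int[P]_t (\prod_j q j t) = \prod_j \int[P]_t q j t.
Proof.
elim: k q => [|k ih] q hq rq.
  by apply: mean_prod_rectangle => j; exact: rq.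
have [kn|nk] := ltnP k n; last first.
  apply: ih => // j kj; apply: rq.
  by have := leq_ltn_trans kj (ltn_ord j); rewrite ltnNge nk.
pose j0 := Ordinal kn.
have bq j : bmfun (q j) by case: (hq j) => [/rectangle_bmfun|/sum_bmfun].
have rest j : j != j0 -> (k <= j)%N -> (k < j)%N.
  by move=> jj0 kj; rewrite ltn_neqAle kj andbT; apply: contraNneq jj0 => kj'; apply/eqP/val_inj.
case: (hq j0) => [r0|[g [bg q0E]]].
  apply: ih => // j kj; have [->//|jj0] := eqVneq j j0.
  by apply: rq; exact: rest.
pose W t := \prod_(j | j != j0) q j t.
have bW : bmfun W.
  rewrite (_ : W = fun t => \prod_(j <- enum 'I_n) (if j != j0 then q j t else 1)).
    apply: bmfun_prod => j; case: (j != j0); [exact: bq|exact: bmfun_cst].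
  by apply/funext => t; rewrite /W big_mkcond/= big_enum.
pose c := \prod_(j | j != j0) \int[P]_t q j t.
have rect (B C : set R) : measurable B -> measurable C ->
    \int[P]_t (W t * (\1_B (X j0 t) * \1_C (zeta j0 t))) =
    c * \int[P]_t (\1_B (X j0 t) * \1_C (zeta j0 t)).
  move=> mB mC.
  pose q' j := if j == j0 then fun t => \1_B (X j0 t) * \1_C (zeta j0 t) else q j.
  have rq'0 : rectangle_factor j0 (q' j0).
    by exists B, C; split => //; rewrite /q' eqxx.
  have : \int[P]_t (\prod_j q' j t) = \prod_j \int[P]_t q' j t.
    apply: ih => j.
      have [->|jj0] := eqVneq j j0; first by left.
      by rewrite /q' (negbTE jj0).
    move=> kj; have [->//|jj0] := eqVneq j j0.
    by rewrite /q' (negbTE jj0); apply: rq; exact: rest.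
  have q'0 : q' j0 = fun t => \1_B (X j0 t) * \1_C (zeta j0 t) by rewrite /q' eqxx.
  have q'n j : j != j0 -> q' j = q j by move=> jj0; rewrite /q' (negbTE jj0).
  rewrite (bigD1 j0)//= q'0.
  rewrite [X in _ * X](eq_bigr (fun j => \int[P]_t q j t)) => [|j jj0]; last by rewrite q'n.
  rewrite -/c [in RHS]mulrC => <-; apply: eq_Rintegral => t _.
  rewrite (bigD1 j0)//= q'0 mulrC; congr (_ * _); apply: eq_bigr => j jj0.
  by rewrite q'n.
have bg2 : bmfun (fun z : R * R => g (z.1 + z.2)).
  apply: (bmfun_comp bg).
  by apply: measurable_funD; [exact: measurable_fst|exact: measurable_snd].
have := mean_factor bW (mX j0) (mzeta j0) rect bg2.
rewrite /= (bigD1 j0)//= -/c q0E [in RHS]mulrC => <-.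
apply: eq_Rintegral => t _; rewrite (bigD1 j0)//= {1}q0E mulrC.
by congr (_ * _).
Qed.

Lemma mean_prod_sums (g : 'I_n -> R -> R) : (forall j, bmfun (g j)) ->
  \int[P]_t (\prod_j g j (X j t + zeta j t)) =
  \prod_j \int[P]_t g j (X j t + zeta j t).
Proof.
move=> bg; apply: (@mean_prod_factors n) => j; first by right; exists (g j).
by move=> nj; have := ltn_ord j; rewrite ltnNge nj.
Qed.

(** Two applications of [mean_factor], freeing first the function of zeta j and
    then that of X j. *)
Lemma mean_mul_pair j (f g : R -> R) : bmfun f -> bmfun g ->
  \int[P]_t (f (X j t) * g (zeta j t)) =
  \int[P]_t f (X j t) * \int[P]_t g (zeta j t).
Proof.
move=> bf bg.
have b1 (h : R -> R) : bmfun h -> bmfun (fun z : R * R => h z.1).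
  by move=> bh; exact: (bmfun_comp bh measurable_fst).
have indII (B C : set R) x : \1_B x * \1_C x = \1_(B `&` C) x :> R by rewrite indicI.
have h1 B : measurable B ->
    \int[P]_t (\1_B (X j t) * g (zeta j t)) =
    \int[P]_t \1_B (X j t) * \int[P]_t g (zeta j t).
  move=> mB; apply: (@mean_factor _ _ _ P (fun t => \1_B (X j t)) (zeta j) (zeta j) _
    (fun z => g z.1)) => //; [exact: bind| |exact: b1].
  move=> C D mC mD; under eq_Rintegral do rewrite indII.
  under [X in _ = _ * X]eq_Rintegral do rewrite indII.
  by apply: mean_indic_pair => //; exact: measurableI.
under eq_Rintegral do rewrite mulrC.
rewrite [RHS]mulrC.
apply: (@mean_factor _ _ _ P (fun t => g (zeta j t)) (X j) (X j) _
    (fun z => f z.1)) => //; [exact: (bmfun_comp bg)| |exact: b1].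
move=> C D mC mD; under eq_Rintegral do rewrite indII.
under [X in _ = _ * X]eq_Rintegral do rewrite indII.
transitivity (\int[P]_t (\1_(C `&` D) (X j t) * g (zeta j t))).
  by apply: eq_Rintegral => t _; exact: mulrC.
by rewrite h1; [exact: mulrC|exact: measurableI].
Qed.

End independence.

(** * Laws of the observations *)

Section laws.
Context d (T : measurableType d) (R : realType) (P : probability T R).
Notation mu := (@lebesgue_measure R).
Variables (f : R -> R) (hf : is_density f) (X : {RV P >-> R}).

(* Measures with a Lebesgue density live on the copy of the real line that
   carries the Lebesgue measure, so X is also read with values there. *)
Let mX : @measurable_fun _ _ T (measurableTypeR R) setT X.
Proof. by move=> _ B mB; rewrite setTI; exact: (measurable_funPTI X mB). Qed.

(** The two laws agree on half-lines, hence on half-open intervals, which generate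
    the Borel sets. *)
Lemma law_of_cdf (F : R -> R) : (forall t, ((F t)%:E =
    \int[mu]_(x in `]-oo, t]) (f x)%:E)%E) ->
  (forall t, cdf X t = (F t)%:E) ->
  forall A, measurable A -> distribution P X A = density_probability hf A.
Proof.
move=> FE cX A mA.
have ray t : distribution P X `]-oo, t] = density_probability hf `]-oo, t].
  by rewrite -[LHS]/(cdf X t) cX FE.
apply: (@measure_unique _ R (measurableTypeR R) (@ocitv R)
  (fun n => `](- n%:R), n%:R]%classic) erefl (@ocitvI R) _ _
  (@pushforward _ _ T (measurableTypeR R) R P X)
  (density_probability hf) _ _ A mA) => //.
- by move=> n; exact: is_ocitv.
- apply/seteqP; split => // x _; exists (Num.truncn `|x|).+1 => //=.
  rewrite in_itv/=; have := truncnS_gt `|x|; rewrite ltr_norml => /andP[-> /ltW].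
  by [].
- move=> _ [[a b] _ <-]/=.
  have [ab|ba] := ltP a b; last first.
    by rewrite set_itv_ge ?bnd_simp -?leNgt// !measure0.
  have -> : `]a, b]%classic = `]-oo, b] `\` `]-oo, a] :> set R.
    by rewrite -[RHS]setCK setCD setCitvl setUC -[LHS]setCK setCitv.
  have sub : ([set` `]-oo, a]] : set R) `<=` [set` `]-oo, b]].
    by apply: subset_itvl; rewrite bnd_simp ltW.
  have fin t : (density_probability hf [set` `]-oo, t]] < +oo)%E.
    by apply: (le_lt_trans (probability_le1 _ _)); rewrite ?ltry.
  have ray' t : @pushforward _ _ T (measurableTypeR R) R P X [set` `]-oo, t]] =
      density_probability hf [set` `]-oo, t]].
    by rewrite -ray.
  by rewrite !measureD//= ?setIidr// !ray' ?fin.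
- move=> n; apply: (@le_lt_trans _ _ 1%E); last by rewrite ltry.
  apply: (probability_le1 P); rewrite -[X in measurable X]setTI; exact: mX.
Qed.

Hypothesis law : forall A, measurable A -> distribution P X A = density_probability hf A.

Lemma mean_law (g : R -> R) : bmfun g ->
  \int[P]_t g (X t) = \int[mu]_x (g x * f x).
Proof.
move=> bg; rewrite -(Rintegral_density_probability hf bg) /Rintegral; congr fine.
have mg : @measurable_fun _ _ (measurableTypeR R) _ setT (EFin \o g).
  by apply/measurable_EFinP; case: bg.
transitivity (\int[@pushforward _ _ T (measurableTypeR R) R P X]_x (EFin \o g) x)%E.
  rewrite (integral_pushforward mX mg) ?preimage_setT//.
  apply: bmfun_integrableP; apply: (bmfun_comp bg); exact: measurable_funPT.
by apply: eq_measure_integral => A mA _; exact: law.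
Qed.

Lemma cosmean_law w : cosmean P X w = fourier_re f w.
Proof.
rewrite /cosmean (@mean_law (fun x => cos (w * x))); last first.
  by apply: bmfun_cos; apply: measurable_funM.
by apply: eq_Rintegral => x _; rewrite mulrC.
Qed.

Lemma sinmean_law w : sinmean P X w = fourier_im f w.
Proof.
rewrite /sinmean (@mean_law (fun x => sin (w * x))); last first.
  by apply: bmfun_sin; apply: measurable_funM.
by apply: eq_Rintegral => x _; rewrite mulrC.
Qed.

Lemma law_atomless t0 : P [set t | X t = t0] = 0%E.
Proof.
have := law (measurable_set1 t0).
rewrite /distribution /pushforward /density_probability /density_measure integral_set1.
by [].
Qed.

End laws.

Lemma cf_of_sum d (T : measurableType d) (R : realType) (P : probability T R)
    (U V : T -> R) w : measurable_fun setT U -> measurable_fun setT V ->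
  (forall f g : R -> R, bmfun f -> bmfun g ->
    \int[P]_t (f (U t) * g (V t)) = \int[P]_t f (U t) * \int[P]_t g (V t)) ->
  cosmean P (fun t => U t + V t) w =
    cosmean P U w * cosmean P V w - sinmean P U w * sinmean P V w /\
  sinmean P (fun t => U t + V t) w =
    sinmean P U w * cosmean P V w + cosmean P U w * sinmean P V w.
Proof.
move=> mU mV ind.
have bc : bmfun (fun x : R => cos (w * x)) by apply: bmfun_cos; apply: measurable_funM.
have bs : bmfun (fun x : R => sin (w * x)) by apply: bmfun_sin; apply: measurable_funM.
have bUV (f g : R -> R) : bmfun f -> bmfun g -> bmfun (fun t => f (U t) * g (V t)).
  by move=> bf bg; apply: bmfunM; [exact: bmfun_comp bf mU|exact: bmfun_comp bg mV].
split.
  rewrite /cosmean; under eq_Rintegral do rewrite mulrDr cosD.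
  rewrite (bmeanB P (bUV _ _ bc bc) (bUV _ _ bs bs)).
  by rewrite (ind _ _ bc bc) (ind _ _ bs bs).
rewrite /sinmean; under eq_Rintegral do rewrite mulrDr sinD.
rewrite (bmeanD P (bUV _ _ bs bc) (bUV _ _ bc bs)).
by rewrite (ind _ _ bs bc) (ind _ _ bc bs).
Qed.

(** * Concentration of an empirical mean *)

Section exponential_bounds.
Context (R : realType).

(** From e^{-x} >= 1 - x, that is e^x <= 1/(1 - x). *)
Lemma expR_le_quadratic (x : R) : `|x| <= 1 / 2 -> expR x <= 1 + x + 2 * x ^+ 2.
Proof.
rewrite ler_norml => /andP[x1 x2].
have h : 1 - x <= expR (- x) by exact: expR_ge1Dx.
have h0 : 0 < 1 - x by lra.
have e : expR x <= (1 - x)^-1.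
  by rewrite -[expR x]invrK -expRN lef_pV2 ?posrE ?expR_gt0.
apply: (le_trans e); rewrite -[leLHS]mul1r ler_pdivrMr//.
have -> : (1 + x + 2 * x ^+ 2) * (1 - x) = 1 + x ^+ 2 * (1 - 2 * x) by ring.
by rewrite lerDl mulr_ge0 ?sqr_ge0//; lra.
Qed.

Lemma sqr_le_expR (x : R) : x ^+ 2 <= 4 * (expR x + expR (- x)).
Proof.
have h (y : R) : 0 <= y -> y ^+ 2 <= 4 * expR y.
  move=> y0; have -> : expR y = expR (y / 2) ^+ 2.
    by rewrite -expRM_natl; congr expR; field.
  have : 1 + y / 2 <= expR (y / 2) by exact: expR_ge1Dx.
  move: (expR _) => e he; nra.
have [x0|x0] := leP 0 x.
  by apply: (le_trans (h _ x0)); rewrite ler_pM2l// lerDl expR_ge0.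
rewrite -sqrrN; apply: le_trans (h (- x) _) _; first by rewrite oppr_ge0 ltW.
by rewrite ler_pM2l// lerDr expR_ge0.
Qed.

End exponential_bounds.

Section concentration.
Context d (T : measurableType d) (R : realType) (P : probability T R).
Context (n : nat) (D : 'I_n -> T -> R) (v : R).
Hypotheses (bD : forall j, bmfun (D j)) (D0 : forall j, \int[P]_t D j t = 0).
Hypothesis Dv : forall j, \int[P]_t (D j t ^+ 2) <= v.

Lemma bmfun_expR (g : T -> R) : bmfun g -> bmfun (fun t => expR (g t)).
Proof.
move=> [mg [M gM]]; split; first by apply: measurableT_comp => //; exact: measurable_expR.
exists (expR M) => t; rewrite ger0_norm ?expR_ge0// ler_expR.
by rewrite (le_trans (ler_norm _)).
Qed.

Variable s : R.
Hypothesis sD : forall j t, `|s * D j t| <= 1 / 2.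
Hypothesis factor : \int[P]_t (\prod_j expR (s * D j t)) =
  \prod_j \int[P]_t expR (s * D j t).

(** Each factor is at most 1 + 2 s^2 v <= exp (2 s^2 v): the linear term of
    [expR_le_quadratic] has mean 0. *)
Lemma mgf_le : \int[P]_t expR (s * \sum_j D j t) <= expR (n%:R * (2 * s ^+ 2 * v)).
Proof.
have -> : \int[P]_t expR (s * \sum_j D j t) = \prod_j \int[P]_t expR (s * D j t).
  rewrite -factor; apply: eq_Rintegral => t _.
  by rewrite mulr_sumr expR_sum.
have -> : expR (n%:R * (2 * s ^+ 2 * v)) = \prod_(j < n) expR (2 * s ^+ 2 * v).
  by rewrite prodr_const card_ord expRM_natl.
apply: ler_prod => j _; apply/andP; split.
  by apply: Rintegral_ge0 => t _; exact: expR_ge0.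
apply: le_trans (expR_ge1Dx _).
have bs1 : bmfun (fun t => s * D j t) by apply: bmfunM => //; exact: bmfun_cst.
have bs2 : bmfun (fun t => 2 * s ^+ 2 * D j t ^+ 2).
  by apply: bmfunM; [exact: bmfun_cst|exact: bmfunX].
apply: (@le_trans _ _ (\int[P]_t (1 + s * D j t + 2 * s ^+ 2 * D j t ^+ 2))).
  apply: ler_bmean; first exact: bmfun_expR.
    by apply: bmfunD => //; apply: bmfunD => //; exact: bmfun_cst.
  by move=> t; rewrite -mulrA -exprMn; exact: expR_le_quadratic.
rewrite (bmeanD P (bmfunD (bmfun_cst 1) bs1) bs2) (bmeanD P (bmfun_cst 1) bs1).
rewrite mean_cst !bmeanZl//; last exact: bmfunX.
rewrite D0 mulr0 addr0 lerD2l ler_wpM2l// mulr_ge0 ?sqr_ge0//.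
Qed.

End concentration.

(** Each K (Y j) is centred at its own mean, and each of these means is within b of
    theta. *)
Section sample_average.
Context d (T : measurableType d) (R : realType) (P : probability T R).
Context (n : nat) (Y : 'I_n -> T -> R) (K : R -> R) (A v b theta : R).
Hypotheses (n0 : (0 < n)%N) (mY : forall j, measurable_fun setT (Y j)).
Hypotheses (bK : bmfun K) (A0 : 0 < A) (KA : forall y, `|K y| <= A).
Hypothesis Kv : forall j, \int[P]_t (K (Y j t) ^+ 2) <= v.
Hypothesis Kb : forall j, `|\int[P]_t K (Y j t) - theta| <= b.
Hypothesis factor : forall g : 'I_n -> R -> R, (forall j, bmfun (g j)) ->
  \int[P]_t (\prod_j g j (Y j t)) = \prod_j \int[P]_t g j (Y j t).

Let e j := \int[P]_t K (Y j t).
Let D j t := K (Y j t) - e j.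
Let S t := \sum_j D j t.

Let bKY j : bmfun (fun t => K (Y j t)). Proof. exact: bmfun_comp bK (mY j). Qed.
Let bD j : bmfun (D j). Proof. by apply: bmfunB => //; exact: bmfun_cst. Qed.
Let bS : bmfun S.
Proof. exact: (@bmfun_sum _ _ _ _ (index_enum 'I_n) D). Qed.

Let D0 j : \int[P]_t D j t = 0.
Proof. by rewrite (bmeanB P (bKY j) (bmfun_cst (e j))) mean_cst subrr. Qed.

Let Dv j : \int[P]_t (D j t ^+ 2) <= v.
Proof.
have bK2 : bmfun (fun t => K (Y j t) ^+ 2) by exact: bmfunX.
have bc : bmfun (fun t => (- 2 * e j) * K (Y j t)).
  by apply: bmfunM => //; exact: bmfun_cst.
have -> : \int[P]_t (D j t ^+ 2) =
    \int[P]_t (K (Y j t) ^+ 2 + (- 2 * e j) * K (Y j t) + e j ^+ 2).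
  by apply: eq_Rintegral => t _; rewrite /D; ring.
rewrite (bmeanD P (bmfunD bK2 bc) (bmfun_cst (e j ^+ 2))) (bmeanD P bK2 bc).
rewrite bmeanZl// mean_cst -/(e j); have := Kv j; have := sqr_ge0 (e j); nra.
Qed.

Let sD (s : R) : `|s| = (4 * A)^-1 -> forall j t, `|s * D j t| <= 1 / 2.
Proof.
move=> sA j t; rewrite normrM sA mulrC ler_pdivrMr; last by have := A0; lra.
have h : `|e j| <= A by apply: normr_bmean_le => // u; exact: KA.
by have := ler_normB (K (Y j t)) (e j); have := KA (Y j t); rewrite -/(D j t); lra.
Qed.

(** The largest s that [expR_le_quadratic] allows, as the centred variables are
    bounded by 2A. *)
Let mgf (s : R) : `|s| = (4 * A)^-1 ->
  \int[P]_t expR (s * S t) <= expR (n%:R * v / (8 * A ^+ 2)).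
Proof.
move=> sA.
have s2 : s ^+ 2 = (4 * A)^-1 ^+ 2 by rewrite -sA real_normK// num_real.
have := mgf_le bD D0 Dv (sD sA); rewrite s2.
have -> : n%:R * (2 * (4 * A)^-1 ^+ 2 * v) = n%:R * v / (8 * A ^+ 2).
  by have := A0; move=> /gt_eqF/negbT A0'; field.
apply.
apply: (factor (g := fun j y => expR (s * (K y - e j)))) => j.
apply: bmfun_expR; apply: bmfunM; first exact: bmfun_cst.
by apply: bmfunB => //; exact: bmfun_cst.
Qed.

Let sp : `|(4 * A)^-1| = (4 * A)^-1.
Proof. by rewrite ger0_norm// invr_ge0; have := A0; lra. Qed.

Let sn : `|- (4 * A)^-1| = (4 * A)^-1. Proof. by rewrite normrN sp. Qed.

Let bexp (s : R) : bmfun (fun t => expR (s * S t)).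
Proof. by apply: bmfun_expR; apply: bmfunM => //; exact: bmfun_cst. Qed.

Definition average t := n%:R^-1 * \sum_j K (Y j t).

Let nR0 : 0 < n%:R :> R. Proof. by rewrite ltr0n. Qed.

Lemma bmfun_average : bmfun average.
Proof.
apply: bmfunM; first exact: bmfun_cst.
exact: (@bmfun_sum _ _ _ _ (index_enum 'I_n) (fun j t => K (Y j t))).
Qed.

Let average_err t : `|average t - theta| <= n%:R^-1 * `|S t| + b.
Proof.
have -> : average t - theta = n%:R^-1 * S t + n%:R^-1 * \sum_j (e j - theta).
  rewrite -mulrDr /S -big_split/= /average.
  rewrite [in RHS](eq_bigr (fun j => K (Y j t) - theta)) => [|j _]; last by rewrite /D; ring.
  by rewrite sumrB sumr_const card_ord -[theta *+ n]mulr_natl mulrBr mulrA mulVf ?mul1r// gt_eqF.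
rewrite (le_trans (ler_normD _ _))// !normrM ger0_norm ?invr_ge0 ?ler0n//.
rewrite lerD2l -ler_pdivlMl ?invr_gt0// invrK.
apply: (le_trans (ler_norm_sum _ _ _)).
have -> : n%:R * b = \sum_(j < n) b by rewrite sumr_const card_ord mulr_natl.
by apply: ler_sum => j _; exact: Kb.
Qed.

(** The square is dominated by exponentials, so that the exponential moment also
    controls the second moment and a separate variance computation for sums is
    avoided. *)
Lemma mean_square_average : \int[P]_t (`|average t - theta| ^+ 2) <=
  256 * (A / n%:R) ^+ 2 * expR (n%:R * v / (8 * A ^+ 2)) + 2 * b ^+ 2.
Proof.
have b0 : 0 <= b by exact: le_trans (Kb (Ordinal n0)).
set s := (4 * A)^-1; have s0 : 0 < s by rewrite invr_gt0; have := A0; lra.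
pose c := 128 * (A / n%:R) ^+ 2.
have c0 : 0 <= c by exact: mulr_ge0 (ler0n _ _) (sqr_ge0 _).
apply: (@le_trans _ _
   (\int[P]_t (c * (expR (s * S t) + expR (- s * S t)) + 2 * b ^+ 2))).
  apply: ler_bmean.
  - by apply: bmfunX; apply: bmfun_norm; apply: bmfunB; [exact: bmfun_average|exact: bmfun_cst].
  - apply: bmfunD; last exact: bmfun_cst.
    by apply: bmfunM; [exact: bmfun_cst|apply: bmfunD; exact: bexp].
  - move=> t; have := average_err t; have := sqr_le_expR (s * S t); rewrite -mulNr.
    move: (expR (s * _) + _) => Ex hE ha.
    have q0 : 0 <= n%:R^-1 * `|S t| by rewrite mulr_ge0// invr_ge0 ltW.
    apply: (@le_trans _ _ ((n%:R^-1 * `|S t| + b) ^+ 2)).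
      by rewrite ler_pXn2r ?nnegrE// addr_ge0.
    apply: (@le_trans _ _ (2 * (n%:R^-1 * `|S t|) ^+ 2 + 2 * b ^+ 2)).
      by have := sqr_ge0 (n%:R^-1 * `|S t| - b); rewrite sqrrB sqrrD; lra.
    rewrite lerD2r.
    have -> : 2 * (n%:R^-1 * `|S t|) ^+ 2 = c / 4 * (s * S t) ^+ 2.
      rewrite exprMn real_normK ?num_real// /c /s.
      have := A0; move=> /gt_eqF/negbT A0'; have := nR0; move=> /gt_eqF/negbT n0'.
      by field; rewrite n0' A0'.
    have : c / 4 * (s * S t) ^+ 2 <= c / 4 * (4 * Ex) by rewrite ler_wpM2l// divr_ge0.
    by lra.
have bE : bmfun (fun t => expR (s * S t) + expR (- s * S t)) by apply: bmfunD; exact: bexp.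
have bcE : bmfun (fun t => c * (expR (s * S t) + expR (- s * S t))).
  by apply: bmfunM => //; exact: bmfun_cst.
rewrite (bmeanD P bcE (bmfun_cst (2 * b ^+ 2))) bmeanZl// (bmeanD P (bexp _) (bexp _)).
rewrite mean_cst lerD2r.
have -> : 256 * (A / n%:R) ^+ 2 * expR (n%:R * v / (8 * A ^+ 2)) =
  c * (expR (n%:R * v / (8 * A ^+ 2)) + expR (n%:R * v / (8 * A ^+ 2))).
  by rewrite /c; ring.
by rewrite ler_wpM2l// lerD// mgf.
Qed.

(** Chernoff's bound on both sides: on the event, exp (s |S|) exceeds
    exp (s n delta). *)
Lemma tail_average (delta : R) :
  (P [set t | (delta + b < `|average t - theta|)%R] <=
   (2 * expR (n%:R * v / (8 * A ^+ 2) - n%:R * delta / (4 * A)))%:E)%E.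
Proof.
set B := [set t | _].
have mB : measurable B.
  have [m _] : bmfun (fun t => `|average t - theta|).
    by apply: bmfun_norm; apply: bmfunB; [exact: bmfun_average|exact: bmfun_cst].
  rewrite (_ : B = (fun t => `|average t - theta|) @^-1` `]delta + b, +oo[).
    by rewrite -[X in measurable X]setTI; exact: m.
  by apply/seteqP; split => t /=; rewrite in_itv/= andbT.
rewrite -(fineK (fin_num_measure P B mB)) lee_fin -(mean_indic P mB).
set s := (4 * A)^-1; have s0 : 0 < s by rewrite invr_gt0; have := A0; lra.
pose c := expR (- (n%:R * delta / (4 * A))).
have bE : bmfun (fun t => expR (s * S t) + expR (- s * S t)) by apply: bmfunD; exact: bexp.
apply: (@le_trans _ _ (\int[P]_t (c * (expR (s * S t) + expR (- s * S t))))).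
  apply: ler_bmean.
  - exact: bmfun_indic.
  - by apply: bmfunM => //; exact: bmfun_cst.
  move=> t; rewrite indicE; case: (boolP (t \in B)) => [/set_mem/= tB|_]; last first.
    by rewrite mulr_ge0 ?expR_ge0// addr_ge0 ?expR_ge0.
  have := lt_le_trans tB (average_err t); rewrite ltrD2r ltr_pdivlMl// => h.
  rewrite mulrDr /c -!expRD.
  have h' : n%:R * delta / (4 * A) < s * `|S t|.
    by rewrite [ltLHS]mulrC ltr_pM2l.
  have [S0|S0] := leP 0 (S t).
    rewrite ger0_norm// in h'; apply: (@le_trans _ _ (expR (- (n%:R * delta / (4 * A)) + s * S t))).
      by rewrite -[leLHS]expR0 ler_expR; lra.
    by rewrite lerDl expR_ge0.
  rewrite ltr0_norm// in h'; apply: (@le_trans _ _ (expR (- (n%:R * delta / (4 * A)) + - s * S t))).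
    by rewrite -[leLHS]expR0 ler_expR; lra.
  by rewrite lerDr expR_ge0.
rewrite bmeanZl// (bmeanD P (bexp _) (bexp _)) expRD -/c.
rewrite mulrA [leRHS]mulrC ler_wpM2l ?expR_ge0//.
have -> : 2 * expR (n%:R * v / (8 * A ^+ 2)) =
  expR (n%:R * v / (8 * A ^+ 2)) + expR (n%:R * v / (8 * A ^+ 2)) by ring.
by rewrite lerD// mgf.
Qed.

End sample_average.

(** * The two risks *)

Section model.
Context (R : realType) (fz : R -> R) (hz : is_density fz) (alpha beta L : R).
Hypotheses (E1 : cond_E1 fz beta) (E2 : cond_E2 fz).
Hypotheses (alpha2 : - (1 / 2) < alpha) (ab2 : 1 / 2 < alpha + beta).
Notation mu := (@lebesgue_measure R).

Lemma deconv_estimatorE (t0 lambda : R) n (y : 'I_n -> R) : (0 < n)%N ->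
  deconv_estimator fz t0 lambda y =
  n%:R^-1 * \sum_j deconv_kernel fz t0 lambda (y j).
Proof.
move=> n0; have n0' : n%:R != 0 :> R by rewrite pnatr_eq0 -lt0n.
rewrite /deconv_kernel sumrB sumr_const card_ord -[2^-1 *+ n]mulr_natl mulrBr mulrA mulVf//.
rewrite mul1r; congr (_ - _ * _); apply: eq_bigr => j _; congr (_ * _).
by apply: eq_Rintegral => w _; rewrite Im_cexpi_div.
Qed.

(** The bias, size and second moment of the kernel in terms of the rate, with one
    constant for all. The factor 1 in the cut-off is the constant C1 of the
    theorem. *)
Definition kernel_bound (k : R) := forall t0 z, expR 1 <= z ->
  let lambda := 1 * rate_lambda alpha beta z in
  let psi := rate_psi alpha beta z in
  let K := deconv_kernel fz t0 lambda in
  [/\ 0 < psi, bmfun K, forall y, `|K y| <= k * z * psi &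
   forall F n d (T : measurableType d) (P : probability T R)
     (X zeta : 'I_n -> {RV P >-> R}), sobolev_class alpha L F ->
   deconv_model fz F X zeta -> forall j,
   \int[P]_t (K (X j t + zeta j t)) ^+ 2 <= k ^+ 2 * z * psi ^+ 2 /\
   `|\int[P]_t K (X j t + zeta j t) - F t0| <= k * psi].

(** [kernel_estimates] at the cut-off lambda(z), simplified by [rates].  A function
    F of the class supplies the Sobolev bound with A = 2 pi L^2, and the continuity
    of its law gives the null event X = t0. *)
Lemma exists_kernel_bound : exists2 k, 0 < k & kernel_bound k.
Proof.
have [beta0 _] := E1.
have [k1 k10 H] := kernel_estimates hz (2 * pi * L ^+ 2) E1 E2 alpha2 ab2.
have [k2 k20 r] := rates alpha2 beta0 ab2.
pose k := k1 + k1 * k2 + 1.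
have k12 : 0 < k1 * k2 by exact: mulr_gt0.
exists k; first by rewrite /k; lra.
move=> t0 z z1; have [l1 psi0 lb Il lbias] := r z z1; rewrite mul1r /=.
have z0 : 0 < z by apply: lt_le_trans z1; exact: expR_gt0.
have [bK KA HX] := H t0 _ l1.
set psi := rate_psi alpha beta z in psi0 lb Il lbias *.
have k1k : k1 <= k by rewrite /k; lra.
split => //.
  move=> y; apply: (le_trans (KA y)); rewrite -mulrA.
  by apply: ler_pM => //; [exact: ltW|exact: powR_ge0].
move=> F n d T P X zeta [f [[hf FE] sob]] [cX lz ind] j.
have lX := law_of_cdf hf FE (cX j).
have mX : measurable_fun setT (X j) by exact: measurable_funPT.
have mz : measurable_fun setT (zeta j) by exact: measurable_funPT.
have lz' B : measurable B -> distribution P (zeta j) B = density_probability hz B.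
  by move=> mB; exact: lz.
have [cY sY] : (forall w, cosmean P (fun t => X j t + zeta j t) w =
      cosmean P (X j) w * fourier_re fz w - sinmean P (X j) w * fourier_im fz w) /\
    (forall w, sinmean P (fun t => X j t + zeta j t) w =
      sinmean P (X j) w * fourier_re fz w + cosmean P (X j) w * fourier_im fz w).
  have e w := cf_of_sum w mX mz (fun a b ba bb => mean_mul_pair ind j ba bb).
  split => w; have [e1 e2] := e w.
    by rewrite e1 (cosmean_law lz') (sinmean_law lz').
  by rewrite e2 (cosmean_law lz') (sinmean_law lz').
have := HX _ _ P (X j) (fun t => X j t + zeta j t) mX (measurable_funD mX mz) cY sY
  (law_atomless lX t0).
have -> : fine (P [set t | X j t <= t0]) = F t0.
  have := cX j t0; rewrite /cdf /distribution /pushforward => e.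
  have -> : [set t | X j t <= t0] = X j @^-1` `]-oo, t0].
    by apply/seteqP; split => t /=; rewrite in_itv.
  by rewrite e.
case.
  have pi0 : 0 < 2 * pi :> R by rewrite mulr_gt0// pi_gt0.
  have -> : (fun w => (charmod P (X j) w ^+ 2 * (1 + w ^+ 2) `^ alpha)%:E) =
      (fun w => (cmod (fourier f w) ^+ 2 * (1 + w ^+ 2) `^ alpha)%:E).
    by apply/funext => w; rewrite /charmod (cosmean_law lX) (sinmean_law lX) cmodE.
  by have := sob; rewrite -lee_pdivlMl ?invr_gt0// invrK -EFinM.
move=> h1 h2; split.
  apply: (le_trans h1); apply: (@le_trans _ _ (k1 * (k2 * (z * psi ^+ 2)))).
    by rewrite ler_pM2l.
  have q0 : 0 <= z * psi ^+ 2 by rewrite mulr_ge0 ?sqr_ge0// ltW.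
  rewrite mulrA -[leRHS]mulrA ler_wpM2r//.
  apply: (@le_trans _ _ k); first by rewrite /k; lra.
  by rewrite expr2 ler_peMl /k; lra.
apply: (le_trans h2).
by apply: ler_pM => //; [exact: ltW|exact: powR_ge0].
Qed.

End model.

Section risks.
Context (R : realType) (fz : R -> R) (hz : is_density fz) (alpha beta L : R).
Variables (k : R) (k0 : 0 < k) (hk : kernel_bound fz alpha beta L k).

Section fixed_model.
Variables (t0 : R) (n : nat) (z : R) (n0 : (0 < n)%N) (z1 : expR 1 <= z).
Context d (T : measurableType d) (P : probability T R).
Variables (F : R -> R) (X zeta : 'I_n -> {RV P >-> R}).
Hypotheses (hF : sobolev_class alpha L F) (hM : deconv_model fz F X zeta).

Let lambda := 1 * rate_lambda alpha beta z.
Let psi := rate_psi alpha beta z.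
Let K := deconv_kernel fz t0 lambda.
Let Y j t := X j t + zeta j t.
Let err := est_error (@deconv_estimator R fz t0 lambda n) (F t0) X zeta.

Let z0 : 0 < z. Proof. by apply: lt_le_trans z1; exact: expR_gt0. Qed.
Let psi0 : 0 < psi. Proof. by have [] := hk t0 z1. Qed.
Let bK : bmfun K. Proof. by have [] := hk t0 z1. Qed.
Let KA y : `|K y| <= k * z * psi. Proof. by have [_ _ + _] := hk t0 z1; exact. Qed.
Let A0 : 0 < k * z * psi. Proof. by rewrite !mulr_gt0. Qed.

Let mY j : measurable_fun setT (Y j).
Proof. by apply: measurable_funD; exact: measurable_funPT. Qed.

Let Kv j : \int[P]_t (K (Y j t) ^+ 2) <= k ^+ 2 * z * psi ^+ 2.
Proof. by have [_ _ _ h] := hk t0 z1; have [] := h _ _ _ _ _ _ _ hF hM j. Qed.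

Let Kb j : `|\int[P]_t K (Y j t) - F t0| <= k * psi.
Proof. by have [_ _ _ h] := hk t0 z1; have [] := h _ _ _ _ _ _ _ hF hM j. Qed.

Let factor (g : 'I_n -> R -> R) : (forall j, bmfun (g j)) ->
  \int[P]_t (\prod_j g j (Y j t)) = \prod_j \int[P]_t g j (Y j t).
Proof. by case: hM => _ _ ind; exact: mean_prod_sums ind _. Qed.

Let errE t : err t = `|average Y K t - F t0|.
Proof. by rewrite /err /est_error deconv_estimatorE. Qed.

Let exponentE : n%:R * (k ^+ 2 * z * psi ^+ 2) / (8 * (k * z * psi) ^+ 2) =
  n%:R / (8 * z).
Proof.
have := gt_eqF k0; have := gt_eqF z0; have := gt_eqF psi0.
by move=> /negbT ? /negbT ? /negbT ?; field; apply/and3P.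
Qed.

(** Here A/n = k psi, so the bound of [mean_square_average] is at most
    (256 * 2 + 2) k^2 psi^2 = 514 k^2 psi^2, and 514 <= 23^2. *)
Lemma root_mean_square_error_le : n%:R = z ->
  (('E_P[fun s => (err s ^+ 2)%R] `^ 2^-1)%E <= (23 * k * psi)%:E)%E.
Proof.
move=> nz.
have bA : bmfun (average Y K) by exact: bmfun_average.
have be : bmfun (fun t => `|average Y K t - F t0| ^+ 2).
  by apply: bmfunX; apply: bmfun_norm; apply: bmfunB => //; exact: bmfun_cst.
have -> : ('E_P[fun s => (err s ^+ 2)%R] =
    (\int[P]_t (`|average Y K t - F t0| ^+ 2))%R%:E)%E.
  rewrite unlock /Rintegral fineK; last first.
    by apply: integrable_fin_num => //; exact: bmfun_integrableP.
  by apply: eq_integral => t _; rewrite errE.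
have := mean_square_average n0 mY bK A0 KA Kv Kb factor.
rewrite exponentE nz.
have -> : k * z * psi / z = k * psi by have := gt_eqF z0 => /negbT ?; field.
have -> : z / (8 * z) = 1 / 8 by have := gt_eqF z0 => /negbT ?; field.
have e2 : expR (1 / 8) <= 2 :> R.
  have := @expR_le_quadratic R (1 / 8); rewrite ger0_norm; lra.
have : 0 <= \int[P]_t (`|average Y K t - F t0| ^+ 2).
  by apply: Rintegral_ge0 => t _; exact: sqr_ge0.
move: (\int[P]_t _) => I I0 hI; rewrite poweR_EFin lee_fin.
have Ib : I <= (23 * k * psi) ^+ 2.
  have : 256 * (k * psi) ^+ 2 * expR (1 / 8) <= 256 * (k * psi) ^+ 2 * 2.
    by rewrite ler_wpM2l// mulr_ge0// sqr_ge0.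
  have := sqr_ge0 (k * psi).
  have -> : (23 * k * psi) ^+ 2 = 529 * (k * psi) ^+ 2 by ring.
  lra.
have p0 : 0 <= 23 * k * psi by rewrite !mulr_ge0// ltW.
by rewrite powR12_sqrt// -[leRHS]ger0_norm// -sqrtr_sqr ler_wsqrtr.
Qed.

(** With delta = 8 k psi the exponent is ell/8 - 2 ell <= - ell; the bias adds
    k psi to the distance. *)
Lemma tail_le ell : n%:R = z * ell -> 0 < ell ->
  (P [set s | (9 * k * psi < err s)%R] <= (2 * expR (- ell))%:E)%E.
Proof.
move=> nz ell0.
have := tail_average n0 mY bK A0 KA Kv Kb factor (8 * k * psi).
have -> : 8 * k * psi + k * psi = 9 * k * psi by ring.
rewrite exponentE => h.
have -> : [set s | (9 * k * psi < err s)%R] =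
    [set t | (9 * k * psi < `|average Y K t - F t0|)%R].
  by apply/seteqP; split => t /=; rewrite errE.
apply: (le_trans h); rewrite lee_fin ler_pM2l// ler_expR nz.
have -> : z * ell / (8 * z) = ell / 8 by have := gt_eqF z0 => /negbT ?; field.
have -> : z * ell * (8 * k * psi) / (4 * (k * z * psi)) = 2 * ell.
  have := gt_eqF k0; have := gt_eqF z0; have := gt_eqF psi0.
  by move=> /negbT ? /negbT ? /negbT ?; field; apply/and3P.
lra.
Qed.

End fixed_model.
End risks.

Unset Implicit Arguments.
Set Strict Implicit.

Theorem theorem2p1 (R : realType) (fz : R -> R) (beta : R)
    (fz_density : is_density fz)
    (fz_neq0 : forall w, cmod (fourier fz w) != 0)
    (E1 : cond_E1 fz beta) (E2 : cond_E2 fz)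
    (alpha L : R) (alpha_gt : - (1 / 2) < alpha)
    (alpha_beta : 1 / 2 < alpha + beta) (L_gt0 : 0 < L) :
  exists C1 C2 C3 C4 : R,
    [/\ 0 < C1, 0 < C2, 0 < C3 & 0 < C4] /\
    (exists N : nat, forall (t0 : R) (n : nat), (N <= n)%N ->
       let lambda := C1 * rate_lambda alpha beta n%:R in
       (risk2 fz (@deconv_estimator R fz t0 lambda n) t0 (sobolev_class alpha L)
        <= (C2 * rate_psi alpha beta n%:R)%:E)%E) /\
    (exists N : nat, forall (t0 : R) (n : nat) (eps : R), (N <= n)%N ->
       0 < eps -> eps < 1 / 2 -> 2 * expR (- (C4 * n%:R)) <= eps ->
       let z := n%:R / ln (2 * eps^-1) in
       let lambda := C1 * rate_lambda alpha beta z in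
       (risk_eps eps fz (@deconv_estimator R fz t0 lambda n) t0
          (sobolev_class alpha L)
        <= (C3 * rate_psi alpha beta z)%:E)%E).
Proof.
have [k k0 hk] := exists_kernel_bound fz_density L E1 E2 alpha_gt alpha_beta.
exists 1, (23 * k), (9 * k), (expR 1)^-1; split.
  by split; rewrite ?mulr_gt0// invr_gt0 expR_gt0.
split.
  exists (Num.truncn (expR 1 : R)).+1 => t0 n Nn; cbv zeta.
  have n0 : (0 < n)%N by exact: leq_ltn_trans Nn.
  have ne : expR 1 <= n%:R :> R.
    by apply: (le_trans (ltW (truncnS_gt _))); rewrite ler_nat.
  apply: ub_ereal_sup => _ [F hF [d [T [P [X [zeta [hM ->]]]]]]].
  exact: (root_mean_square_error_le k0 hk t0 n0 ne hF hM).
exists 1 => t0 n eps n0 eps0 eps2 hn; cbv zeta.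
set z := n%:R / ln _.
have ell0 : 0 < ln (2 * eps^-1).
  rewrite ln_gt0// -ltr_pdivrMr ?invr_gt0// invrK; lra.
(* The lower bound on eps says that ln (2/eps) <= n/e, that is z >= e. *)
have ell_le : ln (2 * eps^-1) <= (expR 1)^-1 * n%:R.
  rewrite -ler_expR lnK ?posrE ?mulr_gt0 ?invr_gt0//.
  rewrite ler_pdivrMr//.
  have : 2 * expR (- ((expR 1)^-1 * n%:R)) * expR ((expR 1)^-1 * n%:R) <=
     eps * expR ((expR 1)^-1 * n%:R) by rewrite ler_wpM2r ?expR_ge0.
  by rewrite -mulrA -expRD addNr expR0 mulr1 mulrC.
have nz : n%:R = z * ln (2 * eps^-1) by rewrite /z -mulrA mulVf ?mulr1// gt_eqF.
have z1 : expR 1 <= z.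
  by rewrite /z ler_pdivlMr// -ler_pdivlMl ?expR_gt0.
apply: ereal_inf_lbound; exists (9 * k * rate_psi alpha beta z) => //.
apply: ub_ereal_sup => _ [F hF [d [T [P [X [zeta [hM ->]]]]]]].
apply: (le_trans (tail_le k0 hk t0 n0 z1 hF hM nz ell0)).
rewrite expRN lnK ?posrE ?mulr_gt0 ?invr_gt0// lee_fin invfM invrK.
by rewrite mulrA mulfV ?mul1r.
Qed.
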